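(* Let $p$ be an odd prime and let $\zeta=e^{2\pi i/p}$. Let $a\in\mathbb Z$ with $p\nmid a$. Then $$\begin{aligned}&(-1)^{a\frac{p+1}2\lfloor\frac{p-1}4\rfloor}2^{(p-1)(p-3)/8}\prod_{1\le j<k\le(p-1)/2}\cos\pi\frac{a(k^2-j^2)}p\\=\;&\prod_{1\le j<k\le(p-1)/2}(\zeta^{aj^2}+\zeta^{ak^2})=\begin{cases}1&\text{if } p\equiv3\pmod4,\\ \pm\varepsilon_p^{\left(\frac ap\right)h(p)\left(\left(\frac2p\right)-1\right)/2}&\text{if } p\equiv1\pmod4\end{cases}\end{aligned}$$ (in the case $p\equiv1\pmod 4$ the equality holds for one of the two choices of the sign $\pm$).
   Context: $(\frac{\cdot}{p})$ is the Legendre symbol; empty products equal $1$. For a prime $p\equiv1\pmod4$, $\varepsilon_p>1$ and $h(p)$ are the fundamental unit and the class number of the real quadratic field $\mathbb Q(\sqrt p)$. *)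

(* Defs.v *)
From mathcomp Require Import all_boot all_order all_algebra finmap.
From mathcomp Require Import all_classical all_reals all_analysis.
From mathcomp Require Import complex.

Set Implicit Arguments.
Unset Strict Implicit.
Unset Printing Implicit Defensive.

Import Order.TTheory GRing.Theory Num.Theory.
Local Open Scope classical_set_scope.
Local Open Scope ring_scope.

(* exp (x + i y) = exp x (cos y + i sin y) *)
Definition cexp (R : realType) (z : R[i]) : R[i] :=
  let: Complex x y := z in Complex (expR x * cos y) (expR x * sin y).

Definition zeta (R : realType) (p : nat) : R[i] :=
  cexp (2 * (pi : R)%:C%C * 'i%C / p%:R).

Definition legendre (a : int) (p : nat) : int :=
  if (p %| a)%Z then 0
  else if [exists x : 'I_p, (x%:Z ^+ 2 == a %[mod p])%Z] then 1 else -1.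

(* Q(sqrt d) is realized as a subfield of R, so that the condition
   "epsilon > 1" makes sense for its elements. *)
Definition quad_field (R : realType) (d : nat) : set R :=
  [set x | exists r s : rat, x = ratr r + ratr s * Num.sqrt d%:R].

Definition quad_int (R : realType) (d : nat) : set R :=
  [set x | quad_field d x /\ integralOver (intr : int -> R) x].

Definition quad_unit (R : realType) (d : nat) : set R :=
  [set u | quad_int d u /\ exists2 v, quad_int d v & u * v = 1].

Definition is_fundamental_unit (R : realType) (d : nat) (e : R) : Prop :=
  [/\ quad_unit d e, 1 < e &
      forall u : R, quad_unit d u -> exists n : int, u = e ^ n \/ u = - e ^ n].

(* For d > 1 squarefree there is exactly one e > 1 as above; the value 1 is
   only a default for the other d. *)
Definition fundamental_unit (R : realType) (d : nat) : R :=
  xget 1 [set e : R | is_fundamental_unit d e].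

Definition quad_ideal (R : realType) (d : nat) (I : set R) : Prop :=
  [/\ I `<=` quad_int d, I 0,
      forall x y, I x -> I y -> I (x + y) &
      forall c x, quad_int d c -> I x -> I (c * x)].

Definition nonzero_ideal (R : realType) (d : nat) (I : set R) : Prop :=
  quad_ideal d I /\ exists2 x, I x & x != 0.

(* I ~ J iff alpha I = beta J for some nonzero integers alpha, beta of the
   field. *)
Definition ideal_equiv (R : realType) (d : nat) (I J : set R) : Prop :=
  exists alpha beta : R,
    [/\ quad_int d alpha, alpha != 0, quad_int d beta, beta != 0 &
        [set alpha * x | x in I] = [set beta * x | x in J]].

Definition ideal_class (R : realType) (d : nat) (I : set R) : set (set R) :=
  [set J | nonzero_ideal d J /\ ideal_equiv d I J].

Definition ideal_classes (R : realType) (d : nat) : set (set (set R)) :=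
  [set ideal_class d I | I in nonzero_ideal d].

(* fset_set returns the empty set on infinite sets; the set of ideal classes
   is finite for d > 1 squarefree. *)
Definition class_number (R : realType) (d : nat) : nat :=
  #|` fset_set (@ideal_classes R d)|%fset.

(* Main.v *)
Require Import Defs.
From mathcomp Require Import all_boot all_order all_algebra.
From mathcomp Require Import all_solvable all_field finmap.
From mathcomp Require Import all_classical all_reals all_analysis.
From mathcomp Require Import complex.
From mathcomp Require Import zify ring lra.

(** Write [chi] for the quadratic character modulo [p], [n = (p - 1) / 2], and [P]
    for the product. Each factor is a root of unity times twice a cosine, and the
    roots of unity multiply to a sign: this is the first equality
    ([zeta_product_real]), and it shows that [P] is real.

    Up to sign, [P] is then found from [P ^ 2], the product of the
    [cochord (a (k^2 - j^2)) = |1 + zeta^(a (k^2 - j^2))|^2] over [j < k]. Extended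
    to all pairs of residues, the product over [j, k] becomes, by [s = k - j] and
    [t = k + j], a product over [s] and [t] of [cochord (a s t)], which is
    elementary, because [cochord x = chord (2 x) / chord x] telescopes over the
    nonzero residues. Among all pairs, up to powers of 2, those with [j k = 0]
    contribute a power of the product [Q = chord_char] of the
    [|1 - zeta^d| ^ (2 chi(d))], and the others a power of [P]; the outcome is
    [P ^ 16 Q ^ (2 chi(a) (chi(2) - 1)) = 1] ([real_product_chord_char]).

    If [p = 3 mod 4], then [Q = 1] by parity, so [P] is 1 or -1. A polynomial
    relation over the integers satisfied by zeta holds at 1 modulo [p], since the
    cyclotomic polynomial is [(X - 1)^(p-1)] modulo [p]; there [P] becomes
    [2 ^ 'C(n, 2) = 1], and the sign is determined ([real_product3]).

    If [p = 1 mod 4], the claim becomes [Q = epsilon ^ (-4 h)], Dirichlet's class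
    number formula, which is proved by counting the ideals of norm at most [X] of
    the ring of integers of the quadratic field in two ways.

    On the one hand, every nonzero ideal is [c (Z a + Z (b + omega))] for a unique
    triple [(c, a, b)] with [b] a root modulo [a] of the norm polynomial [Fm]
    ([ideal_normal_form], [jset_inj]). The number of roots is computed by
    quadratic reciprocity ([Fm_root_qchar1], [Fm_root_qcharN1]) and Hensel's
    lemma; it makes the number of ideals the sum over [d <= X] of
    [chi(d) floor (X / d)] ([ideal_countE]), which is [L(1, chi) X] up to
    [O(sqrt X)] ([ideal_count_asymp]). The value [L(1, chi) = - ln Q / (2 sqrt p)]
    comes from the Gauss sum, sign included ([gauss_sum_value], [Lvalue_partial]).

    On the other hand, the ideals in the class of [J] are the [g J] with [g] in the
    inverse of [J], up to units. If [epsilon] is the fundamental unit, exactly one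
    multiple of [g] by a unit is positive and has
    [1 <= |conjugate of g| / g < epsilon^2]. So ideals correspond to
    lattice points in two hyperbolic sectors, one for each sign of the norm, and
    each sector contains [ln epsilon / sqrt p * X + O(sqrt X)] of them
    ([sector_count], [class_triples_asymp]). The two counts yield
    [h * 2 ln epsilon / sqrt p = L(1, chi)] ([class_number_formula]). They also
    yield, before that, the existence of [epsilon] ([fundamental_unitP]) and the
    finiteness of the set of classes ([finite_ideal_classes]), because neither the
    area of a sector nor the number of classes can exceed what [L(1, chi)]
    allows. *)

Set Implicit Arguments.
Unset Strict Implicit.
Unset Printing Implicit Defensive.

Import Order.TTheory GRing.Theory Num.Theory.
Local Open Scope ring_scope.
Local Open Scope complex_scope.

(** * Quadratic residues modulo p *)

Section QuadraticCharacter.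

Variables (p : nat) (p_pr : prime p) (p_odd : odd p).
Let n := ((p - 1) %/ 2)%N.

Definition qchar (x : 'F_p) : int :=
  if x == 0 then 0 else if x ^+ ((p - 1) %/ 2) == 1 then 1 else -1.

Lemma Fp_intr_eq0 (k : int) : ((k%:~R : 'F_p) == 0) = (p %| k)%Z.
Proof. by rewrite (dvdz_pcharf (pchar_Fp p_pr)). Qed.

Lemma Fp_natr_eq0 (k : nat) : ((k%:R : 'F_p) == 0) = (p %| k)%N.
Proof. by rewrite (dvdn_pcharf (pchar_Fp p_pr)). Qed.

Lemma half_double : (n * 2 = p - 1)%N.
Proof. by rewrite /n; have := odd_prime_gt2 p_odd p_pr; move: p_odd; lia. Qed.

Lemma Fp_expf_half (x : 'F_p) : x != 0 -> x ^+ n = 1 \/ x ^+ n = -1.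
Proof.
move=> x0; have : (x ^+ n) ^+ 2 = 1.
  rewrite -exprM half_double; apply: (mulfI x0).
  rewrite -exprS mulr1 subn1 prednK ?prime_gt0 //.
  by have := expf_card x; rewrite card_Fp.
move/eqP; rewrite -subr_eq0 -[X in _ - X](expr1n _ 2) subr_sqr mulf_eq0.
by rewrite subr_eq0 addr_eq0 => /orP[/eqP->|/eqP->]; [left | right].
Qed.

Lemma Fp_neq_opp (x : 'F_p) : x != 0 -> x != - x.
Proof.
move=> x0; rewrite -addr_eq0 -mulr2n -mulr_natl mulf_eq0 negb_or x0 andbT.
rewrite Fp_natr_eq0; apply/negP => /dvdn_leq => /(_ isT).
by rewrite leqNgt odd_prime_gt2.
Qed.

Lemma qcharE (x : 'F_p) : (qchar x)%:~R = x ^+ n.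
Proof.
rewrite /qchar -/n; case: eqVneq => [->|x0].
  have n_gt0 : (0 < n)%N by have := odd_prime_gt2 p_odd p_pr; have := half_double; lia.
  by rewrite expr0n; case: n n_gt0.
by case: eqP => [->//|]; case: (Fp_expf_half x0) => -> // _; rewrite rmorphN.
Qed.

Lemma qchar_range x : [\/ qchar x = 0, qchar x = 1 | qchar x = -1].
Proof.
by rewrite /qchar; case: ifP => _; [apply: Or31 | case: ifP => _; [apply: Or32|apply: Or33]].
Qed.

Lemma qchar_inj (u v : int) : `|u| <= 1 -> `|v| <= 1 ->
  u%:~R = v%:~R :> 'F_p -> u = v.
Proof.
move=> u1 v1 /eqP; rewrite -subr_eq0 -rmorphB /= Fp_intr_eq0 => /dvdzP[k].
move: k => k; have := odd_prime_gt2 p_odd p_pr => p3 uv; have : k = 0 by nia.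
by move=> k0; move: uv; rewrite k0 mul0r => /subr0_eq.
Qed.

Lemma qchar_norm x : `|qchar x| <= 1.
Proof. by case: (qchar_range x) => ->. Qed.

Lemma qchar_eq0 x : (qchar x == 0) = (x == 0).
Proof. by rewrite /qchar; case: ifP => // _; case: ifP. Qed.

Lemma qchar0 : qchar 0 = 0.
Proof. by apply/eqP; rewrite qchar_eq0. Qed.

Lemma qcharM x y : qchar (x * y) = qchar x * qchar y.
Proof.
apply: qchar_inj; rewrite ?qchar_norm //.
  by case: (qchar_range x) => ->; case: (qchar_range y) => ->.
by rewrite rmorphM /= !qcharE exprMn.
Qed.

Lemma qchar1 : qchar 1 = 1.
Proof. by rewrite /qchar oner_eq0 expr1n eqxx. Qed.

Lemma qchar_sqr x : x != 0 -> qchar x ^+ 2 = 1.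
Proof. by rewrite -qchar_eq0; case: (qchar_range x) => ->. Qed.

Lemma qchar_pm1 x : x != 0 -> qchar x = 1 \/ qchar x = -1.
Proof. by rewrite -qchar_eq0; case: (qchar_range x) => ->; [|left|right]. Qed.

Lemma card_sqrt_le (x : 'F_p) : x != 0 -> (#|[pred y : 'F_p | y ^+ 2 == x]| <= 2)%N.
Proof.
move=> x0; case: (pickP [pred y : 'F_p | y ^+ 2 == x]) => [z /= /eqP zx|h].
  apply: (@leq_trans #|[set z; - z]|); last by rewrite cards2 ltnS leq_b1.
  apply: subset_leq_card; apply/fintype.subsetP => y.
  rewrite !inE -zx -subr_eq0 subr_sqr.
  by rewrite mulf_eq0 subr_eq0 addr_eq0.
by rewrite eq_card0.
Qed.

Lemma card_qchar1_le : (#|[pred x : 'F_p | qchar x == 1]| <= n)%N.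
Proof.
have n_gt0 : (0 < n)%N by have := odd_prime_gt2 p_odd p_pr; have := half_double; lia.
have nz : ('X^n - 1%:P : {poly 'F_p}) != 0 by rewrite -size_poly_eq0 size_XnsubC.
rewrite cardE; have := @max_poly_roots _ _ (enum [pred x : 'F_p | qchar x == 1]) nz.
rewrite size_XnsubC // enum_uniq ltnS; apply=> //.
apply/allP => x; rewrite mem_enum !inE rootE !hornerE => /eqP h.
by rewrite subr_eq0 -qcharE h.
Qed.

(** The [p - 1] nonzero [y] are distributed by [y ^+ 2] over the roots of
    [X^n - 1], of which there are at most [n = (p - 1) / 2], with at most two
    [y] over each of them; so every root receives exactly two. *)
Lemma card_sqrt (x : 'F_p) : (#|[pred y : 'F_p | y ^+ 2 == x]|%:Z = 1 + qchar x).
Proof.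
have sq1 (y : 'F_p) : y != 0 -> qchar (y ^+ 2) = 1.
  by move=> y0; rewrite expr2 qcharM -expr2 qchar_sqr.
have [->|x0] := eqVneq x 0.
  rewrite qchar0 addr0; transitivity (Posz #|pred1 (0 : 'F_p)|); last by rewrite card1.
  congr Posz.
  by apply: eq_card => y; rewrite !inE expf_eq0.
case: (qchar_pm1 x0) => hx; last first.
  rewrite hx eq_card0 // => y; rewrite !inE; apply/eqP => yx.
  have y0 : y != 0 by apply: contraNneq x0 => y0; rewrite -yx y0 expr0n.
  by move: hx; rewrite -yx sq1.
have tot : (\sum_(z : 'F_p | qchar z == 1) #|[pred y : 'F_p | y ^+ 2 == z]| = p - 1)%N.
  rewrite (eq_bigr (fun z => \sum_(y : 'F_p | (y ^+ 2 == z) && (y != 0%R)) 1)%N); last first.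
    move=> z /eqP hz; rewrite sum1_card; apply: eq_card => y; rewrite !inE.
    rewrite !unfold_in; case: eqP => //= yz; apply/esym.
    by apply/eqP => y0; move: hz; rewrite -yz y0 expr0n qchar0.
  rewrite (exchange_big_dep (fun y : 'F_p => y != 0)) /=; last by move=> z y _ /andP[].
  rewrite (eq_bigr (fun=> 1%N)); last first.
    move=> y y0; rewrite (eq_bigl (pred1 (y ^+ 2))) ?big_pred1_eq // => z /=.
    rewrite y0 andbT [z == _]eq_sym; case: (y ^+ 2 =P z) => [<-|]; rewrite ?andbF //.
    by rewrite sq1.
  rewrite sum1_card subn1 -[in RHS](card_Fp p_pr) -(cardC1 (0 : 'F_p)).
  by apply: eq_card => y; rewrite !inE.
have le2 z : qchar z == 1 -> (#|[pred y : 'F_p | y ^+ 2 == z]| <= 2)%N.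
  move=> hz; apply: card_sqrt_le; apply/eqP => z0.
  by move: hz; rewrite z0 qchar0.
have hxx : qchar x == 1 by apply/eqP.
move: tot; rewrite (bigD1 x) //=.
set B := (\sum_(i | _) _)%N; set c := #|_| => tot.
set A := [predD1 [pred z : 'F_p | qchar z == 1] & x].
have BA : (B <= #|A| * 2)%N.
  rewrite -sum_nat_const /B big_mkcond [leqRHS]big_mkcond /=; apply: leq_sum => z _.
  by rewrite !inE andbC; case: ifP => // /andP[_ /le2].
have An : (1 + #|A| <= n)%N.
  by have := card_qchar1_le; rewrite (cardD1 x [pred z : 'F_p | qchar z == 1]) [x \in _]hxx.
have c2 : (c <= 2)%N by exact: le2.
clearbody B c; move: (#|A|) BA An half_double => a BA An np.
by rewrite hx; lia.
Qed.

Lemma sum_qchar : \sum_(x : 'F_p) qchar x = 0.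
Proof.
have : \sum_(x : 'F_p) (#|[pred y : 'F_p | y ^+ 2 == x]|%:Z) = p%:Z.
  rewrite -(big_morph Posz PoszD (erefl _)); congr Posz.
  under eq_bigr do rewrite -sum1_card.
  rewrite (exchange_big_dep predT) //= -[RHS](card_Fp p_pr) -sum1_card.
  apply: eq_bigr => y _; rewrite (eq_bigl (pred1 (y ^+ 2))) ?big_pred1_eq //.
  by move=> z; rewrite inE eq_sym.
under eq_bigr do rewrite card_sqrt.
by rewrite big_split /= sumr_const card_Fp // => /(canRL (addKr _)) ->; rewrite natz addNr.
Qed.

Lemma legendreE (a : int) : legendre a p = qchar a%:~R.
Proof.
rewrite /legendre -Fp_intr_eq0; case: ifP => [/eqP->|/negbT a0]; first by rewrite qchar0.
have eqv : [exists x : 'I_p, (x%:Z ^+ 2 == a %[mod p])%Z] =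
           (0 < #|[pred y : 'F_p | y ^+ 2 == a%:~R]|)%N.
  apply/existsP/card_gt0P => [[x hx]|[y]].
    exists (x%:R); rewrite inE -subr_eq0.
    move: hx; rewrite eqz_mod_dvd -Fp_intr_eq0 rmorphB rmorphXn /=.
    by rewrite -pmulrn.
  rewrite inE => hy; have yp : ((y : nat) < p)%N.
    by rewrite -[X in (_ < X)%N](Fp_cast p_pr) ltn_ord.
  exists (Ordinal yp) => /=.
  rewrite eqz_mod_dvd -Fp_intr_eq0 rmorphB rmorphXn /= -pmulrn subr_eq0.
  by rewrite natr_Zp.
rewrite eqv; have := card_sqrt a%:~R.
by case: (qchar_pm1 a0) => ->; case: (#|_|).
Qed.

End QuadraticCharacter.

(** * The root of unity zeta *)

Section RootsOfUnity.

Variable R : realType.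

Definition cis (t : R) : R[i] := cos t +i* sin t.

Lemma cis0 : cis 0 = 1.
Proof. by rewrite /cis cos0 sin0. Qed.

Lemma cisD s t : cis (s + t) = cis s * cis t.
Proof. by rewrite /cis cosD sinD; simpc; congr (_ +i* _); ring. Qed.

Lemma cis_neq0 t : cis t != 0.
Proof.
apply/eqP => h; have := cisD t (- t); rewrite subrr cis0 h mul0r => /eqP.
by rewrite oner_eq0.
Qed.

Lemma cisN t : cis (- t) = (cis t)^-1.
Proof.
by apply: (mulfI (cis_neq0 t)); rewrite -cisD subrr cis0 divff ?cis_neq0.
Qed.

Lemma cisX t (k : int) : cis t ^ k = cis (k%:~R * t).
Proof.
have cisXn (n : nat) : cis t ^+ n = cis (n%:R * t).
  by elim: n => [|n IH]; rewrite ?mul0r ?cis0 ?expr0 // exprS IH -cisD -[n.+1]addn1 natrD mulrDl mul1r addrC.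
case: k => n; first by rewrite -exprnP cisXn -pmulrn.
by rewrite NegzE -exprnN cisXn mulrNz mulNr cisN -pmulrn.
Qed.

Lemma zeta_cis (p : nat) : zeta R p = cis (2 * pi / p%:R).
Proof.
rewrite /zeta.
have -> : 2 * (pi : R)%:C * 'i / p%:R = 0 +i* (2 * pi / p%:R).
  have -> : 2 * (pi : R)%:C * 'i / p%:R = (2 * pi / p%:R)%:C * 'i.
    by rewrite !rmorphM /= fmorphV /= !rmorph_nat mulrAC.
  by simpc.
by rewrite /cexp /cis expR0 !mul1r.
Qed.

Lemma zetaX (p : nat) (k : int) : zeta R p ^ k = cis (2 * pi * k%:~R / p%:R).
Proof. by rewrite zeta_cis cisX; congr cis; ring. Qed.

Lemma cos_lt1 (t : R) : 0 < t < 2 * pi -> cos t != 1.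
Proof.
move=> /andP[t0 t2]; apply/eqP => h.
have ht : t = t / 2 + t / 2 by field.
have : sin (t / 2) = 0.
  have := cos2Dsin2 (t / 2); move: h; rewrite {1}ht cosD -!expr2 => h1 h2.
  by apply/eqP; rewrite -sqrf_eq0; apply/eqP; lra.
have : 0 < sin (t / 2) by apply: sin_gt0_pi; lra.
by move=> /[swap] ->; rewrite ltxx.
Qed.

Lemma cis2pi (k : nat) : cis (2 * pi * k%:R) = 1.
Proof.
rewrite mulrC -(cisX (2 * pi) k) /cis mulrC.
by rewrite (mulr_natr pi 2) cos2pi sin2pi exp1rz.
Qed.

Variables (p : nat) (p_pr : prime p).

Lemma p_neq0 : (p%:R : R) != 0.
Proof. by rewrite pnatr_eq0 -lt0n prime_gt0. Qed.

Lemma zeta_prim : p.-primitive_root (zeta R p).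
Proof.
apply/andP; split; first by rewrite prime_gt0.
apply/forallP => i; rewrite unity_rootE; apply/eqP.
rewrite [zeta R p ^+ _](zetaX p i.+1).
have pp := p_neq0.
have [ip|/eqP ip] := eqVneq i.+1 p.
  by rewrite ip (_ : _ / _ = 2 * pi * 1%:R) ?cis2pi ?eqxx //; field.
apply/negbTE/eqP => -[h _]; move: h; apply/eqP/cos_lt1.
have ip' : (i.+1 < p)%N by have := ltn_ord i; lia.
have pi0 : 0 < (pi : R) by exact: pi_gt0.
have p0 : 0 < (p%:R : R) by rewrite ltr0n prime_gt0.
apply/andP; split; first by rewrite divr_gt0 // mulr_gt0 ?ltr0z // mulr_gt0.
by rewrite ltr_pdivrMr // ltr_pM2l ?mulr_gt0 // -pmulrn ltr_nat.
Qed.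

End RootsOfUnity.

(** * Relations between powers of zeta, modulo p *)

Section CyclotomicDivisibility.

Variables (p : nat) (p_pr : prime p).

Definition Phi : {poly int} := \sum_(i < p) 'X^i.

Lemma PhiM (A : nzRingType) (x : A) : (x - 1) * \sum_(i < p) x ^+ i = x ^+ p - 1.
Proof. by rewrite subrX1. Qed.

Lemma size_Phi : size Phi = p.
Proof.
rewrite /Phi -[RHS](@size_poly_eq int p (fun=> 1)) ?oner_neq0 // poly_def.
by congr (size (polyseq _)); apply: eq_bigr => i _; rewrite scale1r.
Qed.

Lemma Phi_monic : Phi \is monic.
Proof.
apply/monicP; rewrite lead_coefE size_Phi coef_sum.
have p0 := prime_gt0 p_pr.
have lt : (p.-1 < p)%N by lia.
rewrite (bigD1 (Ordinal lt)) //= coefXn eqxx big1 ?addr0 // => i.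
by rewrite -val_eqE /= coefXn eq_sym => /negbTE ->.
Qed.

Lemma map_Phi (A : nzRingType) : map_poly (intr : int -> A) Phi = \sum_(i < p) 'X^i.
Proof. by rewrite rmorph_sum; apply: eq_bigr => i _ /=; rewrite map_polyXn. Qed.

Lemma Phi_root (A : idomainType) (z : A) : p.-primitive_root z ->
  (map_poly intr Phi).[z] = 0.
Proof.
move=> zp; rewrite map_Phi horner_sum; under eq_bigr do rewrite hornerXn.
have z1 : z - 1 != 0.
  rewrite subr_eq0; apply/eqP => z1.
  have := prim_order_dvd zp 1; rewrite expr1 z1 eqxx dvdn1 => /eqP p1.
  by have := prime_gt1 p_pr; rewrite p1.
by apply: (mulfI z1); rewrite PhiM prim_expr_order // subrr mulr0.
Qed.

(** [Phi] is irreducible over the rationals, being the minimal polynomial of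
    the primitive [p]-th roots of unity among algebraic numbers. *)
Lemma Phi_rat_dvd (F : {poly rat}) (A : numFieldType) (z : A) :
  p.-primitive_root z -> root (map_poly ratr F) z ->
  (map_poly intr Phi %| F)%R.
Proof.
move=> zp Fz; have [w wp] := C_prim_root_exists (prime_gt0 p_pr).
have [P [Pmin Pmon] PP] := minCpolyP w.
have ratPhi (B : numFieldType) : map_poly (ratr : rat -> B) (map_poly intr Phi) = map_poly intr Phi.
  by rewrite !map_Phi rmorph_sum; apply: eq_bigr => i _ /=; rewrite map_polyXn.
have PPhi : map_poly intr Phi = P.
  have dP : (P %| map_poly intr Phi)%R.
    rewrite -PP /root; have := Phi_root wp.
    by rewrite -[map_poly intr Phi](ratPhi algC) => ->.
  have : size P = p.
    rewrite -(size_map_poly (ratr : {rmorphism rat -> algC})) /= -Pmin.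
    rewrite (minCpoly_cyclotomic wp) size_cyclotomic totient_prime //.
    by rewrite prednK ?prime_gt0.
  move=> sP; apply/eqP; rewrite -eqp_monic //; last first.
    by apply: monic_map; exact: Phi_monic.
  rewrite eqp_sym -dvdp_size_eqp // sP.
  by rewrite size_map_inj_poly ?size_Phi //; exact: intr_inj.
rewrite PPhi; set d := gcdp P F.
have [e Pe] : exists e, P = e * d by apply/dvdpP/dvdp_gcdl.
have : root (map_poly ratr P) w by rewrite PP.
rewrite {1}Pe rmorphM rootM !PP => /orP[]; last first.
  by move=> h; apply: dvdp_trans h _; exact: dvdp_gcdr.
move=> Pdvde; have P0 : P != 0 by exact: monic_neq0.
have e0 : e != 0 by apply: contraNneq P0 => e0; rewrite Pe e0 mul0r.
have d0 : d != 0 by apply: contraNneq P0 => d0; rewrite Pe d0 mulr0.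
have cop : coprimep P F.
  rewrite /coprimep -/d eqn_leq size_poly_gt0 d0 andbT.
  have := dvdp_leq e0 Pdvde; rewrite Pe size_mul //.
  have : (0 < size d)%N by rewrite size_poly_gt0.
  have : (0 < size e)%N by rewrite size_poly_gt0.
  lia.
move: cop; rewrite -(coprimep_map (ratr : {rmorphism rat -> A})) /=.
move/coprimep_root => /(_ z); rewrite -{1}PPhi ratPhi /root Phi_root // eqxx.
by move=> /(_ isT); rewrite (rootP Fz) eqxx.
Qed.

Lemma Phi_int_dvd (F : {poly int}) (A : numFieldType) (z : A) :
  p.-primitive_root z -> root (map_poly intr F) z ->
  exists G, F = G * Phi.
Proof.
move=> zp Fz; have := Pdiv.RingMonic.rdivp_eq Phi_monic F.
set G := Pdiv.CommonRing.rdivp F Phi; set r := Pdiv.CommonRing.rmodp F Phi => Fe.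
have intrat (H : {poly int}) : map_poly (ratr : rat -> A) (map_poly intr H) = map_poly intr H.
  by apply/polyP => i; rewrite !coef_map /= rmorph_int.
have : ((map_poly intr Phi : {poly rat}) %| map_poly intr F)%R.
  by apply: Phi_rat_dvd zp _; rewrite intrat.
rewrite {1}Fe rmorphD rmorphM /= dvdp_addr ?dvdp_mull // => dr.
exists G; rewrite {1}Fe; suff -> : r = 0 by rewrite addr0.
have szr : (size r < size Phi)%N.
  by apply: Pdiv.Ring.ltn_rmodpN0; exact: monic_neq0 Phi_monic.
have inj : injective (intr : int -> rat) by exact: intr_inj.
apply/eqP; apply: contraTT dr => r0; rewrite gtNdvdp //.
  by rewrite map_poly_eq0_id0 ?intr_eq0 // lead_coef_eq0.
by rewrite !size_map_inj_poly.
Qed.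

Lemma Phi_modp : map_poly intr Phi = ('X - 1) ^+ p.-1 :> {poly 'F_p}.
Proof.
have X1 : ('X - 1 : {poly 'F_p}) != 0 by rewrite -polyC1 polyXsubC_eq0.
apply: (mulfI X1); rewrite map_Phi PhiM -exprS prednK ?prime_gt0 //.
have chP : p \in [pchar {poly 'F_p}] by rewrite pchar_poly pchar_Fp.
rewrite -(pFrobenius_autE chP ('X - 1)) pFrobenius_autB_comm; last exact: commr1.
by rewrite pFrobenius_autE pFrobenius_aut1.
Qed.

(** Since [Phi] is [(X-1)^(p-1)] modulo [p], an integral relation for [zeta]
    gives the vanishing modulo [p] of its first [p-1] Taylor coefficients
    at 1. *)
Lemma zeta_relation_modp (F : {poly int}) (A : numFieldType) (z : A) (i : nat) :
  p.-primitive_root z -> (map_poly intr F).[z] = 0 -> (i < p.-1)%N ->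
  (map_poly (intr : int -> 'F_p) F \Po ('X + 1))`_i = 0.
Proof.
move=> zp Fz ip; have [G ->] := Phi_int_dvd zp (introT rootP Fz).
rewrite rmorphM /= Phi_modp comp_polyM rmorphXn /= comp_polyB comp_polyX.
by rewrite -polyC1 comp_polyC addrK coefMXn ip.
Qed.

End CyclotomicDivisibility.

(** * Gauss sums, and products over residues *)

Section FpBigop.

Variables (p : nat) (p_pr : prime p).

Lemma big_Fp (T : Type) (idx : T) (op : T -> T -> T) (P : pred 'F_p) (F : 'F_p -> T) :
  \big[op/idx]_(x : 'F_p | P x) F x = \big[op/idx]_(0 <= j < p | P j%:R) F j%:R.
Proof.
have gen m : m = (Zp_trunc (pdiv p)).+2 ->
    \big[op/idx]_(x : 'F_p | P x) F x = \big[op/idx]_(0 <= j < m | P j%:R) F j%:R.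
  by move=> ->; rewrite big_mkord; apply: eq_big => [x|x _]; rewrite natr_Zp.
by apply: gen; rewrite Fp_cast.
Qed.

Lemma big_Fp_neq0 (T : Type) (idx : T) (op : T -> T -> T) (F : 'F_p -> T) :
  \big[op/idx]_(x : 'F_p | x != 0) F x = \big[op/idx]_(1 <= j < p) F j%:R.
Proof.
rewrite big_Fp big_ltn_cond ?prime_gt0 //= big_nat_cond [RHS]big_nat_cond.
apply: eq_bigl => j; rewrite Fp_natr_eq0 // andbT.
case H: (0 < j < p)%N => //=; case/andP: H => j1 jp; apply/negP => /dvdn_leq => /(_ j1).
by rewrite leqNgt jp.
Qed.

End FpBigop.

Section AdditiveCharacter.

Variables (p : nat) (p_pr : prime p).
Variables (A : fieldType) (z : A) (zp : p.-primitive_root z).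

Definition addchar (x : 'F_p) : A := z ^+ x.

Lemma addchar_nat (k : nat) : addchar k%:R = z ^+ k.
Proof. by rewrite /addchar val_Fp_nat // prim_expr_mod. Qed.

Lemma addchar0 : addchar 0 = 1.
Proof. by rewrite /addchar expr0. Qed.

Lemma addcharD x y : addchar (x + y) = addchar x * addchar y.
Proof. by rewrite -[x]natr_Zp -[y]natr_Zp -natrD !addchar_nat exprD. Qed.

Lemma prim_root_neq0 : z != 0.
Proof.
apply/eqP => z0; have := prim_expr_order zp.
by rewrite z0 expr0n eqn0Ngt prime_gt0 //= => /eqP; rewrite eq_sym oner_eq0.
Qed.

Lemma addchar_neq0 x : addchar x != 0.
Proof. by rewrite expf_neq0 // prim_root_neq0. Qed.

Lemma addcharN x : addchar (- x) = (addchar x)^-1.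
Proof.
by apply: (mulfI (addchar_neq0 x)); rewrite -addcharD subrr addchar0 divff ?addchar_neq0.
Qed.

Lemma addchar_int (k : int) : addchar k%:~R = z ^ k.
Proof.
case: k => k; first by rewrite -pmulrn addchar_nat.
by rewrite NegzE mulrNz addcharN -pmulrn addchar_nat -exprnN.
Qed.

Lemma addchar_eq1 x : (addchar x == 1) = (x == 0).
Proof.
rewrite /addchar -(prim_order_dvd zp) -val_eqE /=.
have xp : (x < p)%N by rewrite -[X in (_ < X)%N](Fp_cast p_pr) ltn_ord.
by rewrite /dvdn modn_small.
Qed.

Lemma sum_addchar (a : 'F_p) : a != 0 -> \sum_x addchar (a * x) = 0.
Proof.
move=> a0; set S := \sum_x _.
have : addchar a * S = S.
  rewrite /S big_distrr /= [RHS](reindex_inj (addrI 1)) /=.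
  by apply: eq_bigr => x _; rewrite mulrDr mulr1 addcharD.
move/eqP; rewrite -subr_eq0 -[X in _ - X]mul1r -mulrBl mulf_eq0 subr_eq0.
by rewrite addchar_eq1 (negbTE a0) => /eqP.
Qed.

Definition gauss_sum : A := \sum_x (qchar x)%:~R * addchar x.

Hypothesis p_odd : odd p.

Lemma gauss_sum_twist (a : 'F_p) :
  \sum_x (qchar x)%:~R * addchar (a * x) = (qchar a)%:~R * gauss_sum.
Proof.
have [->|a0] := eqVneq a 0.
  rewrite qchar0 mul0r; under eq_bigr do rewrite mul0r addchar0 mulr1.
  by rewrite -rmorph_sum /= sum_qchar.
rewrite /gauss_sum [in RHS](reindex_inj (mulfI a0)) /= mulr_sumr.
apply: eq_bigr => x _; rewrite mulrA -rmorphM /= qcharM // mulrA -expr2 qchar_sqr //.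
by rewrite mul1r.
Qed.

(** Expand one factor and absorb it into the other by [gauss_sum_twist]: what
    multiplies [qchar y] is the full sum of [addchar (x * (1 + y))], which
    vanishes unless [y = -1]. *)
Lemma gauss_sum_sqr : gauss_sum ^+ 2 = (qchar (-1 : 'F_p))%:~R * p%:R.
Proof.
rewrite expr2 {1}/gauss_sum mulr_suml.
under eq_bigr => x _ do rewrite mulrAC -gauss_sum_twist mulr_suml.
set u : 'F_p := -1; rewrite exchange_big /= (bigD1 u) //= [X in _ + X]big1 => [|y y1].
  transitivity (\sum_(x : 'F_p) (qchar u)%:~R : A); last first.
    by rewrite sumr_const card_Fp // mulr_natr.
  rewrite addr0; apply: eq_bigr => x _.
  by rewrite -mulrA -addcharD /u mulrN1 addNr addchar0 mulr1.
under eq_bigr => x _ do rewrite -mulrA -addcharD -{2}[x]mul1r [x * y]mulrC -mulrDl.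
by rewrite -mulr_sumr sum_addchar ?mulr0 // addr_eq0.
Qed.

(** Evaluate at 1 the factorization of [1 + X + ... + X^(p-1)]. *)
Lemma prod_1_sub_addchar : \prod_(x | x != 0) (1 - addchar x) = p%:R.
Proof.
have := factor_Xn_sub_1 zp; rewrite big_mkord => h.
have X1 : ('X - 1 : {poly A}) != 0 by rewrite -polyC1 polyXsubC_eq0.
have hh : \prod_(1 <= i < p) ('X - (z ^+ i)%:P) = \sum_(i < p) 'X^i.
  apply: (mulfI X1); rewrite PhiM -h -(big_mkord xpredT (fun i => 'X - (z ^+ i)%:P)).
  by rewrite [in RHS]big_ltn ?prime_gt0 // expr0.
have := congr1 (fun q : {poly A} => q.[1]) hh; rewrite horner_prod horner_sum.
under [X in _ = X]eq_bigr do rewrite hornerXn expr1n.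
rewrite sumr_const card_ord => <-; rewrite big_Fp_neq0 //.
by apply: eq_bigr => i _; rewrite !hornerE addchar_nat.
Qed.

End AdditiveCharacter.

Section ParityProducts.

Variables (p : nat) (p_pr : prime p) (p_odd : odd p).
Let n := ((p - 1) %/ 2)%N.

Lemma Fp_half_prod (A : comNzRingType) (F : 'F_p -> A) :
  \prod_(x : 'F_p | x != 0) F x =
  \prod_(1 <= j < n.+1) (F j%:R * F (- j%:R)).
Proof.
have hn := half_double p_pr p_odd; rewrite -/n in hn.
have p3 := odd_prime_gt2 p_odd p_pr.
rewrite big_Fp_neq0 // big_split /= (@big_cat_nat _ _ _ n.+1) //=; last lia.
congr (_ * _); rewrite -{1}[n.+1]add0n big_addn [RHS]big_add1 /= big_nat_rev /=.
have -> : (p - n.+1 = n)%N by lia.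
apply: eq_big_nat => i /andP[_ i_n]; congr F; apply/esym/eqP.
rewrite add0n eq_sym -addr_eq0 -natrD Fp_natr_eq0 //.
by have -> : (n - i.+1 + n.+1 + i.+1 = p)%N by lia.
Qed.

Lemma Fp_half_prod_even (A : comNzRingType) (F : 'F_p -> A) :
  (forall x, F (- x) = F x) ->
  \prod_(x : 'F_p | x != 0) F x = (\prod_(1 <= j < n.+1) F j%:R) ^+ 2.
Proof.
by move=> Fe; rewrite Fp_half_prod expr2 -big_split; apply: eq_bigr => j _; rewrite Fe.
Qed.

End ParityProducts.

Lemma big_triangle_recr (T : Type) (idx : T) (op : Monoid.com_law idx)
    (f : nat -> nat -> T) (N : nat) :
  \big[op/idx]_(1 <= j < N.+2) \big[op/idx]_(j.+1 <= k < N.+2) f j k =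
  op (\big[op/idx]_(1 <= j < N.+1) \big[op/idx]_(j.+1 <= k < N.+1) f j k)
     (\big[op/idx]_(1 <= j < N.+1) f j N.+1).
Proof.
rewrite big_nat_recr //= [X in op _ X]big_geq // Monoid.mulm1 -big_split /=.
by apply: eq_big_nat => j /andP[_ jN]; rewrite big_nat_recr.
Qed.

Lemma prod_sym_triangle (A : comNzRingType) (f : nat -> nat -> A) (N : nat) :
  (forall j k, f j k = f k j) ->
  \prod_(1 <= j < N.+1) \prod_(1 <= k < N.+1) f j k =
  \prod_(1 <= j < N.+1) f j j *
    (\prod_(1 <= j < N.+1) \prod_(j.+1 <= k < N.+1) f j k) ^+ 2.
Proof.
move=> fs; elim: N => [|N IH]; first by rewrite !big_geq // expr1n mulr1.
rewrite big_triangle_recr /= exprMn big_nat_recr //= [X in _ * X]big_nat_recr //=.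
under eq_big_nat => j _ do rewrite big_nat_recr //=.
rewrite big_split /= IH (eq_big_nat _ _ (F1 := f N.+1) (F2 := fun i => f i N.+1)) //.
by rewrite [in RHS]big_nat_recr //=; ring.
Qed.

(** * Products of chords of the regular polygon *)

Section CosineProducts.

Variables (R : realType) (p : nat) (p_pr : prime p) (p_odd : odd p).
Let n := ((p - 1) %/ 2)%N.
Let zp := zeta_prim R p_pr.

Definition cosp (x : 'F_p) : R := cos (2 * pi * (x : nat)%:R / p%:R).
Definition sinp (x : 'F_p) : R := sin (2 * pi * (x : nat)%:R / p%:R).

Lemma addchar_cis (x : 'F_p) : addchar (zeta R p) x = cosp x +i* sinp x.
Proof. exact: (zetaX R p (x : nat)). Qed.

Lemma cosp_int (k : int) : cosp k%:~R = cos (2 * pi * k%:~R / p%:R).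
Proof.
have := addchar_int p_pr zp k; rewrite addchar_cis zetaX => -[-> _]; by [].
Qed.

Lemma cosp_nat (k : nat) : cosp k%:R = cos (2 * pi * k%:R / p%:R).
Proof. exact: (cosp_int k). Qed.

Lemma cosp0 : cosp 0 = 1.
Proof. by rewrite /cosp mulr0 mul0r cos0. Qed.

Lemma cospN x : cosp (- x) = cosp x.
Proof.
rewrite -[x]natr_Zp -[_%:R]/((x : nat)%:~R) -rmorphN /= !cosp_int.
by rewrite rmorphN /= mulrN mulNr cosN.
Qed.

Lemma cosp_sqr x : cosp (x + x) = 2 * cosp x ^+ 2 - 1.
Proof.
have := addcharD p_pr zp x x; rewrite !addchar_cis; simpc => -[-> _].
by have := cos2Dsin2 (2 * pi * (x : nat)%:R / p%:R : R); rewrite -/(cosp x) -/(sinp x); lra.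
Qed.

Lemma cosp_eq1 x : x != 0 -> cosp x != 1.
Proof.
move=> x0; apply: cos_lt1.
have pi0 : 0 < (pi : R) by exact: pi_gt0.
have p0 : 0 < (p%:R : R) by rewrite ltr0n prime_gt0.
have xp : ((x : nat) < p)%N by rewrite -[X in (_ < X)%N](Fp_cast p_pr) ltn_ord.
have x0' : (0 < (x : nat))%N by rewrite lt0n; apply: contra_neq x0 => /= h; exact/val_inj.
apply/andP; split; first by rewrite divr_gt0 // mulr_gt0 ?ltr0n // mulr_gt0.
by rewrite ltr_pdivrMr // ltr_pM2l ?mulr_gt0 // ltr_nat.
Qed.

(** [|1 - zeta^x|^2] and [|1 + zeta^x|^2]; being real, they can be raised to the
    power of a character and fed to the logarithm. *)
Definition chord (x : 'F_p) : R := 2 - 2 * cosp x.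
Definition cochord (x : 'F_p) : R := 2 + 2 * cosp x.

Lemma chord_gt0 x : x != 0 -> 0 < chord x.
Proof.
move=> /cosp_eq1 x1; have := cos_le1 (2 * pi * (x : nat)%:R / p%:R : R).
by rewrite -/(cosp x) le_eqVlt (negbTE x1) /= /chord; lra.
Qed.

Lemma chordN x : chord (- x) = chord x. Proof. by rewrite /chord cospN. Qed.

Lemma cochordN x : cochord (- x) = cochord x. Proof. by rewrite /cochord cospN. Qed.

Lemma cochord0 : cochord 0 = 4. Proof. by rewrite /cochord cosp0; lra. Qed.

Lemma cochord_chord x : cochord x * chord x = chord (2 * x).
Proof. have -> : 2 * x = x + x by rewrite mulr_natl mulr2n.
by rewrite /cochord /chord cosp_sqr; ring. Qed.

Lemma chord_addchar x :
  (chord x)%:C = (1 - addchar (zeta R p) x) * (1 - addchar (zeta R p) (- x)).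
Proof.
have h := cos2Dsin2 (2 * pi * (x : nat)%:R / p%:R : R); rewrite -/(cosp x) -/(sinp x) in h.
have : addchar (zeta R p) x * addchar (zeta R p) (- x) = 1.
  by rewrite -addcharD // subrr addchar0.
rewrite !addchar_cis cospN; simpc => -[h1 h2].
congr (_ +i* _); rewrite /chord.
  by lra.
have : sinp (- x) = - sinp x by move: h1 h2 h; nra.
by move=> ->; lra.
Qed.

Lemma prod_chord : \prod_(x | x != 0) chord x = p%:R ^+ 2.
Proof.
apply: complexI; rewrite rmorph_prod /=.
under eq_bigr => x _ do rewrite chord_addchar.
rewrite big_split /= prod_1_sub_addchar // [X in _ * X](reindex_inj oppr_inj) /=.
under [X in _ * X]eq_bigl => x do rewrite oppr_eq0.
under [X in _ * X]eq_bigr => x _ do rewrite opprK.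
by rewrite prod_1_sub_addchar // rmorphXn rmorph_nat expr2.
Qed.

Lemma Fp2_neq0 : (2%:R : 'F_p) != 0.
Proof. by rewrite mulr2n addr_eq0 eq_sym eq_sym (Fp_neq_opp p_pr p_odd) ?oner_neq0. Qed.

(** [cochord x = chord (2 x) / chord x], and [x |-> 2 x] permutes the nonzero
    residues. *)
Lemma prod_cochord : \prod_(x | x != 0) cochord x = 1.
Proof.
have h : \prod_(x | x != 0) chord x != 0.
  by rewrite prod_chord expf_neq0 // pnatr_eq0 -lt0n prime_gt0.
apply: (mulIf h); rewrite mul1r -big_split /=.
under eq_bigr => x _ do rewrite cochord_chord.
rewrite [RHS](reindex_inj (mulfI Fp2_neq0)) /=.
by apply: eq_bigl => x; rewrite mulf_eq0 (negbTE Fp2_neq0).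
Qed.

Lemma prod_cochordM (a : 'F_p) : a != 0 -> \prod_(x | x != 0) cochord (a * x) = 1.
Proof.
move=> a0; rewrite -[RHS]prod_cochord [RHS](reindex_inj (mulfI a0)) /=.
by apply: eq_bigl => x; rewrite mulf_eq0 (negbTE a0).
Qed.

Lemma cochord_gt0 x : x != 0 -> 0 < cochord x.
Proof.
move=> x0; have x2 : 0 < chord (2 * x).
  by apply: chord_gt0; rewrite mulf_neq0 // Fp2_neq0.
by move: x2; rewrite -cochord_chord pmulr_lgt0 // chord_gt0.
Qed.

Lemma prod_diff_sqr (A : comNzRingType) (F : 'F_p -> A) :
  \prod_(j : 'F_p) \prod_(k : 'F_p) F (k ^+ 2 - j ^+ 2) =
  \prod_(s : 'F_p) \prod_(t : 'F_p) F (s * t).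
Proof.
rewrite !pair_big /=.
pose h (u : 'F_p * 'F_p) : 'F_p * 'F_p := (u.2 - u.1, u.2 + u.1).
have F2 := Fp2_neq0.
have hinj : injective h.
  move=> u v E; have h1 : u.2 - u.1 = v.2 - v.1 := congr1 fst E.
  have h2 : u.2 + u.1 = v.2 + v.1 := congr1 snd E.
  have e2 : u.2 = v.2.
    apply: (mulfI F2); rewrite !mulr_natl !mulr2n.
    have dbl (w : 'F_p * 'F_p) : w.2 + w.2 = (w.2 - w.1) + (w.2 + w.1).
      by rewrite addrACA addNr addr0.
    by rewrite !dbl h1 h2.
  by move: h2; rewrite e2 => /addrI e1; rewrite [u]surjective_pairing e1 e2 -surjective_pairing.
rewrite [RHS](reindex_inj hinj) /=; apply: eq_bigr => -[j k] _ /=.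
by rewrite subr_sqr.
Qed.

(** Summing over all pairs of residues, the substitution [s = k - j],
    [t = k + j] turns [k^2 - j^2] into [s t], and the inner product over [t]
    is trivial for [s != 0]. Each pair [j < k] of the triangle occurs 8 times,
    by symmetry and by the signs of [j] and [k]; the pairs with [j = 0] or
    [k = 0] give the other factor. *)
Lemma prod_cochord_triangle (a : 'F_p) : a != 0 ->
  (\prod_(s : 'F_p | s != 0) cochord (a * s ^+ 2)) ^+ 2 *
  (\prod_(1 <= j < n.+1) \prod_(j.+1 <= k < n.+1)
     cochord (a * (k%:R ^+ 2 - j%:R ^+ 2))) ^+ 8 = 1.
Proof.
move=> a0; set V := \prod_(s | _) _; set T := \prod_(1 <= j < _) _.
pose f (j k : 'F_p) := cochord (a * (k ^+ 2 - j ^+ 2)).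
have fsym j k : f j k = f k j by rewrite /f -opprB mulrN cochordN.
have fN j k : f j (- k) = f j k by rewrite /f sqrrN.
have full : \prod_j \prod_k f j k = 4 ^+ (p + p.-1).
  rewrite /f (prod_diff_sqr (fun x => cochord (a * x))) (bigD1 (0 : 'F_p)) //=.
  rewrite exprD; congr (_ * _).
    under eq_bigr do rewrite mul0r mulr0 cochord0.
    by rewrite prodr_const card_Fp.
  transitivity (\prod_(s : 'F_p | s != 0) (4 : R)).
    apply: eq_bigr => s s0; rewrite (bigD1 (0 : 'F_p)) //= !mulr0 cochord0.
    under eq_bigr do rewrite mulrA.
    by rewrite prod_cochordM ?mulr1 // mulf_neq0.
  rewrite prodr_const; congr (_ ^+ _).
  by have := cardC1 (0 : 'F_p); rewrite card_Fp // => {2}<-; apply: eq_card.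
have split : \prod_j \prod_k f j k =
    (4 * V ^+ 2) * \prod_(j | j != 0) \prod_(k | k != 0) f j k.
  rewrite (bigD1 (0 : 'F_p)) //= (bigD1 (0 : 'F_p)) //=.
  have -> : \prod_(k | k != 0) f 0 k = V.
    by apply: eq_bigr => k _; rewrite /f expr0n subr0.
  rewrite {1}/f subrr mulr0 cochord0 expr2 -!mulrA; congr (4 * (V * _)).
  have -> : V = \prod_(j | j != 0) f j 0.
    by apply: eq_bigr => j _; rewrite fsym /f expr0n subr0.
  by rewrite -big_split; apply: eq_bigr => j _; rewrite (bigD1 (0 : 'F_p)).
have W : \prod_(j | j != 0) \prod_(k | k != 0) f j k = (4 ^+ n * T ^+ 2) ^+ 4.
  rewrite (Fp_half_prod_even p_pr p_odd); last first.
    by move=> j; apply: eq_bigr => k _; rewrite fsym fN fsym.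
  under eq_bigr => j _ do rewrite (Fp_half_prod_even p_pr p_odd) //.
  rewrite prodrXl -exprM /=; congr (_ ^+ _).
  rewrite (prod_sym_triangle _ (fun j k => fsym j%:R k%:R)); congr (_ * _).
  under eq_bigr do rewrite /f subrr mulr0 cochord0.
  by rewrite big_const_nat iter_mulr_1 subn1.
move: full; rewrite split W => H.
have h4 : (4 : R) ^+ (p + p.-1) != 0 by rewrite expf_neq0 // pnatr_eq0.
apply: (mulIf h4); rewrite mul1r -[in RHS]H.
have -> : (4 : R) ^+ (p + p.-1) = 4 * (4 ^+ n) ^+ 4.
  rewrite -exprM -exprS; congr (_ ^+ _).
  by have := half_double p_pr p_odd; have := odd_prime_gt2 p_odd p_pr; rewrite -/n; lia.
rewrite exprMn -!exprM /=; ring.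
Qed.

End CosineProducts.

(** * The product as a product of cosines *)

Section CosineForm.

Variables (R : realType) (p : nat) (p_pr : prime p) (p_odd : odd p).
Let n := ((p - 1) %/ 2)%N.

(** Factoring out the half-angle phase turns each sum of two powers of zeta into
    a real cosine. *)
Lemma cis_add_cis (s t : R) :
  cis (s + s) + cis (t + t) = cis (s + t) * (2 * cos (t - s))%:C.
Proof.
have hs := cos2Dsin2 s; have ht := cos2Dsin2 t.
rewrite /cis !(cosD, sinD, cosN, sinN); simpc.
congr (_ +i* _).
  rewrite [RHS](_ : _ = 2 * (cos s ^+ 2 * cos t ^+ 2 - sin s ^+ 2 * sin t ^+ 2)); last by ring.
  have s2 : sin s ^+ 2 = 1 - cos s ^+ 2 by rewrite -hs; ring.
  have t2 : sin t ^+ 2 = 1 - cos t ^+ 2 by rewrite -ht; ring.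
  by rewrite -!expr2 s2 t2; ring.
rewrite [RHS](_ : _ = 2 * (sin s * cos s * (cos t ^+ 2 + sin t ^+ 2)
    + cos t * sin t * (cos s ^+ 2 + sin s ^+ 2))); last by ring.
by rewrite hs ht; ring.
Qed.

Lemma cis_pi (m : int) : cis (m%:~R * (pi : R)) = ((-1) ^ m)%:C.
Proof.
have e : cis (pi : R) = -1 by rewrite /cis cospi sinpi; simpc.
by rewrite -cisX e (fmorphXz (real_complex R)) /= rmorphN1.
Qed.

Lemma bin3E (N : nat) : (6 * 'C(N.+1, 3) = N.+1 * N * N.-1)%N.
Proof. by have := bin_ffact N.+1 3; rewrite !ffactnS ffactn0 /= (_ : 3`! = 6)%N //; lia. Qed.

Lemma sum_triangle_sqr (N : nat) :
  (\sum_(1 <= j < N.+1) \sum_(j.+1 <= k < N.+1) (j ^ 2 + k ^ 2) = (N * 2 + 1) * 'C(N.+1, 3))%N.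
Proof.
elim: N => [|N IH]; first by rewrite big_geq.
rewrite big_triangle_recr /= IH big_split /= sum_nat_const_nat.
have S2 : (6 * \sum_(1 <= j < N.+1) j ^ 2 = N * N.+1 * (N * 2 + 1))%N.
  elim: (N) => [|M IHM]; first by rewrite big_geq.
  by rewrite big_nat_recr //= mulnDr IHM; lia.
have H1 : (6 * ((N * 2 + 1) * 'C(N.+1, 3)) = (N * 2 + 1) * (N.+1 * N * N.-1))%N.
  by rewrite mulnCA bin3E.
have H2 : (6 * ((N.+1 * 2 + 1) * 'C(N.+2, 3)) = (N.+1 * 2 + 1) * (N.+2 * N.+1 * N))%N.
  by rewrite mulnCA bin3E.
move: (_ * 'C(N.+1, 3))%N (_ * 'C(N.+2, 3))%N S2 H1 H2 => c d.
by case: N {IH} => [|N] /=; lia.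
Qed.

Lemma sum_triangle1 (N : nat) :
  (\sum_(1 <= j < N.+1) \sum_(j.+1 <= k < N.+1) 1 = 'C(N, 2))%N.
Proof.
elim: N => [|N IH]; first by rewrite big_geq.
by rewrite big_triangle_recr /= IH sum_nat_const_nat muln1 subn1 /= binS bin1 addnC.
Qed.

Lemma binS3_parity (N : nat) : odd 'C(N.+1, 3) = odd (N.+1 * (N %/ 2)).
Proof.
have C3 := bin3E N.
have [No|Ne] := boolP (odd N).
  have [m Nm] : exists m, N = (m * 2 + 1)%N by exists (N %/ 2)%N; lia.
  have -> : (N %/ 2 = m)%N by lia.
  move: C3; rewrite Nm /=.
  have [t ht] : exists t, (m * m.+1 = t * 2)%N.
    exists (m * m.+1 %/ 2)%N; rewrite divnK // dvdn2 oddM /=; by case: (odd m).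
  rewrite oddM /= !addn1 /= oddM andbF /= => C3.
  by nia.
have [m Nm] : exists m, N = (m * 2)%N by exists (N %/ 2)%N; lia.
have -> : (N %/ 2 = m)%N by lia.
move: C3; rewrite Nm oddM /= oddM andbF /=.
by case: m {Nm} => [|m] /=; nia.
Qed.

(** The real number that the statement claims to be the product, kept as one
    constant because everything after [zeta_product_real] is about it. *)
Definition real_product (a : int) : R :=
  (-1) ^ (a * ((p + 1) %/ 2)%N%:Z * ((p - 1) %/ 4)%N%:Z)
        * 2 ^+ ((p - 1) * (p - 3) %/ 8)%N *
    (\prod_(1 <= j < n.+1) \prod_(j.+1 <= k < n.+1)
      cos (pi * (a * (k%:Z ^+ 2 - j%:Z ^+ 2))%:~R / p%:R)).

Lemma signz_parity (a : int) (u v : nat) : odd u = odd v ->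
  (-1) ^ (a * u%:Z) = (-1) ^ (a * v%:Z) :> R.
Proof.
have E (m : nat) : (-1) ^ (a * m%:Z) = (if odd m then (-1) ^ a else 1) :> R.
  rewrite -exprz_exp -exprnP -{1}(odd_double_half m) exprD -mul2n exprM.
  have -> : ((-1) ^ a) ^+ 2 = 1 :> R.
    by rewrite expr2 -expfzMl mulrNN mulr1 exp1rz.
  by rewrite expr1n mulr1; case: (odd m).
by move=> uv; rewrite !E uv.
Qed.

Lemma real_productE (a : int) : real_product a =
  (-1) ^ (a * ((p + 1) %/ 2)%N%:Z * ((p - 1) %/ 4)%N%:Z) *
  \prod_(1 <= j < n.+1) \prod_(j.+1 <= k < n.+1)
      (2 * cos (pi * (a * (k%:Z ^+ 2 - j%:Z ^+ 2))%:~R / p%:R)).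
Proof.
have hn := half_double p_pr p_odd; rewrite -/n in hn.
have p3 := odd_prime_gt2 p_odd p_pr.
rewrite /real_product -mulrA; congr (_ * _).
under [RHS]eq_bigr => j _ do rewrite big_split /=.
rewrite big_split /=; congr (_ * _).
have <- : (2 : R) ^+ 'C(n, 2) = 2 ^+ ((p - 1) * (p - 3) %/ 8).
  congr (_ ^+ _); have := bin_ffact n 2; rewrite !ffactnS ffactn0 (_ : 2`! = 2)%N // => h.
  have -> : (p - 1 = n * 2)%N by lia.
  have -> : (p - 3 = n.-1 * 2)%N by lia.
  by move: h; lia.
rewrite -sum_triangle1.
rewrite (big_morph _ (exprD (2 : R)) (expr0 _)); apply: eq_bigr => j _.
by rewrite (big_morph _ (exprD (2 : R)) (expr0 _)); apply: eq_bigr => k _; rewrite expr1.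
Qed.

(** The half-angle phases of all factors multiply to the root of unity with
    exponent [a / (2 p)] times the sum of the [j^2 + k^2], which is
    [p 'C(n + 1, 3)]: only a sign survives, and [binS3_parity] computes it. *)
Lemma zeta_product_real (a : int) :
  \prod_(1 <= j < n.+1) \prod_(j.+1 <= k < n.+1)
      (zeta R p ^ (a * j%:Z ^+ 2) + zeta R p ^ (a * k%:Z ^+ 2)) =
  (real_product a)%:C.
Proof.
have hn := half_double p_pr p_odd; rewrite -/n in hn.
have p3 := odd_prime_gt2 p_odd p_pr.
have p0 := p_neq0 R p_pr.
pose th : R := pi / p%:R * a%:~R.
have step (j k : nat) :
  zeta R p ^ (a * j%:Z ^+ 2) + zeta R p ^ (a * k%:Z ^+ 2) =
  cis (th * (j ^ 2 + k ^ 2)%:R) *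
  ((2 : R) * cos (pi * (a * (k%:Z ^+ 2 - j%:Z ^+ 2))%:~R / p%:R))%:C.
  have e (i : nat) : zeta R p ^ (a * i%:Z ^+ 2) = cis (th * (i ^ 2)%:R + th * (i ^ 2)%:R).
    rewrite zetaX; congr cis; rewrite /th rmorphM rmorphXn /= -pmulrn natrX.
    by field.
  rewrite !e cis_add_cis natrD mulrDr; congr (_ * (2 * cos _)%:C).
  rewrite /th !natrX !rmorphM rmorphB !rmorphXn /= -!pmulrn.
  by field.
under eq_bigr => j _ do under eq_bigr => k _ do rewrite step.
under eq_bigr => j _ do rewrite big_split /=.
rewrite big_split /=.
have -> : \prod_(1 <= j < n.+1) \prod_(j.+1 <= k < n.+1) cis (th * (j ^ 2 + k ^ 2)%:R) =
   ((-1) ^ (a * ((p + 1) %/ 2)%N%:Z * ((p - 1) %/ 4)%N%:Z) : R)%:C.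
  have cs := big_morph (@cis R) (@cisD R) (cis0 R).
  under eq_bigr => j _ do rewrite -cs -mulr_sumr -natr_sum.
  rewrite -cs -mulr_sumr -natr_sum sum_triangle_sqr hn subn1 addn1 prednK ?prime_gt0 //.
  have -> : th * (p * 'C(n.+1, 3))%:R = (a * 'C(n.+1, 3)%:Z)%:~R * pi.
    by rewrite /th natrM rmorphM /= -pmulrn; field.
  rewrite cis_pi -mulrA -PoszM; congr (_%:C); apply: signz_parity.
  rewrite binS3_parity; congr odd.
  have -> : ((p + 1) %/ 2 = n.+1)%N by lia.
  by congr (_ * _)%N; lia.
rewrite real_productE [RHS]rmorphM; congr (_ * _).
by rewrite rmorph_prod; apply: eq_bigr => j _; rewrite rmorph_prod.
Qed.

(** Squaring removes the sign and turns [2 cos x] into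
    [cochord = 2 + 2 cos (2 x)], which depends only on residues modulo [p]. *)
Lemma real_product_sqr (a : int) :
  real_product a ^+ 2 =
  \prod_(1 <= j < n.+1) \prod_(j.+1 <= k < n.+1)
     cochord R ((a%:~R : 'F_p) * (k%:R ^+ 2 - j%:R ^+ 2)).
Proof.
have sq1 (m : int) : ((-1) ^ m) ^+ 2 = 1 :> R.
  by rewrite expr2 -expfzMl mulrNN mulr1 exp1rz.
rewrite real_productE exprMn sq1 mul1r -prodrXl; apply: eq_bigr => j _.
rewrite -prodrXl; apply: eq_bigr => k _.
have -> : (a%:~R : 'F_p) * (k%:R ^+ 2 - j%:R ^+ 2) = (a * (k%:Z ^+ 2 - j%:Z ^+ 2))%:~R.
  by rewrite rmorphM rmorphB !rmorphXn /= -!pmulrn.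
rewrite /cochord cosp_int //.
set m := (_ * _)%R : int; pose x : R := pi * m%:~R / p%:R.
have -> : 2 * pi * m%:~R / p%:R = x + x by rewrite /x; field; exact: p_neq0.
by rewrite -/x cosD; have := cos2Dsin2 x; lra.
Qed.

End CosineForm.

(** * The sixteenth power of the product; the case of p = 3 modulo 4 *)

Section CharacterProducts.

Variables (R : realType) (p : nat) (p_pr : prime p) (p_odd : odd p).
Let n := ((p - 1) %/ 2)%N.

Lemma prod_expz (F : fieldType) (I : Type) (r : seq I) (P : pred I) (f : I -> F) (k : int) :
  \prod_(i <- r | P i) f i ^ k = (\prod_(i <- r | P i) f i) ^ k.
Proof.
by rewrite (big_morph (fun x : F => x ^ k) (fun x y => expfzMl x y k) (exp1rz _ k)).
Qed.

(** This is [epsilon^(-4h)] for [p = 1 mod 4], by the class number formula. *)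
Definition chord_char : R := \prod_(d : 'F_p | d != 0) chord R d ^ qchar d.

Lemma chord_char_gt0 : 0 < chord_char.
Proof. by apply: prodr_gt0 => d d0; apply: exprz_gt0; apply: chord_gt0. Qed.

(** [s ^+ 2] takes each value [d] exactly [1 + qchar d] times, and without the
    character the product over [d] is 1. *)
Lemma prod_cochord_sqr (a : 'F_p) : a != 0 ->
  \prod_(s : 'F_p | s != 0) cochord R (a * s ^+ 2) =
  \prod_(d : 'F_p | d != 0) cochord R d ^ (qchar a * qchar d).
Proof.
move=> a0.
have -> : \prod_(s : 'F_p | s != 0) cochord R (a * s ^+ 2) =
    \prod_(d : 'F_p | d != 0) cochord R (a * d) ^ (1 + qchar d).
  rewrite (partition_big (fun s : 'F_p => s ^+ 2) (fun d => d != 0)) /=; last first.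
    by move=> s s0; rewrite expf_neq0.
  apply: eq_bigr => d d0.
  rewrite (eq_bigr (fun=> cochord R (a * d))); last by move=> s /andP[_ /eqP->].
  rewrite prodr_const -card_sqrt // -exprnP; congr (_ ^+ _).
  apply: eq_card => s; rewrite !inE unfold_in.
  case: (s ^+ 2 =P d) => [sd|]; rewrite ?andbF // andbT.
  by apply: contraNneq d0 => s0; rewrite -sd s0 expr0n.
have cneq (d : 'F_p) : d != 0 -> cochord R d != 0.
  by move=> d0; rewrite lt0r_neq0 // cochord_gt0.
have -> : \prod_(d : 'F_p | d != 0) cochord R (a * d) ^ (1 + qchar d) =
    \prod_(d : 'F_p | d != 0) cochord R (a * d) ^ (qchar d).
  rewrite -[RHS]mul1r -[X in X * _](prod_cochordM R p_pr p_odd a0) -big_split /=.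
  by apply: eq_bigr => d d0; rewrite expfzDr ?expr1z // cneq // mulf_neq0.
rewrite [RHS](reindex_inj (mulfI a0)) /=.
apply: eq_big => [d|d d0]; first by rewrite mulf_eq0 (negbTE a0).
by rewrite qcharM // mulrA -expr2 qchar_sqr // mul1r.
Qed.

(** Substitute [cochord d = chord (2 d) / chord d]; the numerators give the same
    character product raised to [qchar 2]. *)
Lemma prod_cochord_chord_char (a : 'F_p) : a != 0 ->
  \prod_(s : 'F_p | s != 0) cochord R (a * s ^+ 2) =
  chord_char ^ (qchar a * (qchar (2%:R : 'F_p) - 1)).
Proof.
move=> a0; rewrite prod_cochord_sqr //.
under eq_bigr => d d0 do rewrite mulrC -exprz_exp.
rewrite prod_expz mulrC -exprz_exp; congr (_ ^ _).
have F2 := Fp2_neq0 p_pr p_odd.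
have cneq (d : 'F_p) : d != 0 -> chord R d != 0.
  by move=> d0; rewrite lt0r_neq0 // chord_gt0.
have -> : \prod_(d : 'F_p | d != 0) cochord R d ^ qchar d =
   \prod_(d : 'F_p | d != 0) (chord R (2 * d) ^ qchar d / chord R d ^ qchar d).
  apply: eq_bigr => d d0.
  by rewrite -cochord_chord // expfzMl mulfK // expfz_neq0 // cneq.
rewrite prodf_div expfzDr ?lt0r_neq0 ?chord_char_gt0 // exprN1; congr (_ / _).
rewrite /chord_char -prod_expz [RHS](reindex_inj (mulfI F2)) /=.
apply: eq_big => [d|d d0]; first by rewrite mulf_eq0 (negbTE F2).
by rewrite exprz_exp qcharM // mulrAC -expr2 qchar_sqr // mul1r.
Qed.

(** The exponent 16 is the 8 occurrences of each pair [j < k] among all pairs of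
    residues, doubled by squaring. *)
Lemma real_product_chord_char (a : int) : ~~ (p %| a)%Z ->
  real_product R p a ^+ 16 *
    chord_char ^ (2 * (legendre a p * (legendre 2 p - 1))) = 1.
Proof.
move=> pa; have a0 : (a%:~R : 'F_p) != 0 by rewrite Fp_intr_eq0.
have := prod_cochord_triangle R p_pr p_odd a0.
rewrite -real_product_sqr // prod_cochord_chord_char // -exprM => <-.
rewrite !legendreE // mulrC; congr (_ * _).
by rewrite [RHS]exprnP exprz_exp mulrC.
Qed.

Lemma qcharN1 : qchar (-1 : 'F_p) = (-1) ^+ n.
Proof.
apply: (@qchar_inj p p_pr p_odd); rewrite ?qchar_norm ?normrX ?normrN1 ?expr1n //.
by rewrite qcharE // rmorphXn rmorphN1.
Qed.

Lemma real_product_pm1 (a : int) : ~~ (p %| a)%Z -> chord_char = 1 \/ legendre 2 p = 1 ->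
  real_product R p a = 1 \/ real_product R p a = -1.
Proof.
move=> pa h; have := real_product_chord_char pa.
have -> : chord_char ^ (2 * (legendre a p * (legendre 2 p - 1))) = 1.
  by case: h => ->; rewrite ?exp1rz // subrr !mulr0 expr0z.
rewrite mulr1 => /eqP; rewrite -[16%N]/(2 * 8)%N exprM pexpr_eq1 ?sqr_ge0 //=.
by rewrite sqrf_eq1 => /orP[/eqP|/eqP]; [left|right].
Qed.

(** Here [qchar] is odd while [chord] is even, so [chord_char] is its own
    inverse. *)
Lemma chord_char3 : (p %% 4 = 3)%N -> chord_char = 1.
Proof.
move=> p4; have : chord_char = chord_char^-1.
  rewrite {1}/chord_char (reindex_inj oppr_inj) /= -exprN1 /chord_char -prod_expz.
  apply: eq_big => [d|d d0]; first by rewrite oppr_eq0.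
  rewrite chordN // -[- d]mulN1r qcharM // qcharN1 exprz_exp mulrC.
  have -> : n = (2 * (p %/ 4) + 1)%N by rewrite /n; lia.
  by rewrite exprD exprM sqrrN !expr1n mul1r expr1.
move/(congr1 (fun x => x * chord_char)); rewrite mulVf ?lt0r_neq0 ?chord_char_gt0 //.
by move=> /eqP; rewrite -expr2 sqrp_eq1 ?ltW ?chord_char_gt0 // => /eqP.
Qed.

Lemma prod_odd_even (A : comNzRingType) (M : nat) :
  \prod_(1 <= k < (2 * M).+2) (k%:R : A) =
  \prod_(1 <= k < M.+1) (2 * k%:R) * \prod_(0 <= i < M.+1) (2 * i%:R + 1).
Proof.
elim: M => [|M IH]; first by rewrite !big_nat1 big_geq // mul1r mulr0 add0r.
rewrite mulnS !addSn add0n 2?big_nat_recr //= IH.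
rewrite [in RHS](big_nat_recr M.+1) //= [X in _ = _ * X]big_nat_recr //=.
have e : ((2 * M).+2%:R : A) = 2 * M.+1%:R by rewrite -natrM; congr _%:R; lia.
have e' : ((2 * M).+3%:R : A) = 2 * M.+1%:R + 1 by rewrite -natrM -natr1; congr (_%:R + 1); lia.
by rewrite e e'; ring.
Qed.

(** The supplementary law for 2, by comparing the product of the even
    numbers up to [p - 1] with [n!]. *)
Lemma Fp_exp2_half : (p %% 8 = 7)%N -> (2 : 'F_p) ^+ n = 1.
Proof.
move=> p8; pose m := (p %/ 8)%N.
have pm : (p = 8 * m + 7)%N by rewrite /m; lia.
have nm : (n = (2 * (2 * m).+1).+1)%N by rewrite /n; lia.
have f0 : \prod_(1 <= k < n.+1) (k%:R : 'F_p) != 0.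
  rewrite prodf_seq_neq0; apply/allP => k; rewrite mem_index_iota => /andP[k1 kn] /=.
  rewrite Fp_natr_eq0 //; apply/negP => /(dvdn_leq k1); lia.
apply: (mulIf f0); rewrite mul1r.
have -> : (2 : 'F_p) ^+ n * \prod_(1 <= k < n.+1) (k%:R : 'F_p) =
          \prod_(1 <= k < n.+1) (2 * k%:R).
  by rewrite big_split /= prodr_const_nat subSS subn0.
rewrite {2}nm prod_odd_even (@big_cat_nat _ _ _ (2 * m).+2) //=; last lia.
congr (_ * _).
rewrite -{1}[(2 * m).+2]add0n big_addn big_nat_rev /= add0n.
have -> : (n.+1 - (2 * m).+2 = (2 * m).+2)%N by lia.
transitivity (\prod_(0 <= i < (2 * m).+2) (- (2 * i%:R + 1) : 'F_p)).
  apply: eq_big_nat => i /andP[_ im]; apply/eqP.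
  rewrite -addr_eq0 -!natrM natr1 -natrD Fp_natr_eq0 //; apply/dvdnP; exists 1%N.
  by lia.
rewrite !big_mkord prodrN card_ord.
have -> : ((2 * m).+2 = 2 * m.+1)%N by lia.
by rewrite exprM sqrrN !expr1n mul1r.
Qed.

(** Only the sign is in question. Modulo the prime above [p] each power of zeta
    is 1, so that the product is [2 ^ 'C(n, 2)], which is 1 modulo [p]. *)
Lemma real_product3 (a : int) : ~~ (p %| a)%Z -> (p %% 4 = 3)%N -> real_product R p a = 1.
Proof.
move=> pa p4; case: (real_product_pm1 pa (or_introl (chord_char3 p4))) => // hm1.
have hn := half_double p_pr p_odd; rewrite -/n in hn.
pose e (j : nat) : nat := (a%:~R * j%:R ^+ 2 : 'F_p).
have zp := zeta_prim R p_pr.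
pose F : {poly int} := \prod_(1 <= j < n.+1) \prod_(j.+1 <= k < n.+1) ('X^(e j) + 'X^(e k)) + 1.
have Fz : (map_poly intr F).[zeta R p] = 0.
  rewrite rmorphD rmorph1 hornerD hornerC /= (_ : _.[_] = (real_product R p a)%:C).
    by rewrite hm1 rmorphN1 addNr.
  rewrite -zeta_product_real // rmorph_prod horner_prod; apply: eq_bigr => j _.
  rewrite rmorph_prod horner_prod; apply: eq_bigr => k _ /=.
  rewrite rmorphD /= !map_polyXn hornerD !hornerXn.
  have ez (i : nat) : zeta R p ^+ e i = zeta R p ^ (a * i%:Z ^+ 2).
    by rewrite -(addchar_int p_pr zp) rmorphM rmorphXn /= -pmulrn.
  by rewrite !ez.
have p1 : (0 < p.-1)%N by have := odd_prime_gt2 p_odd p_pr; lia.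
have := zeta_relation_modp p_pr zp Fz p1.
rewrite -horner_coef0 horner_comp !hornerE.
rewrite rmorphD rmorph1 hornerD hornerC /= rmorph_prod horner_prod.
have -> : \prod_(1 <= j < n.+1) (map_poly intr (\prod_(j.+1 <= k < n.+1) ('X^(e j) + 'X^(e k)))).[1]
   = (2 : 'F_p) ^+ 'C(n, 2).
  rewrite -sum_triangle1 (big_morph _ (exprD (2 : 'F_p)) (expr0 _)); apply: eq_bigr => j _.
  rewrite (big_morph _ (exprD (2 : 'F_p)) (expr0 _)) rmorph_prod horner_prod.
  apply: eq_bigr => k _ /=.
  by rewrite rmorphD /= !map_polyXn !hornerE !expr1n expr1.
have -> : (2 : 'F_p) ^+ 'C(n, 2) = 1.
  have -> : 'C(n, 2) = (n * (p %/ 4))%N.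
    have := bin_ffact n 2; rewrite !ffactnS ffactn0 (_ : 2`! = 2)%N //.
    have -> : (n = 2 * (p %/ 4) + 1)%N by lia.
    by rewrite addn1 /=; nia.
  rewrite exprM -qcharE //.
  have [q2|q2] := boolP (odd (p %/ 4)); last first.
    by rewrite -[(p %/ 4)%N]odd_double_half (negbTE q2) add0n -mul2n exprM -rmorphXn /= qchar_sqr ?expr1n // Fp2_neq0.
  have p8 : (p %% 8 = 7)%N by lia.
  by rewrite qcharE // Fp_exp2_half // expr1n.
by move=> /eqP; rewrite -[1 + 1]/(2%:R : 'F_p) (negbTE (Fp2_neq0 p_pr p_odd)).
Qed.

End CharacterProducts.

(** * The sign of the quadratic Gauss sum *)

Section GaussSumSign.

Variables (R : realType) (p : nat) (p_pr : prime p) (p_odd : odd p).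
Hypothesis p14 : (p %% 4 = 1)%N.
Let n := ((p - 1) %/ 2)%N.

Lemma half_even : n = (2 * (p %/ 4))%N.
Proof. by rewrite /n; lia. Qed.

Lemma qcharN1_1mod4 : qchar (-1 : 'F_p) = 1.
Proof. by rewrite qcharN1 // -/n half_even exprM sqrrN !expr1n. Qed.

Lemma p_half : p = n.*2.+1.
Proof. by rewrite half_even; lia. Qed.

(** The positive square root of [p], written as a product that is also a
    polynomial in zeta (see [half_sines_zeta]). *)
Definition half_sines : R := \prod_(1 <= k < n.+1) (2 * sin (pi * k%:R / p%:R)).

Lemma half_sines_gt0 : 0 < half_sines.
Proof.
rewrite /half_sines big_seq_cond; apply: prodr_gt0 => k.
rewrite mem_index_iota andbT => /andP[k1 kn].
have p0 : 0 < (p%:R : R) by rewrite ltr0n prime_gt0.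
rewrite mulr_gt0 ?ltr0n // sin_gt0_pi // divr_gt0 ?mulr_gt0 ?pi_gt0 ?ltr0n //=.
  rewrite ltr_pdivrMr // ltr_pM2l ?pi_gt0 // ltr_nat.
  by move: kn; rewrite p_half; lia.
exact: prime_gt0.
Qed.

Lemma half_sines_sqr : half_sines ^+ 2 = p%:R.
Proof.
have -> : half_sines ^+ 2 = \prod_(1 <= k < n.+1) chord R (k%:R : 'F_p).
  rewrite /half_sines -prodrXl; apply: eq_bigr => k _; rewrite /chord cosp_nat //.
  pose x : R := pi * k%:R / p%:R.
  have -> : 2 * pi * k%:R / p%:R = x + x by rewrite /x; field; exact: p_neq0.
  by rewrite -/x cosD; have := cos2Dsin2 x; lra.
have : (\prod_(1 <= k < n.+1) chord R (k%:R : 'F_p)) ^+ 2 == p%:R ^+ 2.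
  rewrite -(Fp_half_prod_even p_pr p_odd) ?prod_chord // => x; exact: chordN.
rewrite eqrXn2 ?ler0n //; first by move/eqP.
rewrite big_seq_cond; apply: prodr_ge0 => k; rewrite mem_index_iota andbT => /andP[k1 kn].
apply/ltW/chord_gt0 => //; rewrite Fp_natr_eq0 //; apply/negP => /(dvdn_leq k1).
by move: kn; rewrite p_half; lia.
Qed.

Lemma half_sinesE : half_sines = Num.sqrt p%:R.
Proof. by rewrite -half_sines_sqr sqrtr_sqr gtr0_norm ?half_sines_gt0. Qed.

Lemma half_sines_zeta :
  \prod_(1 <= k < n.+1) (zeta R p ^+ (n.+1 * k) - zeta R p ^+ (n * k)) = half_sines%:C.
Proof.
have p0 := p_neq0 R p_pr.
have pR : (p%:R : R) = 2 * n%:R + 1 by rewrite {1}p_half -addnn -natr1 natrD; ring.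
have e (k : nat) : zeta R p ^+ (n.+1 * k) - zeta R p ^+ (n * k) =
    ((-1) ^+ k * 'i) * (2 * sin (pi * k%:R / p%:R))%:C.
  pose x : R := pi * k%:R / p%:R.
  have e1 : zeta R p ^+ (n.+1 * k) = cis (k%:~R * pi) * cis x.
    rewrite [LHS](zetaX R p (n.+1 * k)%N) -cisD; congr cis.
    by rewrite /x -!pmulrn natrM -natr1 [in RHS]mulrC; move: p0; rewrite pR => p0; field.
  have e2 : zeta R p ^+ (n * k) = cis (k%:~R * pi) * cis (- x).
    rewrite [LHS](zetaX R p (n * k)%N) -cisD; congr cis.
    by rewrite /x -!pmulrn natrM [in RHS]mulrC; move: p0; rewrite pR => p0; field.
  rewrite e1 e2 -mulrBr cis_pi -mulrA; congr (_ * _).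
    by rewrite -exprnP rmorphXn rmorphN1.
  by rewrite -/x /cis cosN sinN; simpc; congr (_ +i* _); ring.
under eq_bigr => k _ do rewrite e.
rewrite big_split /= /half_sines rmorph_prod; set Q := \prod_(_ <= _ < _) _%:C.
suff -> : \prod_(1 <= i < n.+1) ((-1) ^+ i * 'i) = 1 :> R[i] by rewrite mul1r.
rewrite half_even; elim: (p %/ 4)%N => [|m IH]; first by rewrite big_geq.
rewrite mulnS !addSn add0n 2?big_nat_recr //= IH mul1r.
rewrite mulrACA -exprD -expr2 sqr_i -[((-1) ^+ _)]signr_odd addSn /= oddD.
by rewrite /= negbK addbb /= expr1 mulrNN mulr1.
Qed.

Lemma Fp_power_sum (k : nat) : (k < p)%N ->
  \sum_(x : 'F_p) x ^+ k = if k == p.-1 then -1 else 0.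
Proof.
move=> kp; have p1 := prime_gt1 p_pr.
have c0 : #|[pred x : 'F_p | x != 0]| = p.-1.
  by rewrite -[in RHS](card_Fp p_pr) -(cardC1 (0 : 'F_p)); apply: eq_card.
case: eqP => [->|kn].
  rewrite (bigD1 (0 : 'F_p)) //= expr0n (_ : p.-1 == 0%N = false) ?add0r; last lia.
  rewrite (eq_bigr (fun=> 1)) => [|x x0].
    rewrite sumr_const c0; apply/eqP; rewrite -subr_eq0 opprK natr1 prednK ?prime_gt0 //.
    by rewrite Fp_natr_eq0.
  apply: (mulfI x0); rewrite -exprS prednK ?prime_gt0 // mulr1.
  by have := expf_card x; rewrite card_Fp.
have [->|k0] := eqVneq k 0%N.
  by rewrite sumr_const card_Fp //; apply/eqP; rewrite Fp_natr_eq0.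
have [g g0 gk] : exists2 g : 'F_p, g != 0 & g ^+ k != 1.
  apply/exists_inP; apply: contraT; rewrite negb_exists_in => /forall_inP h.
  have kg : (0 < k)%N by rewrite lt0n.
  have nz : ('X^k - 1%:P : {poly 'F_p}) != 0 by rewrite -size_poly_eq0 size_XnsubC.
  have := @max_poly_roots _ _ (enum [pred x : 'F_p | x != 0]) nz.
  rewrite size_XnsubC // enum_uniq -cardE c0 => /(_ _ isT)/wrap[].
    apply/allP => x; rewrite mem_enum inE => /h; rewrite negbK rootE !hornerE => /eqP->.
    by rewrite subrr.
  by lia.
have : g ^+ k * (\sum_(x : 'F_p) x ^+ k) = \sum_(x : 'F_p) x ^+ k.
  rewrite [RHS](reindex_inj (mulfI g0)) /= mulr_sumr.
  by apply: eq_bigr => x _; rewrite exprMn.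
move/eqP; rewrite -subr_eq0 -[X in _ - X]mul1r -mulrBl mulf_eq0 subr_eq0.
by rewrite (negbTE gk) => /eqP.
Qed.

(** Only the power sum of exponent [p - 1] is nonzero. *)
Lemma Fp_sum_monic (q : {poly 'F_p}) : q \is monic -> size q = p ->
  \sum_(x : 'F_p) q.[x] = -1.
Proof.
move=> qm sq; under eq_bigr do rewrite horner_coef sq.
rewrite exchange_big /=; under eq_bigr => k _ do rewrite -mulr_sumr Fp_power_sum //.
have lt : (p.-1 < p)%N by rewrite prednK ?prime_gt0.
rewrite (bigD1 (Ordinal lt)) //= eqxx big1 => [|k].
  by move: qm; rewrite monicE lead_coefE sq => /eqP->; rewrite mul1r addr0.
by rewrite -val_eqE /= => /negbTE->; rewrite mulr0.
Qed.

Lemma natr_ffact (A : comNzRingType) (j m : nat) :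
  (j ^_ m)%:R = \prod_(0 <= i < m) (j%:R - i%:R) :> A.
Proof.
elim: m => [|m IH]; first by rewrite ffactn0 big_geq.
rewrite ffactnSr big_nat_recr //= -IH natrM.
have [mj|jm] := leqP m j; first by rewrite natrB.
by rewrite ffact_small // !mul0r.
Qed.

(** Modulo [p], [qchar j] is [j ^+ n], so that the summand is the value at [j] of
    a monic polynomial of degree [p - 1]. *)
Lemma sum_qchar_bin :
  \sum_(0 <= j < p) (qchar (j%:R : 'F_p))%:~R * ('C(j, n) * n`!)%:R = -1 :> 'F_p.
Proof.
pose q : {poly 'F_p} := 'X^n * \prod_(0 <= i < n) ('X - (i%:R)%:P).
have qm : q \is monic.
  by rewrite monicMr ?monicXn // monic_prod // => i _; exact: monicXsubC.
have sq : size q = p.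
  rewrite size_Mmonic ?monic_prod // ?size_polyXn ?size_prod_XsubC; last first.
    by move=> i _; exact: monicXsubC.
    by rewrite monic_neq0 ?monicXn.
  rewrite size_iota subn0 [RHS]p_half; lia.
rewrite -(Fp_sum_monic qm sq) (big_Fp p_pr); apply: eq_big_nat => j _.
rewrite qcharE // bin_ffact natr_ffact /q hornerM hornerXn horner_prod.
by congr (_ * _); apply: eq_bigr => i _; rewrite !hornerE.
Qed.

Lemma Fp_fact_half_sqr : ((n`!)%:R : 'F_p) ^+ 2 = -1.
Proof.
have W : \prod_(x : 'F_p | x != 0) x = -1.
  have -> : \prod_(x : 'F_p | x != 0) x = ((p.-1)`!)%:R.
    by rewrite big_Fp_neq0 // fact_prod natr_prod prednK ?prime_gt0.
  apply/eqP; rewrite -addr_eq0 natr1 Fp_natr_eq0 //.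
  by rewrite -Wilson // prime_gt1.
rewrite -W (Fp_half_prod p_pr p_odd) big_split /= -/n.
under [X in _ * X]eq_bigr do rewrite -mulN1r.
rewrite big_split /= prodr_const_nat subSS subn0 half_even exprM sqrrN !expr1n mul1r.
by rewrite -half_even expr2 -natr_prod -fact_prod.
Qed.

Lemma coef_XD1n (A : comNzRingType) (j i : nat) : (('X + 1 : {poly A}) ^+ j)`_i = ('C(j, i))%:R.
Proof.
rewrite exprD1n coef_sum; under eq_bigr do rewrite coefMn coefXn.
have [ij|ji] := ltnP i j.+1; last first.
  rewrite bin_small // big1 // => k _.
  by rewrite (gtn_eqF (leq_trans (ltn_ord k) ji)) mul0rn.
rewrite (bigD1 (Ordinal ij)) //= eqxx big1 ?addr0 // => k.
by rewrite -val_eqE /= eq_sym => /negbTE->; rewrite mul0rn.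
Qed.

Lemma half_product_coef (A : comNzRingType) :
  ((\prod_(1 <= k < n.+1) ('X^(n.+1 * k) - 'X^(n * k))) \Po ('X + 1) : {poly A})`_n = (n`!)%:R.
Proof.
rewrite rmorph_prod /=.
pose u (k : nat) : {poly A} := ('X + 1) ^+ (n * k) * \sum_(i < k) ('X + 1) ^+ i.
have e (k : nat) : ('X^(n.+1 * k) - 'X^(n * k)) \Po ('X + 1) = 'X * u k.
  rewrite comp_polyB !rmorphXn /= !comp_polyX mulSn exprD -[X in _ - X]mul1r -mulrBl.
  by rewrite -[X in _ * X]/(_ ^+ _) subrX1 addrK /u mulrCA mulrC; ring.
under eq_bigr do rewrite e.
rewrite big_split /= prodr_const_nat subSS subn0 coefXnM ltnn subnn -horner_coef0.
rewrite horner_prod fact_prod natr_prod; apply: eq_bigr => k _.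
rewrite /u hornerM horner_exp hornerD hornerX hornerC add0r expr1n mul1r.
rewrite horner_sum (eq_bigr (fun=> 1)) ?sumr_const ?card_ord // => i _.
by rewrite horner_exp hornerD hornerX hornerC add0r expr1n.
Qed.

(** Gauss's determination of the sign. Both [gauss_sum] and the product of
    sines are square roots of [p]; modulo [p], their Taylor coefficients of
    order [n] at 1 are [-1/n!] and [n!], which are equal. *)
Lemma gauss_sum_value : gauss_sum p (zeta R p) = (Num.sqrt p%:R)%:C.
Proof.
have zp := zeta_prim R p_pr.
rewrite -half_sinesE.
have sq : gauss_sum p (zeta R p) ^+ 2 = half_sines%:C ^+ 2.
  by rewrite (gauss_sum_sqr p_pr zp p_odd) qcharN1_1mod4 mul1r -rmorphXn half_sines_sqr /= rmorph_nat.
move/eqP: sq; rewrite eqf_sqr => /orP[/eqP//|/eqP sgn]; exfalso.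
pose F : {poly int} := \sum_(0 <= j < p) (qchar (j%:R : 'F_p))%:P * 'X^j
   + \prod_(1 <= k < n.+1) ('X^(n.+1 * k) - 'X^(n * k)).
have Fz : (map_poly intr F).[zeta R p] = 0.
  rewrite rmorphD hornerD /= rmorph_prod horner_prod.
  have -> : \prod_(1 <= k < n.+1) (map_poly intr ('X^(n.+1 * k) - 'X^(n * k))).[zeta R p] = half_sines%:C.
    rewrite -half_sines_zeta; apply: eq_bigr => k _.
    by rewrite rmorphB /= !map_polyXn hornerD hornerN !hornerXn.
  suff -> : (map_poly intr (\sum_(0 <= j < p) (qchar (j%:R : 'F_p))%:P * 'X^j)).[zeta R p]
     = gauss_sum p (zeta R p) by rewrite sgn addNr.
  rewrite rmorph_sum horner_sum /gauss_sum (big_Fp p_pr); apply: eq_bigr => j _ /=.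
  by rewrite rmorphM /= map_polyC map_polyXn hornerM hornerC hornerXn (addchar_nat p_pr zp).
have np : (n < p.-1)%N by rewrite p_half; have := odd_prime_gt2 p_odd p_pr; rewrite p_half; lia.
have := zeta_relation_modp p_pr zp Fz np.
rewrite rmorphD rmorph_prod /= comp_polyD coefD.
under [X in _ + (X \Po _)`__]eq_bigr do rewrite rmorphB /= !map_polyXn.
rewrite half_product_coef.
set S := (_ \Po _)`_ _ => S0.
have fS : (n`!)%:R * S = -1.
  rewrite -sum_qchar_bin /S rmorph_sum /= rmorph_sum /= coef_sum mulr_sumr.
  apply: eq_bigr => j _; rewrite rmorphM /= map_polyC map_polyXn comp_polyM comp_polyC.
  rewrite rmorphXn /= comp_polyX coefCM coef_XD1n natrM mulrCA; congr (_ * _); exact: mulrC.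
have : (n`!)%:R * (S + (n`!)%:R) = 0 by rewrite S0 mulr0.
rewrite mulrDr fS -expr2 Fp_fact_half_sqr -opprD => /eqP; rewrite oppr_eq0.
by rewrite -[1 + 1]/(2%:R : 'F_p) (negbTE (Fp2_neq0 p_pr p_odd)).
Qed.

End GaussSumSign.

(** * Derivatives and the mean value theorem *)

Section Calculus.
Import numFieldNormedType.Exports.

Variable R : realType.
Implicit Types (f df g dg : R -> R) (a b x : R).

Lemma mean_value f df a b : a < b ->
  (forall x, a <= x <= b -> is_derive x 1 f (df x)) ->
  exists2 c, a < c < b & f b - f a = df c * (b - a).
Proof.
move=> ab h; have [|c|c] := @MVT R f df a b ab.
- by move=> x; rewrite in_itv /= => /andP[ax xb]; apply: h; rewrite !ltW.
- apply: derivable_within_continuous => x; rewrite in_itv /= => hx.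
  by have [] := h x hx.
- by rewrite in_itv /= => hc e; exists c.
Qed.

Lemma mean_value_le f df a b (M : R) : a <= b ->
  (forall x, a <= x <= b -> is_derive x 1 f (df x)) ->
  (forall x, a < x < b -> df x <= M) -> f b - f a <= M * (b - a).
Proof.
rewrite le_eqVlt => /orP[/eqP->|ab h hM]; first by rewrite !subrr mulr0.
by have [c /hM hc ->] := mean_value ab h; rewrite ler_wpM2r // subr_ge0 ltW.
Qed.

Lemma is_derive_bigsum (I : Type) (r : seq I) (P : pred I) (F : I -> R -> R) (dF : I -> R) x :
  (forall i, P i -> is_derive x 1 (F i) (dF i)) ->
  is_derive x 1 (fun y => \sum_(i <- r | P i) F i y) (\sum_(i <- r | P i) dF i).
Proof.
move=> h; elim: r => [|i r IH].
  rewrite big_nil (_ : (fun y => _) = cst 0); first exact: is_derive_cst.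
  by apply/funext => y; rewrite big_nil.
rewrite big_cons; case: ifP => Pi.
  rewrite (_ : (fun y => _) = F i + (fun y => \sum_(j <- r | P j) F j y)).
    by apply: is_deriveD; exact: h.
  by apply/funext => y; rewrite big_cons Pi.
rewrite (_ : (fun y => _) = (fun y => \sum_(j <- r | P j) F j y)) //.
by apply/funext => y; rewrite big_cons Pi.
Qed.

Lemma is_derive_scale f x (k d : R) : is_derive x 1 f d ->
  is_derive x 1 (fun y => k * f y) (k * d).
Proof. move=> h; exact: (is_deriveZ k h). Qed.

Lemma is_derive_pow (n : nat) x : is_derive x 1 (fun y : R => y ^+ n) (n%:R * x ^+ n.-1).
Proof.
have := @is_deriveX R _ id n x 1 1 (is_derive_id x 1).
rewrite (_ : id ^+ n = (fun y => y ^+ n)); last first.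
  by apply/funext => y; elim: n => // n IH; rewrite !exprS -IH.
by move=> h; apply: is_derive_eq h _; rewrite /= /GRing.scale /= mulr1 -mulr_natl.
Qed.

End Calculus.

(** * The value at 1 of the L-function *)

Section LValue.
Import numFieldNormedType.Exports.

Variables (R : realType) (p : nat) (p_pr : prime p) (p_odd : odd p).
Hypothesis p14 : (p %% 4 = 1)%N.
Let zp := zeta_prim R p_pr.
Let w : R := Num.sqrt p%:R.

Definition qcharn (d : nat) : R := (qchar (d%:R : 'F_p))%:~R.

Lemma sqrt_p_gt0 : 0 < w.
Proof. by rewrite sqrtr_gt0 ltr0n prime_gt0. Qed.

(** Real part of the twisted Gauss sum: it expresses [qchar r] by cosines, which
    is what makes the logarithm series summable in closed form. *)
Lemma gauss_sum_cos (r : 'F_p) :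
  \sum_(k : 'F_p) (qchar k)%:~R * cosp R (r * k) = w * (qchar r)%:~R :> R.
Proof.
have := gauss_sum_twist p_pr (zeta R p) p_odd r; rewrite gauss_sum_value // -/w.
have intC (m : int) : (m%:~R : R[i]) = (m%:~R : R)%:C by rewrite rmorph_int.
have -> : \sum_x (qchar x)%:~R * addchar (zeta R p) (r * x) =
   (\sum_(k : 'F_p) (qchar k)%:~R * cosp R (r * k)) +i*
   (\sum_(k : 'F_p) (qchar k)%:~R * sinp R (r * k)).
  apply: (big_rec3 (fun (a : R[i]) (b c : R) => a = b +i* c)) => //= i y1 y2 y3 _ ->.
  by rewrite addchar_cis intC; simpc.
by rewrite intC; simpc => -[-> _]; rewrite mulrC.
Qed.

Let D (k : 'F_p) (x : R) : R := 1 - 2 * cosp R k * x + x ^+ 2.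

Lemma cosp_sqr_lt1 (k : 'F_p) : k != 0 -> 0 < 1 - cosp R k ^+ 2.
Proof.
move=> k0; have := chord_gt0 R p_pr k0; have := cochord_gt0 R p_pr p_odd k0.
by rewrite /chord /cochord => h1 h2; rewrite -[1](expr1n _ 2) subr_sqr mulr_gt0; lra.
Qed.

Lemma D_gt0 k x : k != 0 -> 0 < D k x.
Proof.
move=> k0; have h := cosp_sqr_lt1 k0.
have -> : D k x = (x - cosp R k) ^+ 2 + (1 - cosp R k ^+ 2) by rewrite /D; ring.
by rewrite ltr_wpDl // sqr_ge0.
Qed.

(** Dirichlet's closed form of [L(1, chi) = \sum_d chi(d) / d]. *)
Definition Lvalue : R := - ln (chord_char R p) / (2 * w).

Let G (x : R) : R := - (2 * w)^-1 * \sum_(k : 'F_p | k != 0) (qchar k)%:~R * ln (D k x).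
Let g (x : R) : R := w^-1 * \sum_(k : 'F_p | k != 0) (qchar k)%:~R * ((cosp R k - x) / D k x).

Lemma ln_chord_char :
  ln (chord_char R p) = \sum_(k : 'F_p | k != 0) (qchar k)%:~R * ln (chord R k).
Proof.
rewrite /chord_char.
suff [] : 0 < \prod_(k : 'F_p | k != 0) chord R k ^ qchar k /\
   ln (\prod_(k : 'F_p | k != 0) chord R k ^ qchar k) =
   \sum_(k : 'F_p | k != 0) (qchar k)%:~R * ln (chord R k) by [].
apply: (big_rec2 (fun x y : R => 0 < x /\ ln x = y)) => [|k x y k0 [x0 <-]].
  by rewrite ltr01 ln1.
have c0 := chord_gt0 R p_pr k0.
rewrite mulr_gt0 ?exprz_gt0 //; split=> //.
rewrite lnM ?posrE ?exprz_gt0 //; congr (_ + _).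
by case: (qchar_range k) => ->; rewrite ?expr0z ?ln1 ?mul0r ?expr1z ?mul1r ?exprN1 ?lnV ?mulN1r ?posrE.
Qed.

Lemma G_at1 : G 1 = Lvalue.
Proof.
rewrite /G /Lvalue ln_chord_char mulNr mulNr mulrC; congr (- (_ * _)).
by apply: eq_bigr => k _; congr (_ * ln _); rewrite /D /chord; ring.
Qed.

Lemma G_at0 : G 0 = 0.
Proof.
rewrite /G big1 ?mulr0 // => k _.
by rewrite /D mulr0 subr0 expr0n addr0 ln1 mulr0.
Qed.

Lemma is_derive_G (x : R) : is_derive x 1 G (g x).
Proof.
have w0 := sqrt_p_gt0.
have -> : g x = - (2 * w)^-1 * \sum_(k : 'F_p | k != 0)
    (qchar k)%:~R * ((2 * x - 2 * cosp R k) / D k x).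
  rewrite /g !mulr_sumr; apply: eq_bigr => k k0.
  have := D_gt0 x k0; move: (D k x) => d d0; field.
  by rewrite !lt0r_neq0.
have inner (k : 'F_p) : k != 0 -> is_derive x 1 (fun y => (qchar k)%:~R * ln (D k y))
    ((qchar k)%:~R * ((2 * x - 2 * cosp R k) / D k x)).
  move=> k0; have dD : is_derive x 1 (D k) (2 * x - 2 * cosp R k).
    have h1 := is_derive_scale (2 * cosp R k) (is_derive_id x 1).
    have h2 := is_deriveD (is_deriveB (is_derive_cst (1 : R) x 1) h1) (is_derive_pow 2 x).
    apply: is_derive_eq h2 _.
    by rewrite /= sub0r mulr1 expr1 addrC.
  have h := is_derive1_comp (is_derive1_ln (D_gt0 x k0)) dD.
  have hl : is_derive x 1 (fun y => ln (D k y)) ((2 * x - 2 * cosp R k) / D k x).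
    by apply: is_derive_eq h _; rewrite mulrC.
  exact: (is_derive_scale _ hl).
exact: (is_derive_scale _ (is_derive_bigsum _ inner)).
Qed.

(** The geometric progression of ratio [x zeta^k], real part only. *)
Lemma cos_geometric (k : 'F_p) (x : R) (N : nat) :
  (cosp R k - x) - x ^+ N * (cosp R (N.+1%:R * k) - x * cosp R (N%:R * k)) =
  D k x * \sum_(1 <= r < N.+1) x ^+ r.-1 * cosp R (r%:R * k).
Proof.
have cos_rec (m : 'F_p) : cosp R (m + k) + cosp R (m - k) = 2 * cosp R k * cosp R m.
  have h1 := addcharD p_pr zp m k; have h2 := addcharD p_pr zp m (- k).
  have h3 : addchar (zeta R p) k * addchar (zeta R p) (- k) = 1.
    by rewrite -addcharD // subrr addchar0.
  move: h1 h2 h3; rewrite !addchar_cis cospN //; simpc => -[-> _] [-> _] [h3 h4].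
  have h5 := cos2Dsin2 (2 * pi * (k : nat)%:R / p%:R : R).
  rewrite -/(cosp R k) -/(sinp R k) in h5.
  have -> : sinp R (- k) = - sinp R k by move: h3 h4 h5; nra.
  by ring.
elim: N => [|N IH].
  rewrite big_geq // mulr0 expr0 (_ : 1%:R * k = k) ?mul1r // (_ : 0%:R * k = 0) ?mul0r //.
  by rewrite cosp0; ring.
rewrite [in RHS]big_nat_recr //= [RHS]mulrDr -IH.
have := cos_rec (N.+1%:R * k).
have -> : N.+1%:R * k + k = N.+2%:R * k by rewrite -[N.+2%:R]natr1 mulrDl mul1r.
have -> : N.+1%:R * k - k = N%:R * k by rewrite -natr1 mulrDl mul1r addrK.
move=> e; have -> : cosp R (N.+2%:R * k) =
  2 * cosp R k * cosp R (N.+1%:R * k) - cosp R (N%:R * k) by rewrite -e; ring.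
by rewrite /D exprS; ring.
Qed.

Lemma g_rational x : (1 - x ^+ p) * g x = \sum_(1 <= r < p.+1) qcharn r * x ^+ r.-1.
Proof.
have w0 := sqrt_p_gt0.
rewrite /g mulrCA mulr_sumr.
transitivity (w^-1 * \sum_(k : 'F_p) \sum_(1 <= r < p.+1)
    (qchar k)%:~R * (x ^+ r.-1 * cosp R (r%:R * k))).
  congr (_ * _); rewrite [RHS](bigD1 (0 : 'F_p)) //= [X in _ = X + _]big1 ?add0r => [|r _]; last first.
    by rewrite qchar0 mul0r.
  apply: eq_bigr => k k0; rewrite -mulr_sumr mulrCA; congr (_ * _).
  have := cos_geometric k x p.
  have pz : (p%:R : 'F_p) = 0 by apply/eqP; rewrite Fp_natr_eq0.
  rewrite -natr1 pz add0r mul0r mul1r cosp0 mulr1 => e.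
  apply: (mulfI (lt0r_neq0 (D_gt0 x k0))); rewrite -e.
  by have := D_gt0 x k0; move: (D k x) => d d0; field; rewrite lt0r_neq0.
rewrite exchange_big /= mulr_sumr; apply: eq_bigr => r _.
under eq_bigr => k _ do rewrite mulrCA.
rewrite -mulr_sumr gauss_sum_cos -/(qcharn r).
by field; rewrite lt0r_neq0.
Qed.

Let S (N : nat) (x : R) := \sum_(1 <= d < (p * N).+1) qcharn d / d%:R * x ^+ d.

Lemma qcharn_period (d m : nat) : qcharn (p * m + d) = qcharn d.
Proof.
rewrite /qcharn natrD natrM (_ : (p%:R : 'F_p) = 0) ?mul0r ?add0r //.
by apply/eqP; rewrite Fp_natr_eq0.
Qed.

Lemma sum_qcharn_pow N x :
  \sum_(1 <= d < (p * N).+1) qcharn d * x ^+ d.-1 =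
  (\sum_(1 <= r < p.+1) qcharn r * x ^+ r.-1) * \sum_(0 <= i < N) (x ^+ p) ^+ i.
Proof.
elim: N => [|N IH]; first by rewrite muln0 big_geq // [X in _ * X]big_geq // mulr0.
rewrite [X in _ * X]big_nat_recr //= mulrDr -IH.
have l1 : (1 <= (p * N).+1)%N by [].
have l2 : ((p * N).+1 <= (p * N.+1).+1)%N by rewrite mulnS; lia.
rewrite (big_cat_nat l1 l2) /=; congr (_ + _).
rewrite -{1}[(p * N).+1]add1n big_addn.
have -> : ((p * N.+1).+1 - p * N = p.+1)%N by rewrite mulnS; lia.
rewrite mulr_suml; apply: eq_big_nat => r /andP[r1 _].
rewrite addnC qcharn_period -exprM -mulrA -exprD; congr (_ * _ ^+ _).
by move: r1; lia.
Qed.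

(** The denominators [D k x = |1 - x zeta^k|^2] stay away from 0 on [[0, 1]]
    since no [zeta^k] equals 1. *)
Lemma g_bounded : exists2 C : R, 0 < C & forall x, 0 <= x <= 1 -> `|g x| <= C.
Proof.
have w0 := sqrt_p_gt0.
exists (1 + w^-1 * \sum_(k : 'F_p | k != 0) (2 / (1 - cosp R k ^+ 2))).
  apply: ltr_pwDl => //; apply: mulr_ge0; first by rewrite invr_ge0 ltW.
  by apply: sumr_ge0 => k k0; rewrite divr_ge0 // ltW // cosp_sqr_lt1.
move=> x /andP[x0 x1]; rewrite /g normrM gtr0_norm ?invr_gt0 //.
rewrite ler_wpDl //; apply: ler_wpM2l; first by rewrite invr_ge0 ltW.
apply: le_trans (ler_norm_sum _ _ _) _; apply: ler_sum => k k0.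
have D0 := D_gt0 x k0; have c0 := cosp_sqr_lt1 k0.
have c1 : `|cosp R k| <= 1.
  by rewrite ler_norml; apply/andP; split; [exact: cos_geN1 | exact: cos_le1].
rewrite normrM normf_div [ `|D _ _|]gtr0_norm //.
have q1 : `|(qchar k)%:~R : R| <= 1.
  by case: (qchar_range k) => ->; rewrite ?normr0 ?normrN1 ?normr1.
rewrite -[leRHS]mul1r ler_pM ?divr_ge0 ?(ltW D0) //.
apply: ler_pM; rewrite ?invr_ge0 ?(ltW D0) //.
  by rewrite (le_trans (ler_normB _ _)) // (ger0_norm x0); lra.
rewrite lef_pV2 ?posrE //.
have -> : D k x = (x - cosp R k) ^+ 2 + (1 - cosp R k ^+ 2) by rewrite /D; ring.
by rewrite lerDr sqr_ge0.
Qed.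

(** [G - S N] has derivative [x ^+ (p N) * g x] on [[0, 1]], so the mean value
    inequality bounds it by [C / (p N + 1)]. Stopping at multiples of [p] makes
    the derivative of the partial sum a multiple of [g]. *)
Lemma Lvalue_partial : exists2 C : R, 0 < C & forall N : nat,
  `|Lvalue - \sum_(1 <= d < (p * N).+1) qcharn d / d%:R| <= C / N.+1%:R.
Proof.
have [C C0 hC] := g_bounded; exists C => // N.
have p0 := prime_gt0 p_pr.
have SD (x : R) : is_derive x 1 (S N) (\sum_(1 <= d < (p * N).+1) qcharn d * x ^+ d.-1).
  rewrite [X in is_derive _ _ _ X](_ : _ = \sum_(1 <= d < (p * N).+1) (qcharn d / d%:R * (d%:R * x ^+ d.-1))).
    have inner (d : nat) := is_derive_scale (qcharn d / d%:R) (is_derive_pow d x).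
    exact: (is_derive_bigsum _ (fun d _ => inner d)).
  apply: eq_big_nat => d /andP[d1 _]; field.
  by rewrite pnatr_eq0 -lt0n.
pose M := (p * N)%N; pose h (x : R) : R := g x - \sum_(1 <= d < (p * N).+1) qcharn d * x ^+ d.-1.
have hE x : 0 < x < 1 -> h x = g x * x ^+ M.
  move=> /andP[x0 x1]; have x0' : 0 <= x by exact: ltW.
  have hq : (1 - x ^+ p) * (\sum_(0 <= i < N) (x ^+ p) ^+ i) = 1 - x ^+ M.
    by rewrite -opprB mulNr big_mkord -subrX1 opprB exprM.
  rewrite /h sum_qcharn_pow -g_rational; move: (g x) (\sum_(0 <= i < N) _) hq => gx q hq.
  have -> : gx - (1 - x ^+ p) * gx * q = gx * (1 - (1 - x ^+ p) * q) by ring.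
  by rewrite hq; ring.
pose T (x : R) : R := x ^+ M.+1 / M.+1%:R.
have TD (x : R) : is_derive x 1 T (x ^+ M).
  rewrite /T (_ : (fun y => _) = (fun y => M.+1%:R^-1 * y ^+ M.+1)); last first.
    by apply/funext => y; rewrite mulrC.
  have := is_derive_scale (M.+1%:R^-1) (is_derive_pow M.+1 x).
  by move=> e; apply: is_derive_eq e _; rewrite mulrA mulVf ?pnatr_eq0 // mul1r.
have bound (s : R) : s = 1 \/ s = -1 -> s * (G 1 - S N 1) <= C / M.+1%:R.
  move=> hs; have := @mean_value_le R (fun x => s * (G x - S N x) - C * T x)
     (fun x => s * h x - C * x ^+ M) 0 1 0 ler01.
  move=> /(_ _ _)/wrap[].
    move=> x _; apply: is_deriveB; apply: is_derive_scale => //.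
    by apply: is_deriveB => //; exact: is_derive_G.
  move=> x /andP[x0 x1]; rewrite hE ?x0 // subr_le0 mulrA ler_wpM2r ?exprn_ge0 ?(ltW x0) //.
  have gx : `|g x| <= C by apply: hC; rewrite !ltW.
  case: hs => ->; rewrite ?mul1r ?mulN1r.
    exact: le_trans (ler_norm _) gx.
  by rewrite -normrN in gx; exact: le_trans (ler_norm _) gx.
  rewrite mul0r G_at0 (_ : S N 0 = 0) /=; last first.
    rewrite /S big_nat_cond big1 // => d /andP[/andP[d1 _] _].
    by rewrite expr0n (gtn_eqF d1) mulr0.
  by rewrite /T expr1n expr0n mul0r !mulr0 !subr0 mulr0 subr0 mul1r subr_le0.
have S1 : S N 1 = \sum_(1 <= d < (p * N).+1) qcharn d / d%:R.
  by apply: eq_bigr => d _; rewrite expr1n mulr1.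
have CM : C / M.+1%:R <= C / N.+1%:R.
  rewrite ler_wpM2l ?(ltW C0) // lef_pV2 ?posrE ?ltr0n // ler_nat ltnS /M.
  by rewrite leq_pmull.
rewrite -S1 -G_at1 ler_norml; apply/andP; split; last first.
  by have := bound 1 (or_introl erefl); rewrite mul1r => /le_trans; apply.
have := bound (-1) (or_intror erefl); rewrite mulN1r lerNl => hb.
by apply: le_trans hb; rewrite lerN2.
Qed.

End LValue.

(** * Quadratic reciprocity through Gaussian periods *)

Section Reciprocity.

Variables (p : nat) (p_pr : prime p) (p_odd : odd p).
Hypothesis p14 : (p %% 4 = 1)%N.

Definition quarter : nat := ((p - 1) %/ 4)%N.

Lemma p_quarter : p = (4 * quarter + 1)%N.
Proof. by rewrite /quarter; have := prime_gt0 p_pr; lia. Qed.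

(** For [e = 1, -1], the two Gaussian periods, the sums of zeta over the residues
    and over the nonresidues. *)
Definition period (A : fieldType) (z : A) (e : int) : A :=
  \sum_(r : 'F_p | qchar r == e) addchar z r.

Definition period_poly (e : int) : {poly int} := \sum_(r : 'F_p | qchar r == e) 'X^r.

Lemma period_polyE (A : fieldType) (z : A) e :
  (map_poly intr (period_poly e)).[z] = period z e.
Proof.
rewrite rmorph_sum horner_sum; apply: eq_bigr => r _ /=.
by rewrite map_polyXn hornerXn.
Qed.

Lemma sum_by_qchar (A : nmodType) (f : 'F_p -> A) :
  \sum_r f r = f 0 + \sum_(r | qchar r == 1) f r + \sum_(r | qchar r == -1) f r.
Proof.
rewrite (bigD1 (0 : 'F_p)) //= -addrA; congr (_ + _).
rewrite (bigID (fun r : 'F_p => qchar r == 1)) /=; congr (_ + _); apply: eq_bigl => r.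
  by rewrite -qchar_eq0; case: (qchar_range r) => ->.
by rewrite -qchar_eq0; case: (qchar_range r) => ->.
Qed.

Section InField.
Variables (A : fieldType) (z : A) (zp : p.-primitive_root z).

Lemma period_sum : period z 1 + period z (-1) = -1.
Proof.
have := sum_addchar p_pr zp (oner_neq0 'F_p).
under eq_bigr do rewrite mul1r.
rewrite sum_by_qchar addchar0 -addrA addrC => /eqP; rewrite addr_eq0 => /eqP h.
exact: h.
Qed.

Lemma period_diff : period z 1 - period z (-1) = gauss_sum p z.
Proof.
rewrite /gauss_sum sum_by_qchar qchar0 mul0r add0r /period -sumrN.
congr (_ + _); apply: eq_bigr => r /eqP->; first by rewrite mul1r.
by rewrite rmorphN1 mulN1r.
Qed.

End InField.

Lemma period_prod_algC (z : algC) : p.-primitive_root z -> period z 1 * period z (-1) = - quarter%:R.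
Proof.
move=> zp; have h1 := period_sum zp; have h2 := period_diff z.
have h3 := gauss_sum_sqr p_pr zp p_odd.
rewrite qcharN1_1mod4 // mul1r -h2 in h3.
apply: (mulfI (_ : 4%:R != 0 :> algC)); first by rewrite pnatr_eq0.
have -> : 4%:R * (period z 1 * period z (-1)) =
   (period z 1 + period z (-1)) ^+ 2 - (period z 1 - period z (-1)) ^+ 2 by ring.
by rewrite h1 h3 {1}p_quarter natrD natrM; ring.
Qed.

(** The relation between the two periods holds in characteristic zero, hence
    in every field containing a primitive [p]-th root of unity. *)
Lemma period_prod (A : fieldType) (z : A) : p.-primitive_root z ->
  period z 1 * period z (-1) = - quarter%:R.
Proof.
move=> zp; have [w wp] := C_prim_root_exists (prime_gt0 p_pr).
have rt : root (map_poly intr (period_poly 1 * period_poly (-1) + quarter%:R%:P)) w.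
  rewrite rootE rmorphD rmorphM hornerD hornerM /= !period_polyE period_prod_algC //.
  by rewrite map_polyC hornerC /= rmorph_nat addNr.
have [G hG] := Phi_int_dvd p_pr wp rt.
have := congr1 (fun q : {poly int} => (map_poly intr q).[z]) hG.
rewrite rmorphD !rmorphM !hornerD !hornerM /= !period_polyE Phi_root // mulr0.
rewrite map_polyC hornerC /= rmorph_nat => /eqP.
by rewrite addr_eq0 => /eqP.
Qed.

(** The norm of [b + (1 + sqrt p) / 2], also the minimal polynomial of the
    Gaussian periods. *)
Definition Fm (b : int) : int := b ^+ 2 + b - quarter%:Z.

Section Ell.
Variables (l : nat) (l_pr : prime l) (lp : l != p).

Lemma ell_neq0 : (l%:R : 'F_p) != 0.
Proof. by rewrite Fp_natr_eq0 // dvdn_prime2 // eq_sym. Qed.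

(** The field with [l ^ (p - 1)] elements will do, by Fermat. *)
Lemma prim_root_char_l : exists (L : finFieldType) (z : L), l \in [pchar L] /\ p.-primitive_root z.
Proof.
have p1 : (0 < p.-1)%N by have := odd_prime_gt2 p_odd p_pr; lia.
have [L chL cardL] := pPrimePowerField l_pr p1.
exists L.
have N0 : (0 < #|L|.-1)%N by have := card_finNzRing_gt1 L; case: #|_| => [|[]].
have hall : all (#|L|.-1).-unity_root (enum [pred x : L | x != 0]).
  apply/allP => x; rewrite mem_enum inE unity_rootE => x0.
  apply/eqP; apply: (mulfI x0); rewrite mulr1 -exprS prednK ?expf_card //.
  by rewrite ltnW // card_finNzRing_gt1.
have hsz : (#|L|.-1 <= size (enum [pred x : L | x != 0%R]))%N.
  by rewrite -cardE -(cardC1 (0 : L)); apply/eq_leq/eq_card.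
have /hasP[g _ gp] := has_prim_root N0 hall (enum_uniq _) hsz.
have pd : (p %| #|L|.-1)%N.
  rewrite cardL -subn1 -eqn_mod_dvd ?expn_gt0 ?prime_gt0 //.
  rewrite -totient_prime //; apply/eqP/Euler_exp_totient.
  by rewrite prime_coprime // dvdn_prime2.
by exists (g ^+ (#|L|.-1 %/ p)); split=> //; exact: dvdn_prim_root.
Qed.

Lemma period_frobenius (L : fieldType) (z : L) (e : int) : l \in [pchar L] -> p.-primitive_root z ->
  period z e ^+ l = period z (qchar (l%:R : 'F_p) * e).
Proof.
move=> chL zp; rewrite -(pFrobenius_autE chL) /period rmorph_sum /=.
rewrite [RHS](reindex_inj (mulfI ell_neq0)) /=.
apply: eq_big => [r|r _]; last first.
  rewrite pFrobenius_autE -[X in addchar z (_ * X)]natr_Zp -natrM (addchar_nat p_pr zp).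
  by rewrite /addchar -exprM mulnC.
rewrite qcharM //; case: (qchar_pm1 ell_neq0) => ->; first by rewrite !mul1r.
by rewrite !mulN1r eqr_opp.
Qed.

Lemma Fm_periods (L : fieldType) (z : L) (b : int) : p.-primitive_root z ->
  (Fm b)%:~R = (b%:~R - period z 1) * (b%:~R - period z (-1)) :> L.
Proof.
move=> zp; have h1 := period_sum zp; have h2 := period_prod zp.
have -> : (b%:~R - period z 1) * (b%:~R - period z (-1)) =
  b%:~R ^+ 2 - (period z 1 + period z (-1)) * b%:~R + period z 1 * period z (-1) by ring.
by rewrite h1 h2 /Fm rmorphB rmorphD rmorphXn /= mulN1r opprK -pmulrn.
Qed.

(** Quadratic reciprocity, uniformly for all primes [l] (2 included): the
    Frobenius of [l] fixes the two periods or exchanges them. *)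
Lemma Fm_root_qchar1 : qchar (l%:R : 'F_p) = 1 -> exists b : nat, (l %| Fm b)%Z.
Proof.
move=> ql; have [L [z [chL zp]]] := prim_root_char_l.
have fr := period_frobenius 1 chL zp; rewrite ql mul1r in fr.
pose rs : seq L := [seq b%:R | b <- iota 0 l].
have urs : uniq rs.
  rewrite map_inj_in_uniq ?iota_uniq // => i j; rewrite !mem_iota !add0n /= => il jl /eqP.
  wlog ij : i j il jl / (i <= j)%N => [hw|].
    by case/orP: (leq_total i j) => h e; [exact: hw | apply/esym/hw => //; rewrite eq_sym].
  rewrite eq_sym -subr_eq0 -natrB // -(dvdn_pcharf chL) => dv.
  by apply/eqP; rewrite eqn_leq ij -subn_eq0 /=; apply: contraLR dv => h; rewrite gtnNdvd //; lia.
have rrs b : b \in rs -> b ^+ l = b.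
  by move=> /mapP[i _ ->]; rewrite -(pFrobenius_autE chL) rmorph_nat.
have : period z 1 \in rs.
  apply: contraT => nin.
  have sz : size ('X^l - 'X : {poly L}) = l.+1.
    by rewrite size_polyDl size_polyXn // size_polyN size_polyX ltnS prime_gt1.
  have nz : 'X^l - 'X != 0 :> {poly L} by rewrite -size_poly_eq0 sz.
  have := @max_poly_roots _ _ (period z 1 :: rs) nz.
  rewrite sz /= nin urs size_map size_iota ltnn => -> //.
  rewrite rootE !hornerE fr subrr eqxx /=.
  by apply/allP => b /rrs bl; rewrite rootE !hornerE bl subrr.
case/mapP => b _ pb; exists b.
rewrite (dvdz_pcharf chL) (Fm_periods b zp) -pmulrn pb.
by rewrite subrr mul0r.
Qed.

Lemma Fm_root_qcharN1 : qchar (l%:R : 'F_p) = -1 -> forall b : int, ~~ (l %| Fm b)%Z.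
Proof.
move=> ql b; have [L [z [chL zp]]] := prim_root_char_l.
have fr e := period_frobenius e chL zp; rewrite ql in fr.
rewrite (dvdz_pcharf chL) (Fm_periods b zp) mulf_eq0 !subr_eq0.
have bl : (b%:~R : L) ^+ l = b%:~R by rewrite -(pFrobenius_autE chL) rmorph_int.
have neq : period z 1 != period z (-1).
  rewrite -subr_eq0 -sqrf_eq0.
  have -> : (period z 1 - period z (-1)) ^+ 2 =
     (period z 1 + period z (-1)) ^+ 2 - 4%:R * (period z 1 * period z (-1)) by ring.
  rewrite period_sum // period_prod // sqrrN expr1n mulrN opprK -natrM addrC natr1 -addn1 -p_quarter.
  by rewrite -(dvdn_pcharf chL) dvdn_prime2.
rewrite negb_or; apply/andP; split; apply/eqP => e.
  by move/eqP: neq; apply; rewrite -[LHS]e -bl e fr mulN1r.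
by move/eqP: neq; apply; rewrite -[RHS]e -bl e fr mulN1r opprK.
Qed.

End Ell.

End Reciprocity.

(** * Roots of the norm polynomial modulo an integer *)

Section RootCount.

Variables (p : nat) (p_pr : prime p) (p_odd : odd p).
Hypothesis p14 : (p %% 4 = 1)%N.

(** The number of primitive ideals of norm [a], see [jset] below. *)
Definition rho (a : nat) : nat := #|[pred b : 'I_a | (a %| Fm p (b : nat))%Z]|.

Lemma Fm_sub (x y : int) : Fm p x - Fm p y = (x - y) * (x + y + 1).
Proof. by rewrite /Fm; ring. Qed.

Lemma Fm_disc (x : int) : 4 * Fm p x = (2 * x + 1) ^+ 2 - p%:Z.
Proof. by rewrite [in RHS](p_quarter p_pr p_odd p14) /Fm PoszD PoszM; ring. Qed.

Lemma Fm_disc_dvd (d x : int) : (d %| 2 * x + 1)%Z -> (d %| Fm p x)%Z -> (d %| p%:Z)%Z.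
Proof.
move=> d1 d2; have -> : p%:Z = (2 * x + 1) ^+ 2 - 4 * Fm p x by rewrite Fm_disc; ring.
by apply: rpredB; [rewrite expr2 dvdz_mull | rewrite dvdz_mull].
Qed.

Lemma Fm_mod (a : int) (x y : int) : (a %| x - y)%Z -> (a %| Fm p x)%Z = (a %| Fm p y)%Z.
Proof.
move=> axy; rewrite -[Fm p x](subrK (Fm p y)) Fm_sub rpredDl //.
by rewrite dvdz_mulr.
Qed.

Definition ord_of_int (N : nat) (x : int) (N0 : (0 < N)%N) : 'I_N.
Proof.
apply: (@Ordinal N `|(x %% N)%Z|%N).
by have := @ltz_pmod x N; rewrite ltz_nat N0 => /(_ isT); have := @modz_ge0 x N; lia.
Defined.

Lemma ord_of_intP (N : nat) (x : int) (N0 : (0 < N)%N) :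
  (N %| (ord_of_int x N0 : nat)%:Z - x)%Z.
Proof.
rewrite /= gez0_abs; last by rewrite modz_ge0; lia.
by rewrite -eqz_mod_dvd modz_mod.
Qed.

Lemma ord_eq_of_dvd (N : nat) (x y : 'I_N) : (N %| (x : nat)%:Z - (y : nat)%:Z)%Z -> x = y.
Proof.
rewrite -eqz_mod_dvd -[_ == _]/((x%:Z %% N)%Z == (y%:Z %% N)%Z) !modz_nat eqz_nat.
by rewrite !modn_small // => /eqP h; exact/val_inj.
Qed.

Lemma rho1 : rho 1 = 1%N.
Proof.
rewrite /rho -[RHS](card_ord 1); apply: eq_card => b.
by rewrite !inE /= dvd1z.
Qed.

Lemma rhoM (u v : nat) : (0 < u)%N -> (0 < v)%N -> coprime u v -> rho (u * v) = (rho u * rho v)%N.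
Proof.
move=> u0 v0 cuv; rewrite /rho.
pose f (b : 'I_(u * v)) : 'I_u * 'I_v := (ord_of_int (b : nat) u0, ord_of_int (b : nat) v0).
have finj : injective f.
  move=> x y [/(congr1 Posz) h1 /(congr1 Posz) h2]; apply: ord_eq_of_dvd.
  rewrite PoszM Gauss_dvdz ?coprimezE //.
  have d (N : nat) (N0 : (0 < N)%N) : `|((x : nat) %% N)%Z|%N = `|((y : nat) %% N)%Z|%N :> int ->
      (N %| (x : nat)%:Z - (y : nat)%:Z)%Z.
    rewrite !gez0_abs ?modz_ge0 //; [|lia|lia].
    by move=> /eqP; rewrite -eqz_mod_dvd.
  by rewrite !d.
have fbij : bijective f.
  by apply: inj_card_bij => //; rewrite card_prod !card_ord.
rewrite -!sum1_card big_distrlr /= pair_big /= (reindex f) /=; last exact: onW_bij.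
apply: eq_bigl => b; rewrite !inE /= PoszM Gauss_dvdz ?coprimezE //.
by congr (_ && _); apply: Fm_mod; rewrite -opprB rpredN ord_of_intP.
Qed.

(** [l] divides only one of the two factors of [Fm x - Fm y]: their sum is
    [2 x + 1], whose square is [p] modulo [l]. *)
Lemma Fm_root_split (l k : nat) (x y : int) : prime l -> l != p -> (0 < k)%N ->
  ((l ^ k)%N %| Fm p x)%Z -> ((l ^ k)%N %| Fm p y)%Z ->
  ((l ^ k)%N %| x - y)%Z \/ ((l ^ k)%N %| x + y + 1)%Z.
Proof.
move=> l_pr lp k0 hx hy.
have hl : (l %| Fm p x)%Z.
  by apply: dvdz_trans hx; rewrite dvdzE /= dvdn_exp.
have prod : ((l ^ k)%N %| (x - y) * (x + y + 1))%Z by rewrite -Fm_sub rpredB.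
have cop (u : int) : ~~ (l %| u)%Z -> coprimez (l ^ k)%N u.
  by rewrite dvdzE /= coprimezE /= -prime_coprime // => h; rewrite coprimeXl.
have [lxy|/cop h] := boolP (l %| x - y)%Z; last first.
  by right; rewrite Gauss_dvdzr in prod.
have [lxy1|/cop h] := boolP (l %| x + y + 1)%Z; last first.
  by left; rewrite Gauss_dvdzl in prod.
have : (l %| p%:Z)%Z.
  apply: (Fm_disc_dvd _ hl).
  by have -> : 2 * x + 1 = (x - y) + (x + y + 1); [ring | rewrite rpredD].
by rewrite dvdzE /= dvdn_prime2 // (negbTE lp).
Qed.

(** Newton's iteration converges since [2 x + 1], the derivative, is invertible
    modulo [l]: its square is [p] there. *)
Lemma Fm_hensel (l : nat) (b : int) : prime l -> l != p -> (l %| Fm p b)%Z ->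
  forall k, exists x : int, ((l ^ k)%N %| Fm p x)%Z.
Proof.
move=> l_pr lp lb k.
suff [x hx _] : exists2 x : int, ((l ^ k)%N %| Fm p x)%Z & (l %| Fm p x)%Z by exists x.
elim: k => [|k [x xk xl]]; first by exists b => //; exact: dvd1z.
have [k0|k0] := eqVneq k 0%N; first by exists x; rewrite // k0 expn1.
have cop : coprimez (2 * x + 1) l.
  rewrite coprimez_sym coprimezE /= prime_coprime //; apply/negP => h.
  have : (l %| p%:Z)%Z.
    exact: (@Fm_disc_dvd l x h xl).
  by rewrite dvdzE /= dvdn_prime2 // (negbTE lp).
have [[u v] /= uv] := coprimezP _ _ cop.
have /dvdzP[c hc] := xk.
exists (x - c * u * (l ^ k)%N%:Z); last first.
  rewrite (@Fm_mod l _ x) // addrAC subrr add0r rpredN dvdz_mull //.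
  by rewrite dvdzE /= dvdn_exp // lt0n.
have -> : Fm p (x - c * u * (l ^ k)%N%:Z) =
   (l ^ k)%N%:Z * (c - c * (u * (2 * x + 1))) + (c * u) ^+ 2 * (l ^ k)%N%:Z ^+ 2.
  rewrite -[Fm p (x - _)](subrK (Fm p x)) Fm_sub hc; ring.
have -> : c - c * (u * (2 * x + 1)) = c * v * l%:Z.
  by rewrite (canRL (addrK _) uv); ring.
rewrite rpredD //; last first.
  rewrite dvdz_mull // dvdzE abszX /= -expnM dvdn_exp2l //.
  by move: k0; rewrite -lt0n; lia.
by rewrite expnSr PoszM dvdz_mul // dvdz_mull.
Qed.

Lemma rho_prime_power1 (l k : nat) : prime l -> l != p ->
  qchar (l%:R : 'F_p) = 1 -> rho (l ^ k.+1) = 2%N.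
Proof.
move=> l_pr lp ql.
have [b lb] := Fm_root_qchar1 p_pr p_odd p14 l_pr lp ql.
have [x hx] := Fm_hensel l_pr lp lb k.+1.
have N0 : (0 < l ^ k.+1)%N by rewrite expn_gt0 prime_gt0.
pose x0 := ord_of_int x N0; pose x1 := ord_of_int (- 1 - x) N0.
have h0 := ord_of_intP x N0; have h1 := ord_of_intP (-1 - x) N0.
have r0 : ((l ^ k.+1)%N %| Fm p (x0 : nat))%Z by rewrite (Fm_mod h0).
have r1 : ((l ^ k.+1)%N %| Fm p (x1 : nat))%Z.
  rewrite (Fm_mod h1) -[Fm p _](subrK (Fm p x)) Fm_sub rpredDl //.
  have -> : (-1 - x + x + 1) = 0 by ring.
  by rewrite mulr0 dvdz0.
have neq : x0 != x1.
  apply/eqP => e; have d : ((l ^ k.+1)%N %| 2 * x + 1)%Z.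
    have -> : 2 * x + 1 = ((x1 : nat)%:Z - (-1 - x)) - ((x0 : nat)%:Z - x) by rewrite e; ring.
    by rewrite rpredB.
  have dl (u : int) : ((l ^ k.+1)%N %| u)%Z -> (l %| u)%Z.
    by apply: dvdz_trans; rewrite dvdzE /= dvdn_exp.
  have : (l %| p%:Z)%Z by apply: (Fm_disc_dvd (dl _ d)); exact: dl.
  by rewrite dvdzE /= dvdn_prime2 // (negbTE lp).
rewrite /rho -(_ : #|[set x0; x1]| = 2%N); last by rewrite cards2 neq.
apply: eq_card => y; rewrite !inE; apply/idP/orP => [ry|[/eqP->|/eqP->]] //.
have [d|d] := Fm_root_split l_pr lp (ltn0Sn k) ry hx.
  left; apply/eqP; apply: ord_eq_of_dvd.
  have -> : (y : nat)%:Z - (x0 : nat)%:Z = ((y : nat)%:Z - x) - ((x0 : nat)%:Z - x) by ring.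
  by rewrite rpredB.
right; apply/eqP; apply: ord_eq_of_dvd.
have -> : (y : nat)%:Z - (x1 : nat)%:Z = ((y : nat)%:Z + x + 1) - ((x1 : nat)%:Z - (-1 - x)) by ring.
by rewrite rpredB.
Qed.

Lemma rho_prime_powerN1 (l k : nat) : prime l -> l != p ->
  qchar (l%:R : 'F_p) = -1 -> rho (l ^ k.+1) = 0%N.
Proof.
move=> l_pr lp ql; apply: eq_card0 => b; rewrite !inE; apply/negP => h.
have /negP := Fm_root_qcharN1 p_pr p_odd p14 l_pr lp ql (b : nat).
by apply; apply: dvdz_trans h; rewrite dvdzE /= dvdn_exp.
Qed.

Lemma Fm_root_p (x : int) : (p %| Fm p x)%Z -> (p %| 2 * x + 1)%Z.
Proof.
move=> h; have : (p %| (2 * x + 1) ^+ 2)%Z.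
  have -> : (2 * x + 1) ^+ 2 = 4 * Fm p x + p%:Z by rewrite Fm_disc; ring.
  by rewrite rpredD ?dvdz_mull // dvdzz.
by rewrite dvdzE abszX /= Euclid_dvdX // andbT.
Qed.

(** The discriminant is [p], so [Fm] has a double root modulo [p]. *)
Lemma rho_p : rho p = 1%N.
Proof.
have np : ((p - 1) %/ 2 < p)%N by have := odd_prime_gt2 p_odd p_pr; lia.
rewrite /rho -(card1 (Ordinal np)); apply: eq_card => b; rewrite !inE.
have hn : 2 * ((p - 1) %/ 2)%N%:Z + 1 = p%:Z.
  by have := half_double p_pr p_odd; have := prime_gt0 p_pr; lia.
have cop2 : coprimez p 2.
  by rewrite coprimezE /= coprimen2.
apply/idP/eqP => [/Fm_root_p h|->] /=.
  apply: ord_eq_of_dvd => /=; rewrite -(Gauss_dvdzr _ cop2).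
  set n := (_ %/ _)%N in hn *.
  have -> : 2 * ((b : nat)%:Z - n%:Z) = (2 * (b : nat)%:Z + 1) - (2 * n%:Z + 1) by ring.
  by rewrite hn rpredB // dvdzz.
have cop4 : coprimez p 4 by have : coprime p (2 ^ 2) by rewrite coprimeXr // coprimen2.
rewrite -(Gauss_dvdzr _ cop4) Fm_disc hn rpredB ?dvdzz //.
by rewrite expr2 dvdz_mulr // dvdzz.
Qed.

Lemma rho_p_power (k : nat) : rho (p ^ k.+2) = 0%N.
Proof.
apply: eq_card0 => b; rewrite !inE; apply/negP => h.
have h2 : ((p ^ 2)%N %| Fm p (b : nat))%Z.
  by apply: dvdz_trans h; rewrite dvdzE /= dvdn_exp2l.
have /Fm_root_p h1 : (p %| Fm p (b : nat))%Z.
  by apply: dvdz_trans h2; rewrite dvdzE /= dvdn_exp.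
have : ((p ^ 2)%N %| p%:Z)%Z.
  have -> : p%:Z = (2 * (b : nat)%:Z + 1) ^+ 2 - 4 * Fm p (b : nat) by rewrite Fm_disc; ring.
  apply: rpredB; last by rewrite dvdz_mull.
  by rewrite expr2 -mulnn PoszM dvdz_mul.
rewrite dvdzE /= => /dvdn_leq => /(_ (prime_gt0 p_pr)).
by have := prime_gt1 p_pr; rewrite -mulnn; nia.
Qed.

End RootCount.

(** * Counting ideals by norm *)

Section Convolution.

Definition conv (u v : nat -> int) (n : nat) : int := \sum_(d <- divisors n) u d * v (n %/ d)%N.

Definition multiplicative_fun (u : nat -> int) :=
  forall a b, (0 < a)%N -> (0 < b)%N -> coprime a b -> u (a * b)%N = u a * u b.

Lemma divisors_coprime (a b : nat) : (0 < a)%N -> (0 < b)%N -> coprime a b ->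
  perm_eq (divisors (a * b)) [seq (x * y)%N | x <- divisors a, y <- divisors b].
Proof.
move=> a0 b0 cab; have ab0 : (0 < a * b)%N by rewrite muln_gt0 a0.
apply: uniq_perm; first exact: divisors_uniq.
  apply: allpairs_uniq; rewrite ?divisors_uniq // => -[x y] [x' y'] /=.
  move=> /allpairsP[[x1 y1] /= [h1 h2 [-> ->]]] /allpairsP[[x2 y2] /= [h3 h4 [-> ->]]] e.
  rewrite -!dvdn_divisors // in h1 h2 h3 h4.
  have gx (s t : nat) : (s %| a)%N -> (t %| b)%N -> gcdn (s * t) a = s.
    move=> xa yb; rewrite gcdnC Gauss_gcdl; first exact/gcdn_idPr.
    exact: coprime_dvdr yb cab.
  have gy (s t : nat) : (s %| a)%N -> (t %| b)%N -> gcdn (s * t) b = t.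
    move=> xa yb; rewrite gcdnC Gauss_gcdr; first exact/gcdn_idPr.
    by rewrite coprime_sym; exact: coprime_dvdl xa cab.
  by rewrite -(gx x1 y1) // e gx // -(gy x1 y1) // e gy.
move=> d; rewrite -dvdn_divisors //; apply/idP/allpairsP => [dab|[[x y] /= [xa yb ->]]].
  exists (gcdn d a, gcdn d b); rewrite -!dvdn_divisors //= !dvdn_gcdr; split=> //.
  apply/eqP; rewrite eqn_dvd; apply/andP; split; last first.
    rewrite Gauss_dvd ?dvdn_gcdl //.
    by apply: coprime_dvdl (dvdn_gcdr _ _) _; apply: coprime_dvdr (dvdn_gcdr _ _) _.
  have h : (d %| gcdn (d * b) (a * b))%N by rewrite dvdn_gcd dvdn_mulr.
  rewrite -muln_gcdl in h.
  have : (d %| gcdn (gcdn d a * d) (gcdn d a * b))%N by rewrite dvdn_gcd h dvdn_mull.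
  by rewrite -muln_gcdr.
by rewrite -!dvdn_divisors // in xa yb; exact: dvdn_mul.
Qed.

Lemma conv_multiplicative u v :
  multiplicative_fun u -> multiplicative_fun v -> multiplicative_fun (conv u v).
Proof.
move=> mu mv a b a0 b0 cab; rewrite /conv (perm_big _ (divisors_coprime a0 b0 cab)) /=.
rewrite big_allpairs_dep /= big_distrlr /= big_seq [RHS]big_seq; apply: eq_bigr => x xa.
rewrite big_seq [RHS]big_seq; apply: eq_bigr => y yb.
rewrite -!dvdn_divisors // in xa yb.
have x0 : (0 < x)%N by apply: dvdn_gt0 xa.
have y0 : (0 < y)%N by apply: dvdn_gt0 yb.
have cxy : coprime x y by apply: coprime_dvdl xa _; apply: coprime_dvdr yb _.
have -> : (a * b %/ (x * y) = (a %/ x) * (b %/ y))%N.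
  by rewrite -{1}(divnK xa) -{1}(divnK yb) mulnACA mulnK // muln_gt0 x0.
have ax0 : (0 < a %/ x)%N by rewrite divn_gt0 // dvdn_leq.
have by0 : (0 < b %/ y)%N by rewrite divn_gt0 // dvdn_leq.
have cq : coprime (a %/ x) (b %/ y).
  by apply: coprime_dvdl (dvdn_div xa) _; exact: coprime_dvdr (dvdn_div yb) _.
by rewrite (mu _ _ x0 y0 cxy) (mv _ _ ax0 by0 cq) mulrACA.
Qed.

Lemma conv_prime_power u v (l k : nat) : prime l ->
  conv u v (l ^ k) = \sum_(0 <= i < k.+1) u (l ^ i)%N * v (l ^ (k - i))%N.
Proof.
move=> l_pr; have l0 := prime_gt0 l_pr; have l1 := prime_gt1 l_pr.
have pe : perm_eq (divisors (l ^ k)) [seq (l ^ i)%N | i <- iota 0 k.+1].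
  apply: uniq_perm; first exact: divisors_uniq.
    rewrite map_inj_uniq ?iota_uniq // => i j; exact: expnI.
  move=> d; rewrite -dvdn_divisors ?expn_gt0 ?l0 //.
  apply/(dvdn_pfactor _ _ l_pr)/mapP => -[i hi ->]; exists i => //.
    by rewrite mem_iota.
  by rewrite mem_iota in hi.
rewrite /conv (perm_big _ pe) big_map /index_iota subn0.
rewrite big_seq [RHS]big_seq; apply: eq_bigr => i; rewrite mem_iota add0n ltnS => /andP[_ ik].
by rewrite -expnB.
Qed.

Lemma multiplicative_ext u v : multiplicative_fun u -> multiplicative_fun v ->
  (forall l k, prime l -> u (l ^ k)%N = v (l ^ k)%N) ->
  forall n, (0 < n)%N -> u n = v n.
Proof.
move=> mu mv uv n; elim/ltn_ind: n => n IH n0.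
have [n1|n1] := leqP n 1.
  have -> : n = (2 ^ 0)%N by rewrite expn0; lia.
  exact: uv.
have l_pr := pdiv_prime n1.
have [m lm e] := pfactor_coprime l_pr n0; set k := logn _ _ in e.
have k0 : (0 < k)%N by rewrite logn_gt0 mem_primes l_pr n0 pdiv_dvd.
have m0 : (0 < m)%N by move: n0; rewrite e muln_gt0 => /andP[].
have lk1 : (1 < pdiv n ^ k)%N by rewrite -(exp1n k) ltn_exp2r // prime_gt1.
have cml : coprime m (pdiv n ^ k) by rewrite coprimeXr // coprime_sym.
have mn : (m < n)%N by rewrite [ltnRHS]e -[ltnLHS]muln1 ltn_pmul2l.
by rewrite e mu ?mv ?(ltnW lk1) // IH // uv.
Qed.

(** Both sides count the pairs [(a, e)] with [a e <= X]. *)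
Lemma sum_conv u v (X : nat) :
  \sum_(1 <= n < X.+1) conv u v n =
  \sum_(1 <= a < X.+1) \sum_(1 <= e < X.+1 | (a * e <= X)%N) u a * v e.
Proof.
have E n : (1 <= n <= X)%N -> conv u v n =
    \sum_(1 <= a < X.+1) \sum_(1 <= e < X.+1 | (a * e == n)%N) u a * v e.
  move=> /andP[n0 nX].
  have dv (a : nat) : (0 < a)%N -> \sum_(1 <= e < X.+1 | (a * e == n)%N) u a * v e =
      if (a %| n)%N then u a * v (n %/ a)%N else 0.
    move=> a0; case: ifP => an.
      rewrite -big_filter (_ : [seq e <- index_iota 1 X.+1 | (a * e == n)%N] = [:: (n %/ a)%N]).
        by rewrite big_seq1.
      have -> : [seq e <- index_iota 1 X.+1 | (a * e == n)%N] =
                [seq e <- index_iota 1 X.+1 | e == (n %/ a)%N].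
        by apply: eq_filter => e; rewrite -[in LHS](divnK an) mulnC eqn_pmul2r.
      rewrite filter_pred1_uniq ?iota_uniq // mem_index_iota ltnS.
      rewrite divn_gt0 // dvdn_leq //= (leq_trans (leq_div _ _)) //.
    rewrite big1 // => e /eqP ae; move: an.
    by rewrite -ae dvdn_mulr.
  rewrite [RHS](eq_big_nat _ _ (F2 := fun a => if (a %| n)%N then u a * v (n %/ a)%N else 0)); last first.
    by move=> a /andP[a0 _]; exact: dv.
  rewrite -big_mkcond -big_filter /conv; apply: perm_big; apply: uniq_perm.
  - exact: divisors_uniq.
  - by rewrite filter_uniq // iota_uniq.
  move=> d; rewrite mem_filter mem_index_iota -dvdn_divisors //.
  case dn : (d %| n)%N => //=; rewrite ltnS.
  by rewrite (dvdn_gt0 n0 dn) (leq_trans (dvdn_leq n0 dn)).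
rewrite (eq_big_nat _ _ (F2 := fun n => \sum_(1 <= a < X.+1) \sum_(1 <= e < X.+1 | (a * e == n)%N) u a * v e)); last first.
  by move=> n /andP[n1 nX]; rewrite E // n1 -ltnS.
rewrite exchange_big /=; apply: eq_big_nat => a /andP[a1 _].
rewrite (exchange_big_dep xpredT) //= [RHS]big_mkcond /=.
apply: eq_big_nat => e /andP[e1 _].
rewrite -big_filter; case: ifP => ae.
  rewrite (_ : [seq i <- _ | _] = [:: (a * e)%N]) ?big_seq1 //.
  rewrite (eq_filter (a2 := pred1 (a * e)%N)); last by move=> i; rewrite /= eq_sym.
  by rewrite filter_pred1_uniq ?iota_uniq // mem_index_iota muln_gt0 a1 e1 ltnS.
rewrite (_ : [seq i <- _ | _] = [::]) ?big_nil //.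
apply/eqP; rewrite -[_ == _]negbK -has_filter; apply/hasPn => i.
rewrite mem_index_iota ltnS => /andP[_ iX]; apply/negP => /eqP h.
by move: iX; rewrite -h ae.
Qed.

End Convolution.

Section Squares.

Definition is_square (e : nat) : bool := [exists c : 'I_e.+1, (c * c == e)%N].

Lemma is_squareP e : reflect (exists c, (c * c = e)%N) (is_square e).
Proof.
apply: (iffP existsP) => [[c /eqP h]|[c h]]; first by exists c.
have ce : (c < e.+1)%N by rewrite ltnS -h; case: (c) => // k; rewrite leq_pmulr.
by exists (Ordinal ce); rewrite /= h.
Qed.

Lemma is_square_coprimel (a b : nat) : coprime a b -> is_square (a * b) -> is_square a.
Proof.
move=> cab /is_squareP[c h]; apply/is_squareP; exists (gcdn a c).
rewrite {1}muln_gcdr.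
have -> : (gcdn a c * c = a * gcdn c b)%N by rewrite muln_gcdl h muln_gcdr.
rewrite mulnC -muln_gcdr; have -> : gcdn (gcdn a c) (gcdn c b) = 1%N; last by rewrite muln1.
apply/eqP; rewrite -dvdn1 -(eqP cab) dvdn_gcd.
rewrite (dvdn_trans (dvdn_gcdl _ _)) ?dvdn_gcdl //=.
by rewrite (dvdn_trans (dvdn_gcdr _ _)) ?dvdn_gcdr.
Qed.

Lemma is_squareM (a b : nat) : coprime a b -> is_square (a * b) = is_square a && is_square b.
Proof.
move=> cab; apply/idP/andP => [h|[/is_squareP[c <-] /is_squareP[d <-]]].
  split; first exact: is_square_coprimel h.
  by apply: (@is_square_coprimel b a); rewrite 1?coprime_sym // mulnC.
by apply/is_squareP; exists (c * d)%N; rewrite mulnACA.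
Qed.

Lemma is_square_prime_power (l j : nat) : prime l -> is_square (l ^ j) = ~~ odd j.
Proof.
move=> l_pr; apply/is_squareP/idP => [[c h]|ev].
  have c0 : (0 < c)%N.
    by case: c h => // /esym/eqP; rewrite mul0n expn_eq0; case: l l_pr.
  by have := congr1 (logn l) h; rewrite lognM // pfactorK // => <-; rewrite addnn odd_double.
exists (l ^ j./2)%N; rewrite -expnD addnn.
by rewrite -[in RHS](odd_double_half j) (negbTE ev).
Qed.

End Squares.

Section IdealCount.

Variables (p : nat) (p_pr : prime p) (p_odd : odd p).
Hypothesis p14 : (p %% 4 = 1)%N.

Let q (d : nat) : int := qchar (d%:R : 'F_p).

Lemma rho_prime_powerS (l k : nat) : prime l ->
  (rho p (l ^ k.+1))%:Z = q l ^+ k + q l ^+ k.+1.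
Proof.
move=> l_pr; have [->|lp] := eqVneq l p.
  have -> : q p = 0 by rewrite /q (_ : _%:R = 0) ?qchar0 //; apply/eqP; rewrite Fp_natr_eq0.
  case: k => [|k]; first by rewrite expn1 rho_p.
  by rewrite rho_p_power // !expr0n.
have l0 : (l%:R : 'F_p) != 0 by rewrite Fp_natr_eq0 // dvdn_prime2 // eq_sym.
case: (qchar_pm1 l0) => ql.
  by rewrite rho_prime_power1 // /q ql !expr1n.
by rewrite rho_prime_powerN1 // /q ql exprS mulN1r subrr.
Qed.

Lemma rho_conv_prime_power (l k : nat) : prime l ->
  conv (fun a => (rho p a)%:Z) (fun e => (is_square e)%:Z) (l ^ k) = conv q (fun=> 1) (l ^ k).
Proof.
move=> l_pr; rewrite !conv_prime_power //.
have qX i : q (l ^ i)%N = q l ^+ i.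
  rewrite /q natrX; elim: i => [|i IH]; first by rewrite !expr0 qchar1.
  by rewrite !exprS qcharM // IH.
under [RHS]eq_bigr do rewrite mulr1 qX.
under [LHS]eq_bigr do rewrite is_square_prime_power //.
(* from [k] to [k + 2], both sides grow by [q l ^+ k.+1 + q l ^+ k.+2] *)
have [m] := ubnP k; elim: m k => // m IH [_|[_|k km]].
- by rewrite !big_nat1 rho1.
- by rewrite !big_nat_recr //= !big_geq // rho1 mulr0 !add0r rho_prime_powerS // mulr1.
rewrite big_nat_recr //= [in LHS]big_nat_recr //= subnn subSnn /= mulr0 addr0 mulr1.
rewrite [in RHS]big_nat_recr //= [in RHS]big_nat_recr //= -addrA -rho_prime_powerS //.
rewrite -IH; last by lia.
congr (_ + _); apply: eq_big_nat => i /andP[_ ik].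
by rewrite -addn2 -addnBAC // addn2 /= negbK.
Qed.

(** An ideal of norm [n] is a square [c ^ 2] times a primitive ideal, so the left
    side counts the ideals of norm [n]: coefficient by coefficient, this is the
    factorization of the zeta function of the field as [zeta(s) L(s, chi)]. *)
Lemma rho_conv (n : nat) : (0 < n)%N ->
  conv (fun a => (rho p a)%:Z) (fun e => (is_square e)%:Z) n = conv q (fun=> 1) n.
Proof.
apply: multiplicative_ext.
- apply: conv_multiplicative => a b a0 b0 cab; first by rewrite rhoM.
  by rewrite is_squareM // -PoszM mulnb.
- apply: conv_multiplicative => a b a0 b0 cab; last by rewrite mulr1.
  by rewrite /q natrM qcharM.
- by move=> l k; exact: rho_conv_prime_power.
Qed.

(** The number of triples [(c, a, b)] with [c^2 a <= X] and [b] a root of [Fm]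
    modulo [a], that is of the ideals of norm at most [X], see [size_triples]. *)
Definition ideal_count (X : nat) : nat :=
  \sum_(1 <= c < X.+1) \sum_(1 <= a < X.+1 | (c * c * a <= X)%N) rho p a.

Lemma ideal_countE (X : nat) :
  (ideal_count X)%:Z = \sum_(1 <= d < X.+1) q d * (X %/ d)%N%:Z.
Proof.
transitivity (\sum_(1 <= n < X.+1) conv q (fun=> 1) n); last first.
  rewrite sum_conv; apply: eq_big_nat => d /andP[d1 dX].
  rewrite -mulr_sumr; congr (_ * _).
  have -> : \sum_(1 <= e < X.+1 | (d * e <= X)%N) (1 : int) = \sum_(1 <= e < (X %/ d).+1) 1.
    rewrite [RHS](big_nat_widen _ _ X.+1) ?ltnS ?leq_div //.
    by apply: eq_bigl => e; rewrite ltnS leq_divRL // mulnC.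
  by rewrite big_const_nat iter_addr_0 subn1 natz.
transitivity (\sum_(1 <= n < X.+1) conv (fun a => (rho p a)%:Z) (fun e => (is_square e)%:Z) n); last first.
  by apply: eq_big_nat => n /andP[n1 _]; exact: rho_conv.
rewrite sum_conv /ideal_count (exchange_big_dep xpredT) //= (big_morph Posz PoszD (erefl _)).
apply: eq_big_nat => a /andP[a1 _]; rewrite (big_morph Posz PoszD (erefl _)).
have sqE e : (1 <= e <= X)%N -> (is_square e)%:Z = \sum_(1 <= c < X.+1 | (c * c == e)%N) 1%:Z.
  move=> /andP[e1 eX]; case: is_squareP => [[c h]|h]; last first.
    by rewrite big1 // => c /eqP hc; case: h; exists c.
  have cX : (1 <= c <= X)%N by move: h e1 eX; nia.
  rewrite -big_filter (eq_filter (a2 := pred1 c)).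
    by rewrite filter_pred1_uniq ?iota_uniq ?big_seq1 // mem_index_iota.
  by move=> d /=; rewrite -h !mulnn eqn_exp2r.
transitivity (\sum_(1 <= e < X.+1 | (a * e <= X)%N) \sum_(1 <= c < X.+1 | (c * c == e)%N) (rho p a)%:Z); last first.
  apply: congr_big_nat => // e /andP[_ e1].
  by rewrite sqE // mulr_sumr; apply: eq_bigr => c _; rewrite mulr1.
rewrite (exchange_big_dep xpredT) //= [LHS]big_mkcond /=.
apply: eq_big_nat => c /andP[c1 _].
rewrite -big_filter; case: ifP => ac.
  rewrite (_ : [seq e <- _ | _] = [:: (c * c)%N]) ?big_seq1 //.
  have -> : [seq e <- index_iota 1 X.+1 | (a * e <= X)%N && (c * c == e)%N] =
      [seq e <- index_iota 1 X.+1 | pred1 (c * c)%N e].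
    apply: eq_filter => e /=; rewrite [e == _]eq_sym; case: eqP => [<-|]; rewrite ?andbF //.
    by rewrite andbT mulnC.
  rewrite filter_pred1_uniq ?iota_uniq // mem_index_iota muln_gt0 c1 ltnS /=.
  by apply: leq_trans ac; rewrite leq_pmulr.
rewrite (_ : [seq i <- _ | _] = [::]) ?big_nil //.
apply/eqP; rewrite -[_ == _]negbK -has_filter; apply/hasPn => e _.
by apply/negP => /andP[h /eqP ce]; move: h; rewrite -ce mulnC ac.
Qed.

End IdealCount.

(** * Asymptotics with square root error *)

Section Asymptotics.

Variable R : realType.

Definition sqrt_asymp (f : nat -> R) (kappa : R) : Prop :=
  exists C : R, forall X : nat, (0 < X)%N -> `|f X - kappa * X%:R| <= C * Num.sqrt X%:R.

Lemma sqrt_asympD f g k l : sqrt_asymp f k -> sqrt_asymp g l ->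
  sqrt_asymp (fun X => f X + g X) (k + l).
Proof.
move=> [C hC] [D hD]; exists (C + D) => X X0.
have -> : f X + g X - (k + l) * X%:R = (f X - k * X%:R) + (g X - l * X%:R) by ring.
by rewrite (le_trans (ler_normD _ _)) // mulrDl lerD ?hC ?hD.
Qed.

Lemma sqrt_asymp_sum (I : eqType) (s : seq I) (f : I -> nat -> R) k :
  (forall i, i \in s -> sqrt_asymp (f i) k) ->
  sqrt_asymp (fun X => \sum_(i <- s) f i X) ((size s)%:R * k).
Proof.
elim: s => [|i s IH] h.
  by exists 0 => X _; rewrite big_nil mul0r mul0r subrr normr0 mul0r.
have [C hC] := sqrt_asympD (h i (mem_head _ _)) (IH (fun j hj => h j (mem_behead (s := i :: s) hj))).
by exists C => X X0; rewrite big_cons /= -natr1 mulrDl mul1r [_ + k]addrC; exact: hC.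
Qed.

Lemma archi_sqrt (x : R) : exists2 X : nat, (0 < X)%N & x < Num.sqrt X%:R.
Proof.
have := archi_boundP (normr_ge0 x); set N := Num.bound _ => hN.
exists (N.+1 ^ 2)%N; first by rewrite expn_gt0.
rewrite natrX sqrtr_sqr ger0_norm ?ler0n //.
by rewrite (le_lt_trans (ler_norm _)) // (lt_trans hN) // ltr_nat.
Qed.

(** An error [sqrt X] is negligible against [X]; this is how counting
    inequalities become inequalities between densities. *)
Lemma sqrt_asymp_le f g k l : sqrt_asymp f k -> sqrt_asymp g l ->
  (forall X, (0 < X)%N -> f X <= g X) -> k <= l.
Proof.
move=> [C hC] [D hD] fg; rewrite leNgt; apply/negP => lk.
have kl : 0 < k - l by rewrite subr_gt0.
have [X X0 hX] := archi_sqrt ((C + D) / (k - l)).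
have s0 : 0 < Num.sqrt (X%:R : R) by rewrite sqrtr_gt0 ltr0n.
have sX : Num.sqrt (X%:R : R) * Num.sqrt X%:R = X%:R by rewrite -expr2 sqr_sqrtr ?ler0n.
have := hC X X0; have := hD X X0; have := fg X X0.
rewrite !ler_norml => h1 /andP[h2 h3] /andP[h4 h5].
have : (k - l) * X%:R <= (C + D) * Num.sqrt X%:R by lra.
rewrite -{1}sX mulrA ler_pM2r //.
by rewrite ltr_pdivrMr // mulrC in hX; rewrite leNgt hX.
Qed.

Lemma sqrt_asymp_unique f k l : sqrt_asymp f k -> sqrt_asymp f l -> k = l.
Proof.
by move=> fk fl; apply/le_anti; rewrite (sqrt_asymp_le fk fl) // (sqrt_asymp_le fl fk).
Qed.

Lemma sqrt_asymp_ext f g k : (forall X, (0 < X)%N -> f X = g X) -> sqrt_asymp f k -> sqrt_asymp g k.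
Proof. by move=> fg [C hC]; exists C => X X0; rewrite -fg // hC. Qed.

End Asymptotics.

Section Hyperbola.

Variables (R : realType) (p : nat) (p_pr : prime p) (p_odd : odd p).
Hypothesis p14 : (p %% 4 = 1)%N.

Let q (d : nat) : R := qcharn R p d.

Lemma qcharn_norm d : `|q d| <= 1.
Proof.
by rewrite /q /qcharn; case: (qchar_range (d%:R : 'F_p)) => ->; rewrite ?normr0 ?normrN1 ?normr1.
Qed.

Let S (n : nat) : R := \sum_(1 <= d < n.+1) q d.

(** A character sums to 0 over a period. *)
Lemma sum_qcharn_bound n : `|S n| <= p%:R.
Proof.
have trivial_bound m : `|S m| <= m%:R.
  rewrite /S (le_trans (ler_norm_sum _ _ _)) //.
  apply: (@le_trans _ _ (\sum_(1 <= d < m.+1) 1)); first by apply: ler_sum => d _; exact: qcharn_norm.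
  by rewrite sumr_const_nat subn1.
have per m : S (p + m) = S m.
  rewrite /S (@big_cat_nat _ _ _ p.+1) //=; last by rewrite ltnS leq_addr.
  have -> : \sum_(1 <= d < p.+1) q d = 0.
    have := sum_qchar p_pr p_odd; rewrite (big_Fp p_pr) => h.
    transitivity (\sum_(0 <= d < p) q d).
      rewrite big_nat_recr ?prime_gt0 //= [in RHS]big_ltn ?prime_gt0 // addrC.
      congr (_ + _); rewrite /q /qcharn; congr ((qchar _)%:~R).
      by apply/eqP; rewrite Fp_natr_eq0.
    have := congr1 (fun x : int => x%:~R : R) h.
    by rewrite rmorph_sum.
  rewrite add0r -{1}[p.+1]add1n big_addn (_ : (p + m).+1 - p = m.+1)%N; last lia.
  apply: eq_bigr => d _; rewrite (_ : (d + p = p * 1 + d)%N) ?muln1; last by rewrite addnC.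
  by have := qcharn_period R p_pr d 1; rewrite muln1.
rewrite (divn_eq n p); elim: (n %/ p)%N => [|m IH].
  rewrite mul0n add0n (le_trans (trivial_bound _)) // ler_nat ltnW // ltn_mod.
  exact: prime_gt0.
by rewrite mulSn -addnA per.
Qed.

(** Partial summation against the bounded sums of [q]. *)
Lemma abel_bound (f : nat -> R) (D N : nat) : (D < N)%N ->
  (forall d, (D < d)%N -> 0 <= f d) ->
  (forall d, (D < d)%N -> f d.+1 <= f d) ->
  `|\sum_(D.+1 <= d < N.+1) q d * f d| <= 2 * p%:R * f D.+1.
Proof.
move=> DN f0 fd; pose T n := S n - S D.
have TB n : `|T n| <= 2 * p%:R.
  by rewrite (le_trans (ler_normB _ _)) // mulr_natl mulr2n lerD ?sum_qcharn_bound.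
have step : `|\sum_(D.+1 <= d < N.+1) q d * f d - T N * f N| <= 2 * p%:R * (f D.+1 - f N).
  rewrite -(subnKC DN); elim: (N - D.+1)%N => [|k IH].
    rewrite addn0 big_nat1 /T /S big_nat_recr //=.
    have -> : q D.+1 * f D.+1 - (\sum_(1 <= i < D.+1) q i + q D.+1 - \sum_(1 <= d < D.+1) q d) * f D.+1 = 0 by ring.
    by rewrite normr0 subrr mulr0.
  rewrite addnS big_nat_recr /=; last by rewrite leqW // leq_addr.
  set M := (D.+1 + k)%N in IH *.
  have TS : T M.+1 = T M + q M.+1 by rewrite /T /S big_nat_recr //=; ring.
  have DM : (D < M)%N by rewrite /M addSn ltnS leq_addr.
  have -> : \sum_(D.+1 <= i < M.+1) q i * f i + q M.+1 * f M.+1 - T M.+1 * f M.+1 =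
     (\sum_(D.+1 <= i < M.+1) q i * f i - T M * f M) + T M * (f M - f M.+1) by rewrite TS; ring.
  rewrite (le_trans (ler_normD _ _)) //.
  have -> : 2 * p%:R * (f D.+1 - f M.+1) = 2 * p%:R * (f D.+1 - f M) + 2 * p%:R * (f M - f M.+1) by ring.
  have fM : 0 <= f M - f M.+1 by rewrite subr_ge0 fd.
  by rewrite lerD // normrM (ger0_norm fM) ler_wpM2r.
rewrite -[X in `|X|](subrK (T N * f N)) (le_trans (ler_normD _ _)) //.
have -> : 2 * p%:R * f D.+1 = 2 * p%:R * (f D.+1 - f N) + 2 * p%:R * f N by ring.
by rewrite lerD // normrM (ger0_norm (f0 _ DN)) ler_wpM2r ?f0.
Qed.

Lemma Lvalue_tail (M : nat) :
  `|Lvalue R p - \sum_(1 <= d < M.+1) q d / d%:R| <= 2 * p%:R / M.+1%:R.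
Proof.
have [C C0 hC] := Lvalue_partial R p_pr p_odd p14.
apply/ler_addgt0Pr => e e0.
have := archi_boundP (ltW (divr_gt0 C0 e0)); set B := Num.bound _ => hB.
pose N := (M + B).+1.
have MN : (M < p * N)%N by have := prime_gt1 p_pr; rewrite /N; nia.
have ab := @abel_bound (fun d => d%:R^-1) M (p * N) MN.
have := hC N; rewrite (@big_cat_nat _ _ _ M.+1) //=; last by rewrite ltnS ltnW.
move=> h.
have h2 : `|\sum_(M.+1 <= d < (p * N).+1) q d / d%:R| <= 2 * p%:R / M.+1%:R.
  apply: ab => d Md; first by rewrite invr_ge0.
  by rewrite lef_pV2 ?posrE ?ltr0n ?ler_nat // (leq_ltn_trans _ Md).
have h3 : C / N.+1%:R <= e.
  rewrite ler_pdivrMr ?ltr0n // mulrC -ler_pdivrMr // (le_trans (ltW hB)) //.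
  by rewrite ler_nat /N; lia.
set A := \sum_(1 <= d < M.+1) _ in h *; set A' := \sum_(M.+1 <= d < _) _ in h h2.
have -> : Lvalue R p - A = (Lvalue R p - (A + A')) + A' by ring.
rewrite (le_trans (ler_normD _ _)) // addrC lerD //.
exact: le_trans h h3.
Qed.

Lemma sqrt_split (X : nat) : (0 < X)%N -> exists2 D : nat, (0 < D)%N & (D ^ 2 <= X < D.+1 ^ 2)%N.
Proof.
elim: X => // X IH _; case: X IH => [|X] IH; first by exists 1%N.
have [D D0 /andP[h1 h2]] := IH isT.
have [h|h] := leqP (D.+1 ^ 2) X.+2.
  by exists D.+1 => //; rewrite h /=; move: h2; rewrite -!mulnn; nia.
by exists D => //; rewrite h andbT ltnW.
Qed.

(** In the sum of [q d * floor (X / d)], replace the floor by [X / d] for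
    [d <= sqrt X]; for larger [d] it decreases, and [abel_bound] applies. *)
Lemma ideal_count_asymp : sqrt_asymp (fun X => (ideal_count p X)%:R : R) (Lvalue R p).
Proof.
exists (8 * p%:R + 2) => X X0.
have [D D0 /andP[DX XD]] := sqrt_split X0.
have DX' : (D <= X)%N by apply: leq_trans DX; rewrite -mulnn leq_pmulr.
have -> : (ideal_count p X)%:R = \sum_(1 <= d < X.+1) q d * (X %/ d)%N%:R :> R.
  rewrite -[LHS]/((ideal_count p X)%:Z%:~R) ideal_countE // rmorph_sum.
  by apply: eq_bigr => d _ /=; rewrite rmorphM.
rewrite (@big_cat_nat _ _ _ D.+1) //=.
set A := \sum_(1 <= d < _) _; set B := \sum_(D.+1 <= d < _) _.
have D1 : 0 < D.+1%:R :> R by rewrite ltr0n.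
have XD' : X%:R / D.+1%:R <= D.+1%:R :> R.
  by rewrite ler_pdivrMr // -natrM ler_nat mulnn ltnW.
have hB : `|B| <= 2 * p%:R * D.+1%:R.
  have [e|ne] := eqVneq D X; first by rewrite /B e big_geq // normr0 !mulr_ge0.
  have DltX : (D < X)%N by rewrite ltn_neqAle ne.
  have h := @abel_bound (fun d => (X %/ d)%N%:R) D X DltX.
  apply: le_trans (h _ _) _ => [d _|d d0|].
  - exact: ler0n.
  - by rewrite ler_nat leq_div2l // (leq_ltn_trans _ d0).
  rewrite ler_wpM2l ?mulr_ge0 // (le_trans _ XD') //.
  by rewrite ler_pdivlMr // -natrM ler_nat leq_divM.
pose A0 := \sum_(1 <= d < D.+1) q d / d%:R.
have hA : `|A - X%:R * A0| <= D%:R.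
  rewrite /A /A0 mulr_sumr -sumrB (le_trans (ler_norm_sum _ _ _)) //.
  apply: (@le_trans _ _ (\sum_(1 <= d < D.+1) 1)); last by rewrite sumr_const_nat subn1.
  rewrite big_nat_cond [leRHS]big_nat_cond; apply: ler_sum => d; rewrite andbT => /andP[d1 _].
  have -> : q d * (X %/ d)%N%:R - X%:R * (q d / d%:R) = q d * ((X %/ d)%N%:R - X%:R / d%:R) by ring.
  rewrite normrM -[leRHS]mulr1; apply: ler_pM => //; first exact: qcharn_norm.
  have d0 : 0 < d%:R :> R by rewrite ltr0n.
  have -> : (X %/ d)%N%:R - X%:R / d%:R = - ((X %% d)%N%:R / d%:R) :> R.
    by rewrite {2}(divn_eq X d) natrD natrM; field; rewrite lt0r_neq0.
  rewrite normrN ger0_norm ?divr_ge0 // ler_pdivrMr // mul1r ler_nat ltnW // ltn_mod; exact: d1.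
have hL : X%:R * `|Lvalue R p - A0| <= 2 * p%:R * D.+1%:R.
  apply: le_trans (ler_wpM2l (ler0n _ _) (Lvalue_tail D)) _.
  by rewrite mulrCA ler_wpM2l ?mulr_ge0.
have DS : D%:R <= Num.sqrt X%:R :> R.
  by rewrite -[leLHS]ger0_norm ?ler0n // -sqrtr_sqr ler_wsqrtr // -natrX ler_nat.
have -> : A + B - Lvalue R p * X%:R = (A - X%:R * A0) + B - X%:R * (Lvalue R p - A0) by ring.
apply: (@le_trans _ _ ((8 * p%:R + 2) * D%:R)); last first.
  by rewrite ler_wpM2l // addr_ge0 // mulr_ge0.
rewrite (le_trans (ler_normB _ _)) // normrM [ `|X%:R|]ger0_norm ?ler0n //.
have t : `|A - X%:R * A0 + B| <= D%:R + 2 * p%:R * D.+1%:R.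
  by rewrite (le_trans (ler_normD _ _)) // lerD.
have D1le : D.+1%:R <= 2 * D%:R :> R by rewrite -natrM ler_nat; lia.
have p0 : 0 <= p%:R :> R by rewrite ler0n.
have d0 : 0 <= D%:R :> R by rewrite ler0n.
have : p%:R * D.+1%:R <= p%:R * (2 * D%:R) :> R by rewrite ler_wpM2l.
by lra.
Qed.

End Hyperbola.

(** * Lattice points in a hyperbolic sector *)

Section SectorCount.
Import numFieldNormedType.Exports.

Variable R : realType.

(** On each step the mean value inequality puts the increment of the primitive
    between the values of the decreasing [f] at the two ends; the differences
    telescope. *)
Lemma riemann_sum_bound (f F : R -> R) (Y delta : R) (K : nat) :
  (forall x, 0 <= x <= Y -> is_derive x 1 F (f x)) ->
  (forall x y, 0 <= x -> x <= y -> y <= Y -> f y <= f x) ->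
  0 <= f Y -> 0 < delta -> K%:R * delta <= Y < K.+1%:R * delta ->
  `|delta * \sum_(0 <= y < K.+1) f (y%:R * delta) - (F Y - F 0)| <= delta * f 0.
Proof.
move=> dF df fY d0 /andP[KY YK].
have Y0 : 0 <= Y by apply: le_trans KY; rewrite mulr_ge0 // ltW.
have up (x y : R) : 0 <= x -> x <= y -> y <= Y -> F y - F x <= f x * (y - x).
  move=> x0 xy yY; apply: (mean_value_le (df := f)) => // [z /andP[xz zy]|z /andP[xz zy]].
    by apply: dF; rewrite (le_trans x0 xz) (le_trans zy yY).
  by apply: df => //; [exact: ltW | exact: le_trans (ltW zy) yY].
have lo (x y : R) : 0 <= x -> x <= y -> y <= Y -> f y * (y - x) <= F y - F x.
  move=> x0 xy yY; rewrite -lerN2 -mulNr opprB.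
  have := @mean_value_le R (fun z => - F z) (fun z => - f z) x y (- f y) xy.
  have -> : F x - F y = - F y - - F x by rewrite opprK addrC.
  apply=> z /andP[xz zy].
    have h : is_derive z 1 F (f z) by apply: dF; rewrite (le_trans x0 xz) (le_trans zy yY).
    exact: is_deriveN.
  by rewrite lerN2; apply: df => //; [exact: le_trans x0 (ltW xz) | exact: ltW].
have kd0 (k : nat) : 0 <= k%:R * delta by rewrite mulr_ge0 // ltW.
have kS (k : nat) : k.+1%:R * delta = k%:R * delta + delta by rewrite -natr1 mulrDl mul1r.
have kY (k : nat) : (k <= K)%N -> k%:R * delta <= Y.
  by move=> kK; rewrite (le_trans _ KY) // ler_wpM2r ?ler_nat // ltW.
have kk (k : nat) : k%:R * delta <= k.+1%:R * delta by rewrite kS lerDl ltW.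
have tel_up : F (K%:R * delta) - F 0 <= delta * \sum_(0 <= y < K) f (y%:R * delta).
  suff h k : (k <= K)%N -> F (k%:R * delta) - F 0 <= delta * \sum_(0 <= y < k) f (y%:R * delta) by exact: h.
  elim: k => [_|k IH kK]; first by rewrite big_geq // mul0r subrr mulr0.
  rewrite big_nat_recr //= mulrDr.
  have := up _ _ (kd0 k) (kk k) (kY _ kK); rewrite {2}kS addrAC subrr add0r.
  by have := IH (ltnW kK); lra.
have tel_lo : delta * \sum_(0 <= y < K) f (y.+1%:R * delta) <= F (K%:R * delta) - F 0.
  suff h k : (k <= K)%N -> delta * \sum_(0 <= y < k) f (y.+1%:R * delta) <= F (k%:R * delta) - F 0 by exact: h.
  elim: k => [_|k IH kK]; first by rewrite big_geq // mul0r subrr mulr0.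
  rewrite big_nat_recr //= mulrDr.
  have := lo _ _ (kd0 k) (kk k) (kY _ kK); rewrite {2}kS addrAC subrr add0r.
  by have := IH (ltnW kK); lra.
have fK : 0 <= f (K%:R * delta) by apply: le_trans fY _; apply: df.
have last_up : F Y - F (K%:R * delta) <= delta * f (K%:R * delta).
  apply: le_trans (up _ _ (kd0 K) KY (lexx _)) _.
  by rewrite mulrC ler_wpM2r // lerBlDr addrC -kS ltW.
have last_lo : 0 <= F Y - F (K%:R * delta).
  by apply: le_trans (lo _ _ (kd0 K) KY (lexx _)); rewrite mulr_ge0 // subr_ge0.
rewrite ler_norml; apply/andP; split.
  rewrite big_nat_recr //= mulrDr.
  have f00 : 0 <= delta * f 0 by rewrite mulr_ge0 ?(ltW d0) // (le_trans fY) // df.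
  by lra.
by rewrite big_ltn // big_add1 /= mul0r mulrDr; lra.
Qed.

Section Profile.

Variable E : R.
Hypothesis E1 : 1 < E.

(** For the hyperbolic sector [v > 0, u - v = s >= 0, u < E^2 v, u v <= 1],
    the length of the slice at [s], a primitive of it, and the largest [s]. *)
Definition slice (s : R) : R := (Num.sqrt (s ^+ 2 + 4) - s) / 2 - s / (E ^+ 2 - 1).
Definition slice_prim (s : R) : R :=
  s * Num.sqrt (s ^+ 2 + 4) / 4 - s ^+ 2 / 4
  + ln (s + Num.sqrt (s ^+ 2 + 4)) - s ^+ 2 / (2 * (E ^+ 2 - 1)).
Definition slice_end : R := E - E^-1.

Lemma E_gt0 : 0 < E. Proof. exact: lt_trans E1. Qed.

Lemma E2_gt0 : 0 < E ^+ 2 - 1.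
Proof. by rewrite subr_gt0 exprn_egt1. Qed.

Lemma slice_end_gt0 : 0 < slice_end.
Proof.
rewrite /slice_end subr_gt0; apply: lt_trans E1.
by rewrite invf_lt1 // E_gt0.
Qed.

Lemma sqrt_gt (s : R) : 0 < Num.sqrt (s ^+ 2 + 4) /\ `|s| < Num.sqrt (s ^+ 2 + 4).
Proof.
have h : 0 < s ^+ 2 + 4 by rewrite ltr_wpDl ?sqr_ge0.
split; first by rewrite sqrtr_gt0.
by rewrite -sqrtr_sqr ltr_sqrt // ltrDl.
Qed.

Lemma is_derive_slice_prim (s : R) : is_derive s 1 slice_prim (slice s).
Proof.
have [r0 r1] := sqrt_gt s.
have h0 : 0 < s ^+ 2 + 4 by rewrite ltr_wpDl ?sqr_ge0.
have hr : Num.sqrt (s ^+ 2 + 4) ^+ 2 = s ^+ 2 + 4 by rewrite sqr_sqrtr // ltW.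
have e2 := E2_gt0.
have d1 : is_derive s 1 (fun y : R => y ^+ 2 + 4) (2 * s).
  have := is_deriveD (is_derive_pow 2 s) (is_derive_cst (4 : R) s 1).
  by move=> h; apply: is_derive_eq h _; rewrite addr0 expr1.
have d2 : is_derive s 1 (fun y : R => Num.sqrt (y ^+ 2 + 4)) (s / Num.sqrt (s ^+ 2 + 4)).
  have h := @is_derive1_comp R Num.sqrt (fun y : R => y ^+ 2 + 4) s _ _ (is_derive1_sqrt h0) d1.
  apply: is_derive_eq h _; field; exact: lt0r_neq0.
have sr : 0 < s + Num.sqrt (s ^+ 2 + 4).
  by rewrite -ltrBlDl sub0r (le_lt_trans _ r1) // -normrN ler_norm.
have d3 : is_derive s 1 (fun y : R => ln (y + Num.sqrt (y ^+ 2 + 4))) (Num.sqrt (s ^+ 2 + 4))^-1.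
  have h := @is_derive1_comp R (@ln R) (fun y : R => y + Num.sqrt (y ^+ 2 + 4)) s _ _ (is_derive1_ln sr) (is_deriveD (is_derive_id s 1) d2).
  by apply: is_derive_eq h _; field; rewrite !lt0r_neq0.
have d4 : is_derive s 1 (fun y : R => y * Num.sqrt (y ^+ 2 + 4))
   (s * (s / Num.sqrt (s ^+ 2 + 4)) + Num.sqrt (s ^+ 2 + 4)).
  have h := is_deriveM (is_derive_id s 1) d2.
  by apply: is_derive_eq h _; rewrite /GRing.scale /= mulr1.
have d5 := is_derive_scale (4^-1) d4.
have d6 := is_derive_scale (4^-1) (is_derive_pow 2 s).
have d7 := is_derive_scale ((2 * (E ^+ 2 - 1))^-1) (is_derive_pow 2 s).
have := is_deriveB (is_deriveD (is_deriveB d5 d6) d3) d7.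
rewrite (_ : (_ - _)%R = slice_prim); last first.
  by apply/funext => y; rewrite /slice_prim ![_ / _]mulrC.
move=> h; apply: is_derive_eq h _; rewrite /slice expr1 /=.
move: hr r0 e2; set r := Num.sqrt _; set e := E ^+ 2 - 1 => hr r0 e2.
have r0' : r != 0 by exact: lt0r_neq0.
have e0' : e != 0 by exact: lt0r_neq0.
have -> : 4^-1 * (s * (s / r) + r) - 4^-1 * (2 * s) + r^-1 - (2 * e)^-1 * (2 * s) =
  (s ^+ 2 + r ^+ 2 + 4) / (4 * r) - s / 2 - s / e by field; rewrite r0' e0'.
rewrite -addrA hr.
have -> : s ^+ 2 + (s ^+ 2 + 4) + 4 = 2 * r ^+ 2 by rewrite hr; ring.
by field; rewrite r0' e0'.
Qed.

Lemma slice_decr_lin (x y : R) : 0 <= x -> x <= y ->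
  slice y + (y - x) / (E ^+ 2 - 1) <= slice x.
Proof.
move=> x0 xy; have [rx _] := sqrt_gt x; have [ry _] := sqrt_gt y.
have y0 : 0 <= y by exact: le_trans xy.
have h0 (z : R) : 0 <= z ^+ 2 + 4 by rewrite addr_ge0 ?sqr_ge0.
have conj (z : R) : 0 <= z -> (Num.sqrt (z ^+ 2 + 4) - z) / 2 = 2 / (Num.sqrt (z ^+ 2 + 4) + z).
  move=> z0; have [rz _] := sqrt_gt z.
  have hz : Num.sqrt (z ^+ 2 + 4) ^+ 2 = z ^+ 2 + 4 by rewrite sqr_sqrtr.
  have nz : Num.sqrt (z ^+ 2 + 4) + z != 0 by rewrite lt0r_neq0 // ltr_wpDr.
  apply: (mulIf nz); rewrite mulfVK //.
  by rewrite mulrAC -subr_sqr hz; field.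
have -> : slice y + (y - x) / (E ^+ 2 - 1) = (Num.sqrt (y ^+ 2 + 4) - y) / 2 - x / (E ^+ 2 - 1).
  by rewrite /slice mulrBl; ring.
rewrite /slice lerD2r !conj // ler_wpM2l // lef_pV2 ?posrE ?ltr_wpDr //.
by rewrite lerD // ler_wsqrtr // lerD2r lerXn2r ?nnegrE.
Qed.

Lemma slice_decr (x y : R) : 0 <= x -> x <= y -> slice y <= slice x.
Proof.
move=> x0 xy; apply: le_trans (slice_decr_lin x0 xy).
by rewrite lerDl; apply: divr_ge0; [rewrite subr_ge0 | exact: ltW E2_gt0].
Qed.

Lemma sqrt_slice_end : Num.sqrt (slice_end ^+ 2 + 4) = E + E^-1.
Proof.
have E0 := E_gt0; have E0' : E != 0 by exact: lt0r_neq0.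
have -> : slice_end ^+ 2 + 4 = (E + E^-1) ^+ 2 by rewrite /slice_end; field.
by rewrite sqrtr_sqr ger0_norm // addr_ge0 ?invr_ge0 // ltW.
Qed.

Lemma slice_end0 : slice slice_end = 0.
Proof.
have E0 := E_gt0; have E0' : E != 0 by exact: lt0r_neq0.
have e2 : E ^+ 2 - 1 != 0 by rewrite lt0r_neq0 // E2_gt0.
by rewrite /slice sqrt_slice_end /slice_end; field; rewrite E0' e2.
Qed.

Lemma slice0 : slice 0 = 1.
Proof.
rewrite /slice expr0n add0r mul0r !subr0 (_ : 4 = 2 ^+ 2) ?sqrtr_sqr ?ger0_norm //; last by ring.
by rewrite divff.
Qed.

(** The area of the sector; the logarithm is where the regulator comes from. *)
Lemma slice_integral : slice_prim slice_end - slice_prim 0 = ln E.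
Proof.
have E0 := E_gt0; have E0' : E != 0 by exact: lt0r_neq0.
have e2 : E ^+ 2 - 1 != 0 by rewrite lt0r_neq0 // E2_gt0.
rewrite /slice_prim sqrt_slice_end !expr0n /= !mul0r !subr0 !add0r.
have -> : Num.sqrt 4 = 2 :> R.
  by rewrite (_ : 4 = 2 ^+ 2) ?sqrtr_sqr ?ger0_norm //; ring.
have -> : slice_end + (E + E^-1) = 2 * E by rewrite /slice_end; ring.
rewrite lnM ?posrE //; move: (ln 2) (ln E) => l2 lE.
by rewrite /slice_end; field; rewrite E0' e2.
Qed.

Lemma slice_lt0 (s : R) : slice_end < s -> slice s < 0.
Proof.
move=> ys; have := slice_decr_lin (ltW slice_end_gt0) (ltW ys).
rewrite slice_end0; apply: lt_le_trans.
by rewrite ltrDl; apply: divr_gt0; [rewrite subr_gt0 | exact: E2_gt0].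
Qed.

End Profile.

Lemma floor_ltP (x : R) (m : int) : (Num.floor x < m) = (x < m%:~R).
Proof.
have /andP[h1 h2] := floor_itv x; apply/idP/idP => h.
  by apply: lt_le_trans h2 _; rewrite ler_int lezD1.
by rewrite -(ltr_int R); exact: le_lt_trans h1 h.
Qed.

Lemma floor_geP (x : R) (m : int) : (m <= Num.floor x) = (m%:~R <= x).
Proof. by rewrite leNgt floor_ltP -leNgt. Qed.

Lemma int_interval_mem (a b : int) (m i : nat) : (i < m)%N -> m%:Z = b - a ->
  a < a + 1 + i%:Z /\ a + 1 + i%:Z <= b.
Proof. by split; lia. Qed.

Lemma int_interval_index (a b x : int) (m : nat) : a < x -> x <= b -> m%:Z = b - a ->
  exists2 i : nat, (i < m)%N & x = a + 1 + i%:Z.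
Proof. by move=> h1 h2 h3; exists `|(x - a - 1)%R|%N; lia. Qed.

(** The points of a lattice in the sector [1 <= u/v < E^2], [0 < u v <= a X],
    counted along the lines [u - v = y w]; on each of these lines, [v] runs
    through a coset of [a Z]. *)
Lemma sector_count (a : nat) (w E : R) (c : nat -> R) :
  (0 < a)%N -> 0 < w -> 1 < E ->
  exists C : R, forall X : nat, (0 < X)%N ->
  exists s : seq (int * nat),
  [/\ uniq s,
     forall x y, ((x, y) \in s) = let v := x%:~R * a%:R + c y in
       [&& 0 < v, v + y%:R * w < E ^+ 2 * v & v * (v + y%:R * w) <= (a * X)%:R] &
     `|(size s)%:R - ln E / w * X%:R| <= C * Num.sqrt X%:R].
Proof.
move=> a0 w0 E1; have Y0 := slice_end_gt0 E1; have e2 := E2_gt0 E1.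
set Y := slice_end E in Y0.
exists (2 + Y * Num.sqrt a%:R / w) => X X0.
have aR : 0 < a%:R :> R by rewrite ltr0n.
have XR : 0 < X%:R :> R by rewrite ltr0n.
(* dividing by [t] turns the condition [u v <= a X] into [u v <= 1], and
   [delta] is the resulting spacing of the lines *)
pose t : R := Num.sqrt (a * X)%:R.
have t0 : 0 < t by rewrite sqrtr_gt0 ltr0n muln_gt0 a0.
have tt : t ^+ 2 = a%:R * X%:R by rewrite sqr_sqrtr ?ler0n // natrM.
pose delta := w / t; have d0 : 0 < delta by rewrite divr_gt0.
have /andP[K1 K2] := truncn_itv (divr_ge0 (ltW Y0) (ltW d0)).
set K := Num.truncn _ in K1 K2.
have KY : K%:R * delta <= Y < K.+1%:R * delta.
  by rewrite -ler_pdivlMr // K1 -ltr_pdivrMr.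
pose A (y : nat) : R := (y%:R * w / (E ^+ 2 - 1) - c y) / a%:R.
pose V (y : nat) : R := t * ((Num.sqrt ((y%:R * delta) ^+ 2 + 4) - y%:R * delta) / 2).
pose B (y : nat) : R := (V y - c y) / a%:R.
have BA y : B y - A y = t / a%:R * slice E (y%:R * delta).
  by rewrite /B /A /V /slice /delta; field; rewrite !lt0r_neq0.
have sd (y : nat) : 0 <= y%:R * delta by rewrite mulr_ge0 // ltW.
have ABle y : (y <= K)%N -> A y <= B y.
  move=> yK; rewrite -subr_ge0 BA mulr_ge0 //; first by rewrite ltW // divr_gt0.
  rewrite -(slice_end0 E1) slice_decr //.
  by case/andP: KY => KY _; apply: le_trans KY; rewrite ler_wpM2r ?ler_nat // ltW.
have ABgt y : (K < y)%N -> B y < A y.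
  move=> Ky; rewrite -subr_lt0 BA nmulr_llt0 ?divr_gt0 // slice_lt0 //.
  by case/andP: KY => _ KY; apply: lt_le_trans KY _; rewrite ler_wpM2r ?ler_nat // ltW.
pose m (y : nat) : nat := `|Num.floor (B y) - Num.floor (A y)|%N.
have mE y : (y <= K)%N -> (m y)%:Z = Num.floor (B y) - Num.floor (A y).
  move=> yK; rewrite /m gez0_abs // subr_ge0 floor_geP.
  by have /andP[h _] := floor_itv (A y); exact: le_trans h (ABle _ yK).
pose s := [seq (Num.floor (A y) + 1 + i%:Z, y) | y <- iota 0 K.+1, i <- iota 0 (m y)].
have smem x y : ((x, y) \in s) = (A y < x%:~R) && (x%:~R <= B y).
  rewrite -floor_ltP -floor_geP; apply/allpairsPdep/andP => [[y' [i [hy hi [-> ->]]]]|[h1 h2]].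
    rewrite mem_iota add0n ltnS /= in hy; rewrite mem_iota add0n /= in hi.
    exact: int_interval_mem hi (mE _ hy).
  have yK : (y <= K)%N.
    rewrite leqNgt; apply/negP => /ABgt h.
    rewrite floor_ltP in h1; rewrite floor_geP in h2.
    by have := lt_trans (lt_le_trans h1 h2) h; rewrite ltxx.
  have [i im xi] := int_interval_index h1 h2 (mE _ yK).
  by exists y, i; rewrite !mem_iota !add0n ltnS yK im -xi.
have ssize : size s = (\sum_(0 <= y < K.+1) m y)%N.
  by rewrite size_allpairs_dep sumnE big_map /index_iota subn0; apply: eq_bigr => y _; rewrite size_iota.
exists s; split.
- apply: allpairs_uniq_dep; [exact: iota_uniq | by move=> y _; exact: iota_uniq |].
  by move=> [y i] [y' i'] _ _ /= [h e]; subst y'; move: h => /addrI[->].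
- move=> x y /=; rewrite smem; set v := x%:~R * a%:R + c y.
  have -> : (A y < x%:~R) = (y%:R * w / (E ^+ 2 - 1) < v).
    by rewrite /A ltr_pdivrMr // ltrBlDr.
  have -> : (x%:~R <= B y) = (v <= V y) by rewrite /B ler_pdivlMr // lerBrDr.
  have yw0 : 0 <= y%:R * w by rewrite mulr_ge0 // ltW.
  have -> : (y%:R * w / (E ^+ 2 - 1) < v) = (0 < v) && (v + y%:R * w < E ^+ 2 * v).
    rewrite ltr_pdivrMr //; apply/idP/andP => [h|[v0 h]]; last by lra.
    split; last by lra.
    by rewrite -(pmulr_lgt0 _ e2); exact: le_lt_trans h.
  rewrite -andbA; case v0 : (0 < v) => //=; congr (_ && _).
  have [r0 r1] := sqrt_gt (y%:R * delta).
  have Vpos : 0 < V y.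
    by rewrite mulr_gt0 // divr_gt0 // subr_gt0 (le_lt_trans _ r1) // ler_norm.
  have VV : V y * (V y + y%:R * w) = (a * X)%:R.
    rewrite natrM -tt /V.
    have -> : y%:R * w = t * (y%:R * delta) by rewrite /delta; field; exact: lt0r_neq0.
    set sg := y%:R * delta; set r := Num.sqrt _.
    have rr : r ^+ 2 = sg ^+ 2 + 4 by rewrite sqr_sqrtr // addr_ge0 ?sqr_ge0.
    have -> : t * ((r - sg) / 2) * (t * ((r - sg) / 2) + t * sg) = t ^+ 2 * ((r ^+ 2 - sg ^+ 2) / 4) by field.
    by rewrite rr; field.
  clearbody v; have v0' : 0 <= v by rewrite ltW.
  have V0' : 0 <= V y by rewrite ltW.
  rewrite -VV; apply/idP/idP => h.
    by apply: ler_pM; rewrite ?lerD2r ?addr_ge0.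
  rewrite leNgt; apply/negP => Vv; move: h; apply/negP; rewrite -ltNge.
  by apply: ltr_pM; rewrite ?ltrD2r ?addr_ge0.
have rs := riemann_sum_bound (fun x _ => is_derive_slice_prim E1 x)
   (fun x y x0 xy _ => slice_decr E1 x0 xy) (eq_ind_r (fun z => 0 <= z) (lexx 0) (slice_end0 E1)) d0 KY.
rewrite slice_integral // slice0 mulr1 in rs.
rewrite ssize natr_sum; set M := \sum_(0 <= y < K.+1) slice E _ in rs.
have h1 : `|\sum_(0 <= y < K.+1) (m y)%:R - t / a%:R * M| <= K.+1%:R.
  rewrite /M mulr_sumr -sumrB (le_trans (ler_norm_sum _ _ _)) //.
  apply: (@le_trans _ _ (\sum_(0 <= y < K.+1) 1)); last by rewrite sumr_const_nat subn0.
  rewrite big_nat_cond [leRHS]big_nat_cond; apply: ler_sum => y; rewrite andbT => /andP[_ yK].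
  rewrite -BA -[(m y)%:R]/((m y)%:Z%:~R) mE // rmorphB /=.
  have /andP[b1 b2] := floor_itv (B y); have /andP[a1 a2] := floor_itv (A y).
  by rewrite rmorphD /= in a2 b2; rewrite ler_norml; apply/andP; split; lra.
have h2 : `|t / a%:R * M - ln E / w * X%:R| <= X%:R / t.
  have -> : t / a%:R * M - ln E / w * X%:R = X%:R / w * (delta * M - ln E).
    have -> : X%:R = t ^+ 2 / a%:R by rewrite tt; field; exact: lt0r_neq0.
    by rewrite /delta; field; rewrite !lt0r_neq0.
  rewrite normrM ger0_norm; last by rewrite divr_ge0 // ltW.
  have -> : X%:R / t = X%:R / w * delta by rewrite /delta; field; rewrite !lt0r_neq0.
  by rewrite ler_wpM2l // divr_ge0 // ltW.
have tE : t = Num.sqrt a%:R * Num.sqrt X%:R by rewrite /t natrM sqrtrM.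
have sX : 1 <= Num.sqrt X%:R :> R by rewrite -[leLHS]sqrtr1 ler_wsqrtr // ler1n.
have sa : 1 <= Num.sqrt a%:R :> R by rewrite -[leLHS]sqrtr1 ler_wsqrtr // ler1n.
have XX : Num.sqrt X%:R ^+ 2 = X%:R :> R by rewrite sqr_sqrtr.
have h3 : X%:R / t <= Num.sqrt X%:R.
  by rewrite ler_pdivrMr // tE mulrCA -expr2 XX ler_peMl // ltW.
have h4 : K.+1%:R <= Y * Num.sqrt a%:R / w * Num.sqrt X%:R + Num.sqrt X%:R.
  rewrite -natr1 lerD //; apply: le_trans K1 _; rewrite /delta tE.
  have sX0 : 0 < Num.sqrt X%:R :> R by apply: lt_le_trans sX.
  have sa0 : 0 < Num.sqrt a%:R :> R by apply: lt_le_trans sa.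
  by rewrite le_eqVlt; apply/orP; left; apply/eqP; field; rewrite !lt0r_neq0.
rewrite (_ : _ - _ = (\sum_(0 <= y < K.+1) (m y)%:R - t / a%:R * M) + (t / a%:R * M - ln E / w * X%:R)); last by ring.
rewrite (le_trans (ler_normD _ _)) //.
by move: h1 h2 h3 h4; set q1 := `|_|; set q2 := `|_|; lra.
Qed.

End SectorCount.

(** * The ring of integers *)

Section QuadraticIntegers.
Local Open Scope classical_set_scope.

Variables (R : realType) (p : nat) (p_pr : prime p) (p_odd : odd p).
Hypothesis p14 : (p %% 4 = 1)%N.

Definition sqrtp : R := Num.sqrt p%:R.
Let w := sqrtp.

Lemma sqrtp_gt0 : 0 < w.
Proof. by rewrite sqrtr_gt0 ltr0n prime_gt0. Qed.

Lemma sqrtp_sqr : w ^+ 2 = p%:R.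
Proof. by rewrite sqr_sqrtr. Qed.

Lemma p_ge5 : (5 <= p)%N.
Proof. by have := prime_gt1 p_pr; move: p14; lia. Qed.

Definition omega : R := (1 + w) / 2.
Definition omega' : R := (1 - w) / 2.

(** Integers of the field are handled through coordinates, on which conjugation
    is a plain function. *)
Definition qint (z : int * int) : R := z.1%:~R + z.2%:~R * omega.
Definition qconj (z : int * int) : R := z.1%:~R + z.2%:~R * omega'.

Let m : int := (quarter p)%:Z.

Lemma p_quarterR : p%:R = 4 * m%:~R + 1 :> R.
Proof. by rewrite {1}(p_quarter p_pr p_odd p14) natrD natrM. Qed.

Lemma omega_sqr : omega ^+ 2 = omega + m%:~R.
Proof.
have h := sqrtp_sqr; rewrite p_quarterR in h.
have -> : omega ^+ 2 = (1 + 2 * w + w ^+ 2) / 4 by rewrite /omega; field.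
by rewrite h /omega; field.
Qed.

Lemma omega'_sqr : omega' ^+ 2 = omega' + m%:~R.
Proof.
have h := sqrtp_sqr; rewrite p_quarterR in h.
have -> : omega' ^+ 2 = (1 - 2 * w + w ^+ 2) / 4 by rewrite /omega'; field.
by rewrite h /omega'; field.
Qed.

Lemma omegaD : omega + omega' = 1. Proof. by rewrite /omega /omega'; field. Qed.

Lemma omegaB : omega - omega' = w. Proof. by rewrite /omega /omega'; field. Qed.

Definition qmul (z t : int * int) : int * int :=
  (z.1 * t.1 + z.2 * t.2 * m, z.1 * t.2 + z.2 * t.1 + z.2 * t.2).

Lemma qintM z t : qint (qmul z t) = qint z * qint t.
Proof.
rewrite /qint /qmul /= !rmorphD !rmorphM /=.
have -> : (z.1%:~R + z.2%:~R * omega) * (t.1%:~R + t.2%:~R * omega) =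
  z.1%:~R * t.1%:~R + (z.1%:~R * t.2%:~R + z.2%:~R * t.1%:~R) * omega + z.2%:~R * t.2%:~R * omega ^+ 2 by ring.
by rewrite omega_sqr; ring.
Qed.

Lemma qconjM z t : qconj (qmul z t) = qconj z * qconj t.
Proof.
rewrite /qconj /qmul /= !rmorphD !rmorphM /=.
have -> : (z.1%:~R + z.2%:~R * omega') * (t.1%:~R + t.2%:~R * omega') =
  z.1%:~R * t.1%:~R + (z.1%:~R * t.2%:~R + z.2%:~R * t.1%:~R) * omega' + z.2%:~R * t.2%:~R * omega' ^+ 2 by ring.
by rewrite omega'_sqr; ring.
Qed.

Lemma ratrD (x y : rat) : ratr (x + y) = ratr x + ratr y :> R. Proof. exact: rmorphD. Qed.
Lemma ratrM (x y : rat) : ratr (x * y) = ratr x * ratr y :> R. Proof. exact: rmorphM. Qed.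
Lemma ratr_div (x y : rat) : ratr (x / y) = ratr x / ratr y :> R. Proof. exact: fmorph_div. Qed.

Lemma intr_ratB (x y : int) : (x - y)%:~R = x%:~R - y%:~R :> rat.
Proof. exact: rmorphB. Qed.

(** Compare the parities of the valuations at [p]. *)
Lemma rat_sqr_neq_p (r : rat) : r ^+ 2 != p%:R.
Proof.
apply/eqP => h; have d0 := denq_neq0 r.
have : (numq r) ^+ 2 = p%:Z * (denq r) ^+ 2.
  apply: (@intr_inj rat); rewrite !expr2 !intrM -[p%:Z%:~R]/(p%:R : rat).
  rewrite -!expr2 -h -exprMn; congr (_ ^+ 2).
  by rewrite -{2}(divq_num_den r) divfK ?intr_eq0.
move/(congr1 absz); rewrite abszM !abszX /= => e.
have n0 : (0 < `|numq r|)%N.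
  rewrite absz_gt0 numq_eq0; apply/eqP => r0; move/eqP: h.
  by rewrite r0 expr0n /= eq_sym pnatr_eq0 => /eqP p0; move: p_pr; rewrite p0.
have d0' : (0 < `|denq r|)%N by rewrite absz_gt0.
have := congr1 (logn p) e; rewrite lognM ?expn_gt0 ?d0' ?prime_gt0 // !lognX (pfactorK 1 p_pr).
by lia.
Qed.

Lemma rat_indep (r s : rat) : ratr r + ratr s * w = 0 :> R -> r = 0 /\ s = 0.
Proof.
have [-> h|s0 h] := eqVneq s 0.
  split=> //; move/eqP: h; rewrite rmorph0 mul0r addr0 fmorph_eq0.
  by move=> /eqP.
have : ratr ((r / s) ^+ 2) = p%:R :> R.
  rewrite rmorphXn fmorph_div /= -sqrtp_sqr -[RHS]sqrrN; congr (_ ^+ 2).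
  have s0' : ratr s != 0 :> R by rewrite fmorph_eq0.
  apply: (mulIf s0'); rewrite divfK // mulNr mulrC; apply/eqP.
  by rewrite -addr_eq0 h.
move/eqP; rewrite -(rmorph_nat (ratr : {rmorphism rat -> R})) /= (inj_eq (fmorph_inj _)).
by rewrite (negbTE (rat_sqr_neq_p _)).
Qed.

Lemma qint_ratr (a b : int) : qint (a, b) = ratr (a%:~R + b%:~R / 2) + ratr (b%:~R / 2) * w.
Proof.
have -> : ratr (a%:~R + b%:~R / 2) = a%:~R + b%:~R / 2 :> R.
  by rewrite ratrD ratr_div !ratr_int ratr_nat.
have -> : ratr (b%:~R / 2) = b%:~R / 2 :> R by rewrite ratr_div ratr_int ratr_nat.
by rewrite /qint /omega /=; field.
Qed.

Lemma qint_inj : injective qint.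
Proof.
move=> [x y] [x' y'] h.
have : ratr ((x - x')%:~R + (y - y')%:~R / 2) + ratr ((y - y')%:~R / 2) * w = 0 :> R.
  rewrite -qint_ratr /qint /= !rmorphB /=; move: h; rewrite /qint /= => h.
  by rewrite mulrBl addrACA -opprD h subrr.
case/rat_indep => h1 h2.
have y0 : y - y' = 0.
  by apply/eqP; rewrite -(intr_eq0 rat); move/eqP: h2; rewrite mulf_eq0 invr_eq0 pnatr_eq0 orbF.
have x0 : x - x' = 0.
  by apply/eqP; rewrite -(intr_eq0 rat); move: h1; rewrite y0 mul0r addr0 => ->.
by rewrite (subr0_eq x0) (subr0_eq y0).
Qed.

Lemma qint0 : qint (0, 0) = 0. Proof. by rewrite /qint /= mul0r addr0. Qed.
Lemma qint1 : qint (1, 0) = 1. Proof. by rewrite /qint /= mul0r addr0. Qed.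
Lemma qconj1 : qconj (1, 0) = 1. Proof. by rewrite /qconj /= mul0r addr0. Qed.

Lemma qint_quad_field z : quad_field p (qint z).
Proof.
exists (z.1%:~R + z.2%:~R / 2), (z.2%:~R / 2).
by rewrite -qint_ratr; case: z.
Qed.

Lemma rat_integral_int (r : rat) : integralOver (intr : int -> R) (ratr r) -> exists k : int, r = k%:~R.
Proof.
case=> q qm qr.
have qr' : root (map_poly (intr : int -> algC) q) (ratr r).
  have er (B : numFieldType) : map_poly (intr : int -> B) q = map_poly ratr (map_poly intr q).
    by apply/polyP => i; rewrite !coef_map /= ratr_int.
  by move: qr; rewrite (er R) fmorph_root (er algC) fmorph_root.
have rA : (ratr r : algC) \in Aint.
  apply: (root_monic_Aint qr'); first by apply: monic_map.
  by apply/polyOverP => i; rewrite coef_map /= intr_int.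
have := Cint_rat_Aint (Crat_rat r) rA.
by case/intrP => k hk; exists k; apply: (fmorph_inj (ratr : {rmorphism rat -> algC})); rewrite /= hk ratr_int.
Qed.

(** [A + B sqrt p] and [A - B sqrt p] are values of the same integer polynomial,
    so that the conjugate of an integral element is integral. *)
Lemma conj_root (q : {poly int}) (r s : rat) : exists A B : rat,
  (map_poly (intr : int -> R) q).[ratr r + ratr s * w] = ratr A + ratr B * w /\
  (map_poly (intr : int -> R) q).[ratr r - ratr s * w] = ratr A - ratr B * w.
Proof.
elim/poly_ind: q => [|q c [A [B [h1 h2]]]].
  by exists 0, 0; rewrite !rmorph0 !horner0 mul0r addr0 subr0.
exists (A * r + p%:R * (B * s) + c%:~R), (A * s + B * r).
have -> : ratr (A * r + p%:R * (B * s) + c%:~R) = ratr A * ratr r + w ^+ 2 * (ratr B * ratr s) + c%:~R :> R.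
  by rewrite sqrtp_sqr !ratrD !ratrM ratr_int ratr_nat.
have -> : ratr (A * s + B * r) = ratr A * ratr s + ratr B * ratr r :> R by rewrite ratrD !ratrM.
rewrite rmorphD rmorphM /= map_polyX map_polyC /=.
rewrite !hornerD !hornerM !hornerX !hornerC h1 h2.
by split; ring.
Qed.

(** The trace and the norm of an integral element are rational and integral,
    hence integers; [p = 1 mod 4] then puts [2 r] and [2 s] in the same class
    modulo 2. *)
Lemma quad_int_qint (x : R) : quad_int p x -> exists z, x = qint z.
Proof.
case=> [[r [s xe]] xint]; rewrite -/w -/sqrtp in xe.
have cint : integralOver (intr : int -> R) (ratr r - ratr s * w).
  case: xint => q qm qx; exists q => //; move: qx; rewrite !rootE xe.
  have [A [B [-> ->]]] := conj_root q r s.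
  by move=> /eqP /rat_indep[-> ->]; rewrite !rmorph0 mul0r subr0.
(* [t] and [u] below are the trace and the coefficient of [sqrt p], doubled *)
have [t ht] : exists t : int, 2 * r = t%:~R.
  apply: rat_integral_int; have := integral_add xint cint.
  have -> : x + (ratr r - ratr s * w) = ratr (2 * r) by rewrite xe -/w ratrM ratr_nat; ring.
  by [].
have [N hN] : exists N : int, r ^+ 2 - p%:R * s ^+ 2 = N%:~R.
  apply: rat_integral_int; have := integral_mul xint cint.
  have -> : x * (ratr r - ratr s * w) = ratr (r ^+ 2 - p%:R * s ^+ 2).
    have rN y : ratr (- y) = - ratr y :> R by exact: raddfN.
    rewrite ratrD rN ratrM ratr_nat -sqrtp_sqr !expr2 !ratrM xe -/w; ring.
  by [].
have pu : p%:R * (2 * s) ^+ 2 = (t ^+ 2 - 4 * N)%:~R :> rat.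
  by rewrite !expr2 intr_ratB !intrM -ht -hN !expr2; ring.
have [v hv] : exists v : int, p%:R * (2 * s) = v%:~R :> rat.
  apply: rat_integral_int; exists ('X^2 - (p%:Z * (t ^+ 2 - 4 * N))%:P).
    by rewrite monicE lead_coefDl ?lead_coefXn // size_polyXn size_polyN (leq_ltn_trans (size_polyC_leq1 _)).
  rewrite rootE rmorphB /= map_polyXn map_polyC /= !hornerE subr_eq0 -rmorphXn /= -ratr_int.
  by apply/eqP; congr ratr; rewrite [RHS]intrM -pu -[p%:Z%:~R]/(p%:R : rat) !expr2; ring.
have pv : (p %| v)%Z.
  have e : v ^+ 2 = p%:Z * (t ^+ 2 - 4 * N).
    by apply: (@intr_inj rat); rewrite [v ^+ 2]expr2 !intrM -pu -hv -[p%:Z%:~R]/(p%:R : rat) !expr2; ring.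
  have : (p %| v ^+ 2)%Z by rewrite e dvdz_mulr // dvdzz.
  by rewrite !dvdzE abszX /= Euclid_dvdX // andbT.
have [u vu] := dvdzP pv.
have p0 : p%:R != 0 :> rat by rewrite pnatr_eq0 -lt0n prime_gt0.
have hu : 2 * s = u%:~R.
  by apply: (mulfI p0); rewrite hv vu rmorphM mulrC.
have tu : t ^+ 2 - p%:Z * u ^+ 2 = 4 * N.
  apply: (@intr_inj rat); rewrite !expr2 intr_ratB !intrM -ht -hu -hN -[p%:Z%:~R]/(p%:R : rat) !expr2.
  by ring.
have [x0 tux] : exists x0 : int, t = 2 * x0 + u.
  have ev : (2 %| t - u)%Z.
    have : (2 %| (t - u) ^+ 2)%Z.
      apply/dvdzP; exists (2 * N + (2 * m + 1) * u ^+ 2 - t * u).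
      have pm : p%:Z = 4 * m + 1 by rewrite {1}(p_quarter p_pr p_odd p14) PoszD PoszM.
      have -> : (t - u) ^+ 2 = (t ^+ 2 - p%:Z * u ^+ 2) + p%:Z * u ^+ 2 + u ^+ 2 - 2 * (t * u) by ring.
      by rewrite tu pm; ring.
    by rewrite !dvdzE abszX /= Euclid_dvdX // andbT.
  by have [x0 e] := dvdzP ev; exists x0; rewrite mulrC -e subrK.
exists (x0, u); rewrite xe /qint /omega /= -/w.
have -> : ratr r = t%:~R / 2 :> R.
  by rewrite -[t%:~R]ratr_int -ht ratrM ratr_nat; field.
have -> : ratr s = u%:~R / 2 :> R.
  by rewrite -[u%:~R]ratr_int -hu ratrM ratr_nat; field.
by rewrite tux rmorphD rmorphM /=; field.
Qed.

Lemma qint_integral z : integralOver (intr : int -> R) (qint z).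
Proof.
have om : integralOver (intr : int -> R) omega.
  exists ('X^2 - 'X - m%:P).
    rewrite monicE -addrA lead_coefDl ?lead_coefXn //.
    rewrite size_polyXn -opprD size_polyN; apply: leq_ltn_trans (size_polyD _ _) _.
    by rewrite size_polyX gtn_max /= (leq_ltn_trans (size_polyC_leq1 _)).
  rewrite rootE !rmorphB /= map_polyXn map_polyX map_polyC /= !hornerE omega_sqr.
  by apply/eqP; ring.
by apply: integral_add; [exact: integral_id | apply: integral_mul => //; exact: integral_id].
Qed.

Lemma qint_quad_int z : quad_int p (qint z).
Proof. by split; [exact: qint_quad_field | exact: qint_integral]. Qed.

End QuadraticIntegers.

(** * Units *)

Section Units.
Local Open Scope classical_set_scope.

Variables (R : realType) (p : nat) (p_pr : prime p) (p_odd : odd p).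
Hypothesis p14 : (p %% 4 = 1)%N.

Local Notation w := (sqrtp R p).
Local Notation omega := (omega R p).
Local Notation omega' := (omega' R p).
Local Notation qint := (qint R p).
Local Notation qconj := (qconj R p).
Local Notation m := ((quarter p)%:Z).

Lemma omega_mul : omega * omega' = - m%:~R.
Proof.
have h := omega_sqr R p_pr p_odd p14; have h1 := omegaD R p.
have -> : omega' = 1 - omega by rewrite -h1; ring.
by rewrite mulrBr -expr2 h; ring.
Qed.

Lemma quad_intP (x : R) : quad_int p x <-> exists z, x = qint z.
Proof.
by split=> [/(quad_int_qint p_pr p_odd p14) //|[z ->]]; exact: qint_quad_int.
Qed.

Lemma qintD z t : qint (z.1 + t.1, z.2 + t.2) = qint z + qint t.
Proof. by rewrite /qint /= !rmorphD /=; ring. Qed.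

Lemma qint_conj z : qint (z.1 + z.2, - z.2) = qconj z.
Proof.
rewrite /qint /qconj /= rmorphD rmorphN /=.
by have := omegaD R p; rewrite addrC => /(canRL (addrK _)) ->; ring.
Qed.

Lemma qint_sub_conj z : qint z - qconj z = z.2%:~R * w.
Proof. by rewrite -(omegaB R p) /qint /qconj; ring. Qed.

(** Conjugation preserves multiplicative relations: these lemmas transport
    equations between real numbers to their conjugates. *)
Lemma qconj_mul z1 z2 t1 t2 : qint z1 * qint z2 = qint t1 * qint t2 ->
  qconj z1 * qconj z2 = qconj t1 * qconj t2.
Proof.
by rewrite -!qintM // => /(qint_inj p_pr p_odd p14); rewrite -!qconjM // => ->.
Qed.

Definition qnorm (z : int * int) : int := z.1 ^+ 2 + z.1 * z.2 - m * z.2 ^+ 2.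

Lemma qnormE z : qint z * qconj z = (qnorm z)%:~R.
Proof.
have -> : (qnorm z)%:~R = z.1%:~R ^+ 2 + z.1%:~R * z.2%:~R - m%:~R * z.2%:~R ^+ 2 :> R.
  by rewrite /qnorm !expr2 rmorphB rmorphD /= !intrM.
have -> : qint z * qconj z = z.1%:~R ^+ 2 + z.1%:~R * z.2%:~R * (omega + omega') +
   omega * omega' * z.2%:~R ^+ 2 by rewrite /qint /qconj; ring.
by rewrite omegaD omega_mul; ring.
Qed.

Lemma qint_eq0 z : (qint z == 0) = (z == (0, 0)).
Proof. by rewrite -(qint0 R p) (inj_eq (qint_inj p_pr p_odd p14)). Qed.

Lemma qconj_eq0 z : (qconj z == 0) = (z == (0, 0)).
Proof.
rewrite -qint_conj qint_eq0; case: z => x y; rewrite !xpair_eqE /= oppr_eq0.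
by have [->|] := eqVneq y 0; rewrite ?addr0 ?andbT ?andbF.
Qed.

Lemma quad_int1 : quad_int p (1 : R).
Proof. by apply/quad_intP; exists (1, 0); rewrite qint1. Qed.

Lemma quad_int_intr (k : int) : quad_int p (k%:~R : R).
Proof. by apply/quad_intP; exists (k, 0); rewrite /qint /= mul0r addr0. Qed.

Lemma quad_intM (x y : R) : quad_int p x -> quad_int p y -> quad_int p (x * y).
Proof.
by move=> /quad_intP[z ->] /quad_intP[t ->]; apply/quad_intP; exists (qmul p z t); rewrite qintM.
Qed.

Lemma quad_intD (x y : R) : quad_int p x -> quad_int p y -> quad_int p (x + y).
Proof.
by move=> /quad_intP[z ->] /quad_intP[t ->]; apply/quad_intP; exists (z.1 + t.1, z.2 + t.2); rewrite qintD.
Qed.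

Lemma quad_unit1 : quad_unit p (1 : R).
Proof. by split; [exact: quad_int1 | exists 1; rewrite ?mulr1; [exact: quad_int1|]]. Qed.

Lemma quad_unitM (x y : R) : quad_unit p x -> quad_unit p y -> quad_unit p (x * y).
Proof.
move=> [xi [x1 x1i xx1]] [yi [y1 y1i yy1]]; split; first exact: quad_intM.
by exists (x1 * y1); [exact: quad_intM | rewrite mulrACA xx1 yy1 mulr1].
Qed.

Lemma quad_unitN (x : R) : quad_unit p x -> quad_unit p (- x).
Proof.
move=> [xi [y yi xy]]; rewrite -mulN1r; split; last exists (-1 * y).
- by apply: quad_intM => //; rewrite -(rmorphN1 intr); exact: quad_int_intr.
- by apply: quad_intM => //; rewrite -(rmorphN1 intr); exact: quad_int_intr.
- by rewrite mulrACA xy mulN1r opprK mulr1.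
Qed.

Lemma quad_unit_neq0 (x : R) : quad_unit p x -> x != 0.
Proof.
by move=> [_ [y _ xy]]; apply/eqP => x0; move/eqP: xy; rewrite x0 mul0r eq_sym oner_eq0.
Qed.

Lemma quad_unitV (x : R) : quad_unit p x -> quad_unit p x^-1.
Proof.
move=> xu; have x0 := quad_unit_neq0 xu; have [xi [y yi xy]] := xu.
have -> : x^-1 = y by apply: (mulfI x0); rewrite divff.
by split=> //; exists x; rewrite 1?mulrC.
Qed.

Lemma quad_unit_exp (x : R) (k : int) : quad_unit p x -> quad_unit p (x ^ k).
Proof.
move=> xu; have en (n : nat) : quad_unit p (x ^+ n).
  by elim: n => [|n IH]; [exact: quad_unit1 | rewrite exprS; exact: quad_unitM].
by case: k => n; [exact: en | rewrite NegzE -exprnN; exact/quad_unitV/en].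
Qed.

Lemma quad_unit_norm z : quad_unit p (qint z) -> `|qint z * qconj z| = 1.
Proof.
move=> [_ [v /quad_intP[t ->] zt]].
have h : qint z * qint t = qint (1, 0) * qint (1, 0) by rewrite zt qint1 mulr1.
have h' := qconj_mul h; rewrite qconj1 mulr1 in h'.
have : qnorm z * qnorm t = 1.
  by apply: (@intr_inj R); rewrite rmorphM /= -!qnormE mulrACA h' zt mulr1.
move/(congr1 absz); rewrite abszM => /eqP; rewrite muln_eq1 => /andP[/eqP e _].
by rewrite qnormE -intr_norm -abszE e.
Qed.

(** A unit [u > 1] has a conjugate of absolute value less than 1, while their
    difference is a positive multiple of [sqrt p >= sqrt 5 > 11 / 5]. The gap
    makes the units greater than 1 discrete. *)
Lemma quad_unit_gap (u : R) : quad_unit p u -> 1 < u -> 6 / 5 < u.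
Proof.
move=> uu u1; have [ui _] := uu; have [z uz] := (quad_intP u).1 ui.
have := quad_unit_norm (z := z); rewrite -uz => /(_ uu).
rewrite normrM => h; have u0 : 0 < u by apply: lt_trans u1.
have c1 : `|qconj z| < 1.
  by move: h u1; rewrite (gtr0_norm u0); have := normr_ge0 (qconj z); nra.
have := qint_sub_conj z; rewrite -uz => h1.
move: c1; rewrite ltr_norml => /andP[c1 c2].
have w2 : 11 / 5 < w.
  rewrite -(ltr_pXn2r (n := 2)) // ?nnegrE ?(ltW (sqrtp_gt0 R p_pr)) ?divr_ge0 //.
  rewrite (sqrtp_sqr R p); apply: (@lt_le_trans _ _ 5%:R); first by lra.
  by rewrite ler_nat; exact: p_ge5.
have z0 : (0 < z.2)%R.
  rewrite -(ltr0z R); have : 0 < z.2%:~R * w by rewrite -h1; lra.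
  by rewrite pmulr_lgt0 // sqrtp_gt0.
have : 1 <= z.2%:~R :> R by rewrite ler1z; lia.
by move: w2; nra.
Qed.

(** The hypothesis under which the lattice points of the sector of ratio
    [E ^+ 2] represent distinct ideals. It holds for the fundamental unit, and
    would hold for all [E] if the only units were 1 and -1. *)
Definition trivial_units_below (E : R) : Prop :=
  forall u : R, quad_unit p u -> 0 < u -> E^-1 < u -> u < E -> u = 1.

(** The infimum of the units greater than 1 is attained, because the quotient of
    two of them cannot be close to 1; then divide any unit by the power of the
    least one given by the integral part of the logarithm. *)
Lemma fundamental_unit_exists (E : R) : ~ trivial_units_below E ->
  exists e : R, is_fundamental_unit p e.
Proof.
move=> nE; pose U := [set u : R | quad_unit p u /\ 1 < u].
have [u0 [u0u u01]] : exists u, U u.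
  apply: contrapT => nU; apply: nE => u uu u_gt0 _ _; apply: contrapT => u1.
  apply: nU; have [u1'|u1'|//] := ltgtP u 1; last by exists u.
  exists u^-1; split; first exact: quad_unitV.
  by rewrite -[1]invr1 ltf_pV2 ?posrE.
have U_lb : lbound U 1 by move=> u [_ /ltW].
have hi : has_inf U by split; [exists u0 | exists 1].
have i1 : 1 <= inf U by apply: lb_le_inf => //; exists u0.
have i5 : 0 < inf U / 5 by rewrite divr_gt0 // (lt_le_trans _ i1).
have [e [eu e1] einf] := inf_adherent i5 hi.
have min v : quad_unit p v -> 1 < v -> e <= v.
  move=> vu v1; rewrite leNgt; apply/negP => ve.
  have v0 : 0 < v by apply: lt_trans v1.
  have : 6 / 5 < e / v.
    apply: quad_unit_gap; first by apply: quad_unitM => //; exact: quad_unitV.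
    by rewrite ltr_pdivlMr // mul1r.
  rewrite ltr_pdivlMr // => h.
  have : inf U <= v by apply: (ge_inf hi.2).
  by move: h einf; lra.
have e0 : 0 < e by apply: lt_trans e1.
exists e; split => // u uu.
have un0 := quad_unit_neq0 uu.
pose n := Num.floor (ln `|u| / ln e).
have le0 : 0 < ln e by rewrite ln_gt0.
pose v := `|u| / e ^ n.
have vu : quad_unit p v.
  apply: quad_unitM; last by apply: quad_unitV; exact: quad_unit_exp.
  by have [] := ler0P u => // _; exact: quad_unitN.
have en0 : 0 < e ^ n by rewrite exprz_gt0.
have lnen : ln (e ^ n) = n%:~R * ln e.
  clear -e0; case: n => k; first by rewrite -exprnP lnXn // mulr_natl.
  by rewrite NegzE -exprnN lnV ?posrE ?exprn_gt0 // lnXn // rmorphN /= mulNr mulr_natl.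
have v0 : 0 < v by rewrite divr_gt0 ?normr_gt0.
have lnv : ln v = ln `|u| - n%:~R * ln e by rewrite ln_div ?posrE ?normr_gt0 // lnen.
have v1 : v = 1.
  have lv0 : 0 <= ln v.
    by rewrite lnv subr_ge0 -ler_pdivlMr // -floor_geP.
  have lve : ln v < ln e.
    have : ln `|u| / ln e < (n + 1)%:~R by rewrite -floor_ltP ltzD1.
    by rewrite ltr_pdivrMr // intrD mulrDl mul1r lnv ltrBlDl.
  apply/eqP; rewrite eq_le; apply/andP; split.
    rewrite leNgt; apply/negP => v1; have := min v vu v1.
    by rewrite leNgt => /negP; apply; rewrite -ltr_ln ?posrE.
  by rewrite -ler_ln ?posrE // ln1.
have : `|u| = e ^ n by rewrite -[LHS](divfK (lt0r_neq0 en0)) -/v v1 mul1r.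
by have [u0'|u0'] := ler0P u => h; exists n; [right; rewrite -h opprK | left].
Qed.

End Units.

(** * Ideals as lattices *)

Section Ideals.
Local Open Scope classical_set_scope.

Variables (R : realType) (p : nat) (p_pr : prime p) (p_odd : odd p).
Hypothesis p14 : (p %% 4 = 1)%N.

Local Notation w := (sqrtp R p).
Local Notation omega := (omega R p).
Local Notation omega' := (omega' R p).
Local Notation qint := (qint R p).
Local Notation qconj := (qconj R p).
Local Notation m := ((quarter p)%:Z).
Local Notation quad_int := (@quad_int R p).
Local Notation qI := (qint_inj p_pr p_odd p14).

Definition dilate (g : R) (A : set R) : set R := [set g * t | t in A].

Lemma dilateM (g h : R) A : dilate g (dilate h A) = dilate (g * h) A.
Proof.
apply/seteqP; split=> x /=.
  by case=> _ [t At <-] <-; exists t; rewrite // mulrA.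
by case=> t At <-; exists (h * t); rewrite ?mulrA //; exists t.
Qed.

Lemma dilate1 A : dilate 1 A = A.
Proof. by apply/seteqP; split=> x /=; [case=> t At <-; rewrite mul1r | exists x; rewrite ?mul1r]. Qed.

Lemma dilateK (g : R) A B : g != 0 -> dilate g A = B -> A = dilate g^-1 B.
Proof. by move=> g0 <-; rewrite dilateM mulVf // dilate1. Qed.

(** The primitive ideal [Z a + Z (b + omega)] (an ideal when [valid a b]), in
    coordinates. *)
Definition lat (a b : nat) : set R :=
  [set t | exists x y : int, t = qint (x * a%:Z + y * b%:Z, y)].

Definition valid (a b : nat) : bool := [&& (0 < a)%N, (b < a)%N & (a %| Fm p b)%Z].

Lemma valid_F a b : valid a b -> exists F : int, b%:Z ^+ 2 + b%:Z - m = a%:Z * F.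
Proof. by case/and3P=> _ _ /dvdzP[F hF]; exists F; rewrite mulrC -hF. Qed.

Lemma lat_a a b : lat a b a%:R.
Proof. by exists 1, 0; rewrite /qint /= !mul0r !addr0 mul1r. Qed.

Lemma lat_theta a b : lat a b (b%:R + omega).
Proof. by exists 0, 1; rewrite /qint /= mul0r add0r !mul1r. Qed.

Lemma latE a b x y : qint (x * a%:Z + y * b%:Z, y) = x%:~R * a%:R + y%:~R * (b%:R + omega).
Proof. by rewrite /qint /= rmorphD !rmorphM /= -!pmulrn; ring. Qed.

(** [omega (b + omega) = (b + 1) (b + omega) - Fm b], and [a] divides [Fm b]. *)
Lemma lat_mul a b (c t : R) : valid a b -> quad_int c -> lat a b t -> lat a b (c * t).
Proof.
move=> /valid_F[F hF] /(quad_intP p_pr p_odd p14)[z ->] [x [y ->]].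
rewrite -qintM // /qmul /=.
exists (z.1 * x - z.2 * (x * b%:Z + y * F)), (z.1 * y + z.2 * (x * a%:Z + y * b%:Z + y)).
congr (qint (_, _)); last by ring.
have -> : z.2 * y * m = z.2 * y * (b%:Z ^+ 2 + b%:Z) - z.2 * y * (b%:Z ^+ 2 + b%:Z - m) by ring.
by rewrite hF; ring.
Qed.

Lemma lat_add a b t u : lat a b t -> lat a b u -> lat a b (t + u).
Proof.
move=> [x [y ->]] [x' [y' ->]]; exists (x + x'), (y + y'); rewrite -qintD /=.
by congr (qint (_, _)); ring.
Qed.

Lemma dilate_lat_ideal (g : R) a b : valid a b -> g != 0 ->
  quad_int (g * a%:R) -> quad_int (g * (b%:R + omega)) -> nonzero_ideal p (dilate g (lat a b)).
Proof.
move=> vab g0 ga gt; split; last first.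
  exists (g * a%:R); first by exists a%:R => //; exact: lat_a.
  by rewrite mulf_neq0 // pnatr_eq0 -lt0n; case/and3P: vab.
split.
- move=> _ [t [x [y ->]] <-]; rewrite latE.
  have -> : g * (x%:~R * a%:R + y%:~R * (b%:R + omega)) =
     x%:~R * (g * a%:R) + y%:~R * (g * (b%:R + omega)) by ring.
  by apply: quad_intD => //; apply: quad_intM => //; exact: quad_int_intr.
- by exists 0; rewrite ?mulr0 //; exists 0, 0; rewrite !mul0r addr0 qint0.
- move=> _ _ [t At <-] [u Au <-]; exists (t + u); last by rewrite mulrDr.
  exact: lat_add.
- move=> c _ cO [t At <-]; exists (c * t); last by rewrite mulrCA.
  exact: lat_mul.
Qed.

(** For valid triples, [c (Z a + Z (b + omega))], of norm [c ^ 2 * a]. *)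
Definition jset (t : nat * nat * nat) : set R := dilate t.1.1%:R (lat t.1.2 t.2).

Definition valid3 (t : nat * nat * nat) : bool := (0 < t.1.1)%N && valid t.1.2 t.2.

Lemma jsetP c a b z : jset (c, a, b) (qint z) <->
  exists x y : int, z = (c%:Z * (x * a%:Z + y * b%:Z), c%:Z * y).
Proof.
have e (u v : int) : qint (c%:Z * u, c%:Z * v) = c%:R * qint (u, v).
  by rewrite /qint /= !rmorphM /= -pmulrn; ring.
split=> [[_ [x [y ->]] /=]|[x [y ->]]].
  by rewrite -e => /qI <-; exists x, y.
by exists (qint (x * a%:Z + y * b%:Z, y)); [exists x, y | rewrite e].
Qed.

Lemma jset_ideal t : valid3 t -> nonzero_ideal p (jset t).
Proof.
case: t => [[c a] b] /andP[/= c0 vab]; apply: dilate_lat_ideal => //.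
- by rewrite pnatr_eq0 -lt0n.
- by rewrite -natrM [_%:R]pmulrn; exact: quad_int_intr.
- apply: quad_intM => //; first by rewrite [_%:R]pmulrn; exact: quad_int_intr.
  by apply/(quad_intP p_pr p_odd p14); exists (b%:Z, 1); rewrite /qint /= mul1r.
Qed.

(** [c] generates the second coordinates, [c a] the rational elements, and then
    [b] is determined modulo [a]. *)
Lemma jset_inj t1 t2 : valid3 t1 -> valid3 t2 -> jset t1 = jset t2 -> t1 = t2.
Proof.
case: t1 t2 => [[c a] b] [[c' a'] b'] /andP[/= c0 /and3P[/= a0 ba _]] /andP[/= c0' /and3P[/= a0' ba' _]] e.
have sub (c1 a1 b1 c2 a2 b2 : nat) : jset (c1, a1, b1) = jset (c2, a2, b2) ->
    [/\ (c2 %| c1)%N, (c2 * a2 %| c1 * a1)%N & (c2 * a2 %| c1%:Z * b1%:Z - c1%:Z * b2%:Z)%Z].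
  move=> h.
  have h1 : jset (c2, a2, b2) (qint (c1%:Z * a1%:Z, 0)).
    by rewrite -h; apply/jsetP; exists 1, 0; congr (_, _); ring.
  have h2 : jset (c2, a2, b2) (qint (c1%:Z * b1%:Z, c1%:Z)).
    by rewrite -h; apply/jsetP; exists 0, 1; congr (_, _); ring.
  have [x [y [e1 e2]]] := (jsetP _ _ _ _).1 h1.
  have [x' [y' [e1' e2']]] := (jsetP _ _ _ _).1 h2.
  split.
  - by change (c2%:Z %| c1%:Z)%Z; apply/dvdzP; exists y'; rewrite e2' mulrC.
  - case: (eqVneq c2 0%N) => [c20|c20].
      by move: e1; rewrite c20 !mul0r => /eqP; rewrite -PoszM eqz_nat => /eqP ->.
    change ((c2 * a2)%N%:Z %| (c1 * a1)%N%:Z)%Z; apply/dvdzP; exists x; rewrite !PoszM e1.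
    move/eqP: e2; rewrite eq_sym mulf_eq0 eqz_nat (negbTE c20) /= => /eqP ->; ring.
  - by apply/dvdzP; exists x'; rewrite e1' [c1%:Z in X in _ - X]e2' PoszM; ring.
have [d1 d2 d3] := sub _ _ _ _ _ _ e; have [d1' d2' _] := sub _ _ _ _ _ _ (esym e).
have cc : c = c' by apply/eqP; rewrite eqn_dvd d1 d1'.
rewrite -cc in d2 d2' d3 *.
have aa : a = a' by apply/eqP; rewrite eqn_dvd -(dvdn_pmul2l (p := c)) // d2' -(dvdn_pmul2l (p := c)) // d2.
rewrite -aa in d3 ba' *; congr (_, _, _).
move: d3; rewrite -mulrBr PoszM dvdz_mul2l ?eqz_nat -?lt0n // => d3.
exact: (congr1 val (@ord_eq_of_dvd a (Ordinal ba) (Ordinal ba') d3)).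
Qed.

Lemma int_subgroup (P : int -> Prop) : P 0 -> (forall x y, P x -> P y -> P (x - y)) ->
  exists n : nat, forall x, P x <-> (n %| x)%Z.
Proof.
move=> P0 PB.
have PN x : P x -> P (- x) by rewrite -[- x]add0r; apply: PB.
have PD x y : P x -> P y -> P (x + y) by move=> Px Py; rewrite -[y]opprK; apply/PB/PN.
have PM x (k : int) : P x -> P (k * x).
  move=> Px; have Pn (n : nat) : P (n%:Z * x).
    by elim: n => [|n IH]; rewrite ?mul0r // intS mulrDl mul1r; apply: PD.
  by case: k => n; rewrite ?NegzE ?mulNr; [|apply: PN].
have [[x [Px x0]]|nx] := pselect (exists x, P x /\ x != 0); last first.
  exists 0%N => x; rewrite dvd0z; split=> [Px|/eqP -> //].
  by apply/negP => x0; apply: nx; exists x; split=> //; apply/negP.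
have ex : exists n : nat, (0 < n)%N && `[< P n%:Z >].
  exists `|x|%N; rewrite absz_gt0 x0; apply/asboolP.
  by rewrite abszE; have [] := ler0P x => // _; exact: PN.
have [n /andP[n0 /asboolP Pn] nmin] := ex_minnP ex.
exists n => y; split=> [Py|/dvdzP[k ->]]; last exact: PM.
have Pr : P (y %% n)%Z by rewrite /modz; apply: PB => //; exact: PM.
have r0 : (0 <= (y %% n)%Z)%R by apply: modz_ge0; lia.
have rn : ((y %% n)%Z < n%:Z)%R by apply: ltz_pmod; lia.

have [r1|r1] := eqVneq (y %% n)%Z 0; first exact/dvdz_mod0P.
have := nmin `|(y %% n)%Z|%N; rewrite absz_gt0 r1 /= abszE ger0_norm //.
by move=> /(_ (asboolT Pr)); move: r0 rn; lia.
Qed.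

(** [c] generates the subgroup of the second coordinates and [a1] the subgroup of
    rational integers; multiplying by [omega] exchanges coordinates, which
    forces [c] to divide [a1] and the element over [c]. *)
Lemma ideal_normal_form (I : set R) : nonzero_ideal p I ->
  exists2 t, valid3 t & I = jset t.
Proof.
move=> [[IO I0 ID IM] [t0 It0 t00]].
have IB x y : I x -> I y -> I (x - y).
  move=> Ix Iy; apply: ID => //; rewrite -mulN1r; apply: IM => //.
  by rewrite -(rmorphN1 intr); exact: quad_int_intr.
have QI z : quad_int (qint z) by apply/(quad_intP p_pr p_odd p14); exists z.
have Iom z : I (qint z) -> I (qint (z.2 * m, z.1 + z.2)).
  move=> Iz; have -> : qint (z.2 * m, z.1 + z.2) = qint (0, 1) * qint z.
    by rewrite -qintM // /qmul /=; congr (qint (_, _)); ring.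
  exact: IM.
have qB z t : qint z - qint t = qint (z.1 - t.1, z.2 - t.2).
  by rewrite /qint /= !rmorphB /=; ring.
have qZ (k : int) z : k%:~R * qint z = qint (k * z.1, k * z.2).
  by rewrite /qint /= !rmorphM /=; ring.
have [c hc] : exists c : nat, forall y, (exists x, I (qint (x, y))) <-> (c %| y)%Z.
  apply: int_subgroup; first by exists 0; rewrite qint0.
  by move=> y y' [x Ix] [x' Ix']; exists (x - x'); have := IB _ _ Ix Ix'; rewrite qB.
have [a1 ha1] : exists a1 : nat, forall x, I (qint (x, 0)) <-> (a1 %| x)%Z.
  apply: int_subgroup; first by rewrite qint0.
  by move=> x x' Ix Ix'; have := IB _ _ Ix Ix'; rewrite qB /= subrr.
have [z0 t0E] := (quad_intP p_pr p_odd p14 t0).1 (IO _ It0).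
have z00 : z0 != (0, 0) by rewrite -(qint_eq0 R p_pr p_odd p14) -t0E.
have a1_gt0 : (0 < a1)%N.
  rewrite lt0n; apply/eqP => a10.
  have : I (qint (qnorm p z0, 0)).
    have -> : qint (qnorm p z0, 0) = qconj z0 * t0.
      by rewrite t0E mulrC qnormE // /qint /= mul0r addr0.
    by apply: IM => //; rewrite -qint_conj.
  move/ha1; rewrite a10 dvd0z => /eqP n0.
  have := qnormE R p_pr p_odd p14 z0; rewrite n0 => /eqP.
  by rewrite mulf_eq0 qint_eq0 // qconj_eq0 // orbb (negbTE z00).
have ca1 : (c %| a1)%N.
  change (c%:Z %| a1%:Z)%Z; apply/hc; exists 0.
  have /Iom /= : I (qint (a1%:Z, 0)) by apply/ha1; exact: dvdzz.
  by rewrite mul0r addr0.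
have [a a1E] := dvdnP ca1.
have c_gt0 : (0 < c)%N by move: a1_gt0; rewrite a1E muln_gt0 => /andP[].
have a_gt0 : (0 < a)%N by move: a1_gt0; rewrite a1E muln_gt0 => /andP[].
have [x0 Ix0] := (hc c%:Z).2 (dvdzz _).
have /dvdzP[b0 x0E] : (c %| x0)%Z.
  have /Iom /= h := Ix0.
  have : (c %| x0 + c%:Z)%Z by apply/hc; exists (c%:Z * m).
  by case/dvdzP=> k hk; apply/dvdzP; exists (k - 1); rewrite mulrBl mul1r -hk addrK.
pose b := `|(b0 %% a)%Z|%N.
have bE : b%:Z = (b0 %% a)%Z by rewrite abszE ger0_norm // modz_ge0 //; lia.
have ba : (b < a)%N by rewrite -ltz_nat bE ltz_pmod // ltz_nat.
have Ib : I (qint (c%:Z * b%:Z, c%:Z)).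
  have -> : qint (c%:Z * b%:Z, c%:Z) = qint (x0, c%:Z) - qint ((b0 %/ a)%Z * a1%:Z, 0).
    rewrite qB /= subr0 x0E bE a1E PoszM; congr (qint (_, _)).
    by rewrite {2}(divz_eq b0 a); ring.
  by apply: IB => //; apply/ha1; exact: dvdz_mull.
have Fdvd : (a %| Fm p b)%Z.
  have : (c%:Z * a%:Z %| c%:Z * Fm p b)%Z.
    rewrite -PoszM mulnC -a1E; apply/ha1.
    have -> : qint (c%:Z * Fm p b, 0) = qint (b%:Z + 1, -1) * qint (c%:Z * b%:Z, c%:Z).
      by rewrite -qintM // /qmul /= /Fm; congr (qint (_, _)); ring.
    by apply: IM.
  by rewrite dvdz_mul2l // eqz_nat -lt0n.
exists (c, a, b); first by rewrite /valid3 /= c_gt0 /valid a_gt0 ba.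
apply/seteqP; split=> x.
  move=> Ix; have [[x1 y1] xE] := (quad_intP p_pr p_odd p14 x).1 (IO _ Ix).
  rewrite xE in Ix *; have /dvdzP[y yE] : (c %| y1)%Z by apply/hc; exists x1.
  have : I (qint (x1 - y * (c%:Z * b%:Z), 0)).
    have -> : qint (x1 - y * (c%:Z * b%:Z), 0) = qint (x1, y1) - y%:~R * qint (c%:Z * b%:Z, c%:Z).
      by rewrite qZ qB /= yE subrr.
    by apply: IB => //; apply: IM => //; exact: quad_int_intr.
  move/ha1/dvdzP => [k hk]; apply/jsetP; exists k, y; congr (_, _); last by rewrite yE mulrC.
  by move/eqP: hk; rewrite subr_eq => /eqP ->; rewrite a1E PoszM; ring.
case=> _ [x1 [y1 ->]] <- /=; rewrite latE.
have -> : c%:R * (x1%:~R * a%:R + y1%:~R * (b%:R + omega)) =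
   x1%:~R * qint (a1%:Z, 0) + y1%:~R * qint (c%:Z * b%:Z, c%:Z).
  have a1R : a1%:R = a%:R * c%:R :> R by rewrite a1E natrM.
  by rewrite /qint /= !rmorphM /= -!pmulrn a1R; ring.
apply: ID; apply: IM => //; try exact: quad_int_intr.
by apply/ha1; exact: dvdzz.
Qed.

(** Coordinates of two bases of the same lattice have the same determinant up to
    sign; this is half of it. *)
Lemma int_det_dvd (e1 e2 f1 f2 : int * int) (u1 u2 v1 v2 : int) :
  f1 = (u1 * e1.1 + u2 * e2.1, u1 * e1.2 + u2 * e2.2) ->
  f2 = (v1 * e1.1 + v2 * e2.1, v1 * e1.2 + v2 * e2.2) ->
  (e1.1 * e2.2 - e1.2 * e2.1 %| f1.1 * f2.2 - f1.2 * f2.1)%Z.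
Proof.
move=> -> -> /=; apply/dvdzP; exists (u1 * v2 - u2 * v1); ring.
Qed.

(** A point of the conjugate lattice [Z a + Z (b + omega')], and [gcnj] its
    conjugate. Dividing by [a] turns the points into the multipliers [g] such
    that [g (lat a b)] is integral, because the product of [lat a b] with its
    conjugate is the ideal [(a)]. *)
Definition gval (a b : nat) (x y : int) : R := x%:~R * a%:R + y%:~R * (b%:R + omega').
Definition gcnj (a b : nat) (x y : int) : R := x%:~R * a%:R + y%:~R * (b%:R + omega).

Lemma gval_qint a b x y : gval a b x y = qint (x * a%:Z + y * (b%:Z + 1), - y).
Proof.
rewrite /gval /qint /= rmorphD !rmorphM rmorphN rmorphD /= -!pmulrn.
by rewrite (_ : omega' = 1 - omega) ?mulrDl -?(omegaD R p); ring.
Qed.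

Lemma gcnj_qconj a b x y : gcnj a b x y = qconj (x * a%:Z + y * (b%:Z + 1), - y).
Proof.
rewrite /gcnj /qconj /= rmorphD !rmorphM rmorphN rmorphD /= -!pmulrn.
by rewrite (_ : omega = 1 - omega') -?(omegaD R p); ring.
Qed.

Lemma gval_theta a b F x y : b%:Z ^+ 2 + b%:Z - m = a%:Z * F ->
  gval a b x y * (b%:R + omega) = a%:R * qint (x * b%:Z + y * F, x).
Proof.
move=> hF; rewrite gval_qint.
have -> : b%:R + omega = qint (b%:Z, 1) by rewrite /qint /= mul1r -pmulrn.
have -> : a%:R * qint (x * b%:Z + y * F, x) = qint (a%:Z * (x * b%:Z + y * F), a%:Z * x).
  by rewrite /qint /= !rmorphM /= -pmulrn; ring.
rewrite -qintM // /qmul /=; congr (qint (_, _)); last by ring.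
have -> : a%:Z * (x * b%:Z + y * F) = x * (a%:Z * b%:Z) + y * (a%:Z * F) by ring.
by rewrite -hF; ring.
Qed.

(** Both [g a] and [g (b + omega)] are integers; comparing the coordinates of
    [(g a) (b + omega)], a multiple of [a], shows that [a] divides the first
    coordinate of [g a]. *)
Lemma ideal_scalar a b (g : R) : valid a b -> dilate g (lat a b) `<=` quad_int ->
  exists x y, g * a%:R = gval a b x y.
Proof.
move=> vab gO; have [F hF] := valid_F vab; have a0 : (0 < a)%N by case/and3P: vab.
have aR : a%:R != 0 :> R by rewrite pnatr_eq0 -lt0n.
have /(quad_intP p_pr p_odd p14)[z hz] : quad_int (g * a%:R).
  by apply: gO; exists a%:R => //; exact: lat_a.
have /(quad_intP p_pr p_odd p14)[t ht] : quad_int (g * (b%:R + omega)).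
  by apply: gO; exists (b%:R + omega) => //; exact: lat_theta.
have : qint z * qint (b%:Z, 1) = qint (a%:Z * t.1, a%:Z * t.2).
  have -> : qint (a%:Z * t.1, a%:Z * t.2) = a%:R * qint t.
    by rewrite /qint /= !rmorphM /= -pmulrn; ring.
  by rewrite -hz -ht /qint /= mul1r -pmulrn; ring.
rewrite -qintM // => /qI [_ /= h].
exists (t.2 - z.2 * 0), (- z.2); rewrite gval_qint hz opprK.
rewrite [z in LHS]surjective_pairing; congr (qint (_, _)).
by rewrite mulr0 subr0 mulrC -h; ring.
Qed.

Lemma gval_ideal a b x y : valid a b -> gval a b x y != 0 ->
  nonzero_ideal p (dilate (gval a b x y / a%:R) (lat a b)).
Proof.
move=> vab g0; have [F hF] := valid_F vab; have a0 : (0 < a)%N by case/and3P: vab.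
have aR : a%:R != 0 :> R by rewrite pnatr_eq0 -lt0n.
apply: dilate_lat_ideal => //.
- by rewrite mulf_neq0 // invr_eq0.
- by rewrite divfK // gval_qint; apply/(quad_intP p_pr p_odd p14); eexists; reflexivity.
- rewrite mulrAC (gval_theta _ _ hF) mulrAC divff // mul1r.
  by apply/(quad_intP p_pr p_odd p14); eexists; reflexivity.
Qed.

(** Compute the determinant of the lattice [jset t] in two bases, that of the
    normal form and the multiples of [a] and [b + omega]. *)
Lemma gval_norm a b x y t : valid a b -> valid3 t ->
  dilate (gval a b x y / a%:R) (lat a b) = jset t ->
  `|gval a b x y * gcnj a b x y| = a%:R * (t.1.1 * t.1.1 * t.1.2)%:R.
Proof.
case: t => [[c2 a2] b2] vab v3 e; have [F hF] := valid_F vab.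
have a0 : (0 < a)%N by case/and3P: vab.
have aR : a%:R != 0 :> R by rewrite pnatr_eq0 -lt0n.
pose e1 := (x * a%:Z + y * (b%:Z + 1), - y); pose e2 := (x * b%:Z + y * F, x).
pose f1 := (c2%:Z * a2%:Z, 0 : int); pose f2 := (c2%:Z * b2%:Z, c2%:Z).
have gt (u v : int) : gval a b x y / a%:R * qint (u * a%:Z + v * b%:Z, v) =
    qint (u * e1.1 + v * e2.1, u * e1.2 + v * e2.2).
  rewrite latE mulrDr ![_ * (_%:~R * _)]mulrCA divfK // mulrAC (gval_theta _ _ hF).
  rewrite [a%:R * _]mulrC mulfK // gval_qint /e1 /e2 /qint /= !rmorphD /= !intrM !rmorphD /= !intrM.
  ring.
have in1 z : jset (c2, a2, b2) (qint z) ->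
    exists u v, z = (u * e1.1 + v * e2.1, u * e1.2 + v * e2.2).
  rewrite -e => -[_ [u [v ->]] /=]; rewrite gt => /qI <-.
  by exists u, v.
have in2 z : (exists u v, z = (u * e1.1 + v * e2.1, u * e1.2 + v * e2.2)) ->
    exists u v, z = (u * f1.1 + v * f2.1, u * f1.2 + v * f2.2).
  move=> [u [v ->]]; have /jsetP[u' [v' ->]] : jset (c2, a2, b2) (qint (u * e1.1 + v * e2.1, u * e1.2 + v * e2.2)).
    by rewrite -e -gt; exists (qint (u * a%:Z + v * b%:Z, v)) => //; exists u, v.
  by exists u', v'; rewrite /f1 /f2 /=; congr (_, _); ring.
have [u1 [u2 hf1]] : exists u v, f1 = (u * e1.1 + v * e2.1, u * e1.2 + v * e2.2).
  by apply: in1; apply/jsetP; exists 1, 0; rewrite /f1; congr (_, _); ring.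
have [v1 [v2 hf2]] : exists u v, f2 = (u * e1.1 + v * e2.1, u * e1.2 + v * e2.2).
  by apply: in1; apply/jsetP; exists 0, 1; rewrite /f2; congr (_, _); ring.
have [s1 [s2 he1]] : exists u v, e1 = (u * f1.1 + v * f2.1, u * f1.2 + v * f2.2).
  by apply: in2; exists 1, 0; rewrite [LHS]surjective_pairing; congr (_, _); ring.
have [r1 [r2 he2]] : exists u v, e2 = (u * f1.1 + v * f2.1, u * f1.2 + v * f2.2).
  by apply: in2; exists 0, 1; rewrite [LHS]surjective_pairing; congr (_, _); ring.
have d1 := int_det_dvd hf1 hf2; have d2 := int_det_dvd he1 he2.
have df : f1.1 * f2.2 - f1.2 * f2.1 = (c2 * c2 * a2)%N%:Z by rewrite /f1 /f2 /= !PoszM; ring.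
have de : a%:Z * (e1.1 * e2.2 - e1.2 * e2.1) = qnorm p e1.
  rewrite /qnorm /e1 /e2 /=.
  have -> : m = b%:Z ^+ 2 + b%:Z - a%:Z * F by rewrite -hF; ring.
  by ring.
have : absz (e1.1 * e2.2 - e1.2 * e2.1)%R = (c2 * c2 * a2)%N.
  by apply/eqP; rewrite eqn_dvd; apply/andP; split; [move: d1 | move: d2]; rewrite df.
move=> hd; rewrite gval_qint gcnj_qconj -/e1 qnormE // -de intrM normrM.
by rewrite -[X in _ * X]intr_norm -abszE hd -!pmulrn normr_nat.
Qed.

End Ideals.

(** * The ideals of one class *)

Section ClassCount.
Local Open Scope classical_set_scope.

Variables (R : realType) (p : nat) (p_pr : prime p) (p_odd : odd p).
Hypothesis p14 : (p %% 4 = 1)%N.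

Local Notation w := (sqrtp R p).
Local Notation omega := (omega R p).
Local Notation omega' := (omega' R p).
Local Notation qint := (qint R p).
Local Notation qconj := (qconj R p).
Local Notation m := ((quarter p)%:Z).
Local Notation quad_int := (@quad_int R p).
Local Notation quad_unit := (@quad_unit R p).
Local Notation lat := (@lat R p).
Local Notation jset := (@jset R p).
Local Notation valid := (valid p).
Local Notation valid3 := (valid3 p).
Local Notation gval := (gval R p).
Local Notation gcnj := (gcnj R p).
Local Notation qI := (qint_inj p_pr p_odd p14).
Local Notation qP := (quad_intP p_pr p_odd p14).

Lemma quad_field_div (z : int * int) (a : nat) : quad_field p (qint z / a%:R).
Proof.
exists ((z.1%:~R + z.2%:~R / 2) / a%:R), (z.2%:~R / 2 / a%:R).
case: z => x y; rewrite qint_ratr [in RHS]ratr_div [X in _ = _ + X * _]ratr_div !ratr_nat.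
by rewrite /sqrtp; ring.
Qed.

(** Multiplication by [u] acts on the basis [a], [b + omega] by an integer
    matrix, and [u] is a root of its characteristic polynomial. *)
Lemma stable_quad_int (u : R) a b : valid a b ->
  (forall t, lat a b t -> lat a b (u * t)) -> quad_int u.
Proof.
move=> vab st; have a0 : (0 < a)%N by case/and3P: vab.
have aR : a%:R != 0 :> R by rewrite pnatr_eq0 -lt0n.
have [x1 [y1]] := st _ (lat_a R p a b); rewrite latE => h1.
have [x2 [y2]] := st _ (lat_theta R p a b); rewrite latE => h2.
split.
  have -> : u = qint (x1 * a%:Z + y1 * b%:Z, y1) / a%:R by rewrite latE -h1 mulfK.
  exact: quad_field_div.
exists (('X - x1%:P) * ('X - y2%:P) - (y1 * x2)%:P).
  rewrite monicE lead_coefDl ?(monicP (monicMl _ _)) ?monicXsubC //.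
    by rewrite lead_coefM !lead_coefXsubC mulr1.
  rewrite size_polyN (leq_ltn_trans (size_polyC_leq1 _)) //.
  by rewrite size_monicM ?monicXsubC ?polyXsubC_eq0 // !size_XsubC.
rewrite rootE rmorphB rmorphM !rmorphB /= map_polyX !map_polyC /= !hornerE /=.
set th := b%:R + omega in h1 h2.
have th0 : th != 0.
  have -> : th = qint (b%:Z, 1) by rewrite /qint /= mul1r -pmulrn.
  by rewrite qint_eq0 // xpair_eqE andbF.
apply/eqP; apply: (mulIf aR); apply: (mulIf th0); rewrite !mul0r.
have e1 : (u - x1%:~R) * a%:R = y1%:~R * th by rewrite mulrBl h1; ring.
have e2 : (u - y2%:~R) * th = x2%:~R * a%:R by rewrite mulrBl h2; ring.
have -> : ((u - x1%:~R) * (u - y2%:~R) - (y1 * x2)%:~R) * a%:R * th =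
  ((u - x1%:~R) * a%:R) * ((u - y2%:~R) * th) - (y1 * x2)%:~R * a%:R * th by ring.
by rewrite e1 e2 intrM; ring.
Qed.

Lemma stable_unit (u : R) a b : valid a b -> u != 0 ->
  dilate u (lat a b) = lat a b -> quad_unit u.
Proof.
move=> vab u0 h; split.
  by apply: (stable_quad_int vab) => t At; rewrite -h; exists t.
exists u^-1; last by rewrite divff.
apply: (stable_quad_int vab) => t; rewrite -{1}h => -[s As <-].
by rewrite mulKf.
Qed.

Lemma unit_stable (u : R) a b : valid a b -> quad_unit u -> dilate u (lat a b) = lat a b.
Proof.
move=> vab uu; have [ui [v vi uv]] := uu; apply/seteqP; split=> t.
  by case=> s As <-; apply: lat_mul.
move=> At; exists (v * t); first by apply: lat_mul.
by rewrite mulrA uv mul1r.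
Qed.

(** The multiplicative relations used here, conjugated. Positive integer factors
    stand for the denominators, which keeps both sides in the ring. *)
Lemma gval_conj_rel (z : int * int) (k1 k2 a1 b1 a b : nat) (x1 y1 x y : int) :
  qint z * (k1%:R * gval a1 b1 x1 y1) = k2%:R * gval a b x y ->
  qconj z * (k1%:R * gcnj a1 b1 x1 y1) = k2%:R * gcnj a b x y.
Proof.
have e (k : nat) t : k%:R * qint t = qint (k%:Z * t.1, k%:Z * t.2).
  by rewrite /qint /= !intrM -!pmulrn; ring.
have e' (k : nat) t : k%:R * qconj t = qconj (k%:Z * t.1, k%:Z * t.2).
  by rewrite /qconj /= !intrM -!pmulrn; ring.
rewrite !gval_qint !gcnj_qconj !e !e' => h.
rewrite -qintM // in h; rewrite -qconjM //.
by move/qI: h => ->.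
Qed.

Lemma gcnjE a b x y : gcnj a b x y = gval a b x y + y%:~R * w.
Proof. by rewrite /gcnj /gval -(omegaB R p); ring. Qed.

(** If [u] carries a point of the sector to a point of the sector, then [u ^+ 2]
    lies between [E ^- 2] and [E ^+ 2], as the norm of [u] is 1 or -1. *)
Lemma unit_ratio (E u uc g g' h h' : R) : 1 < E -> trivial_units_below p E ->
  quad_unit u -> 0 < u -> `|u * uc| = 1 -> g = u * h -> g' = `|uc| * h' ->
  0 < h -> g <= g' -> g' < E ^+ 2 * g -> h <= h' -> h' < E ^+ 2 * h -> u = 1.
Proof.
move=> E1 tE uu u0 n1 -> -> h0 c1 c2 c3 c4.
have E0 : 0 < E by apply: lt_trans E1.
have ucE : `|uc| = u^-1.
  by apply: (mulfI (lt0r_neq0 u0)); rewrite divff ?lt0r_neq0 // -n1 normrM (gtr0_norm u0).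
rewrite ucE mulrC in c1; rewrite ucE mulrC in c2.
rewrite [_^-1 * _]mulrC ler_pdivlMr // in c1; rewrite ltr_pdivrMr // in c2.
have k1 : u ^+ 2 * h < E ^+ 2 * h by apply: le_lt_trans c4; rewrite expr2 mulrC mulrA.
have k2 : h * 1 < h * (E * u) ^+ 2.
  rewrite mulr1; apply: le_lt_trans c3 _; apply: lt_le_trans c2 _.
  by rewrite exprMn le_eqVlt; apply/orP; left; apply/eqP; ring.
apply: tE => //.
  rewrite -div1r ltr_pdivrMr // mulrC.
  rewrite ltr_pM2l // in k2; rewrite -(ltr_pXn2r (n := 2)) ?expr1n ?nnegrE //.
  by rewrite mulr_ge0 ?ltW.
by rewrite ltr_pM2r // in k1; rewrite -(ltr_pXn2r (n := 2)) ?nnegrE ?ltW.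
Qed.

(** A bound on [c ^ 2 * a] bounds the three entries of a valid triple. *)
Definition triples (X : nat) : seq (nat * nat * nat) :=
  [seq t <- [seq (ca, b) | ca <- [seq (c, a) | c <- index_iota 1 X.+1, a <- index_iota 1 X.+1],
                           b <- index_iota 0 X.+1]
   | valid3 t && (t.1.1 * t.1.1 * t.1.2 <= X)%N].

Lemma triples_uniq X : uniq (triples X).
Proof.
apply: filter_uniq; apply: allpairs_uniq; rewrite ?iota_uniq //.
  by apply: allpairs_uniq; rewrite ?iota_uniq // => [[? ?] [? ?]] _ _ [-> ->].
by move=> [? ?] [? ?] _ _ [-> ->].
Qed.

Lemma mem_triples X t : (t \in triples X) = valid3 t && (t.1.1 * t.1.1 * t.1.2 <= X)%N.
Proof.
case: t => [[c a] b]; rewrite mem_filter; apply: andb_idr => /andP[/andP[c0' /and3P[a0' ba' _]] cX'].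
have {c0'}c0 : (0 < c)%N := c0'; have {a0'}a0 : (0 < a)%N := a0'.
have {ba'}ba : (b < a)%N := ba'; have {cX'}cX : (c * c * a <= X)%N := cX'.
have c1 : (1 <= c * c)%N by rewrite muln_gt0 c0.
have aX : (a <= X)%N by apply: leq_trans cX; rewrite -{1}[a]mul1n leq_mul2r c1 orbT.
have c2 : (c <= X)%N.
  apply: leq_trans cX; rewrite -mulnA -{1}[c]muln1 leq_mul2l muln_gt0 c0 a0 orbT //.
apply: allpairs_f; last by rewrite mem_index_iota ltnS (leq_trans (ltnW ba)).
by apply: allpairs_f; rewrite mem_index_iota ?c0 ?a0 ltnS.
Qed.

Lemma size_triples X : size (triples X) = ideal_count p X.
Proof.
rewrite size_filter -sum1_count big_mkcond big_allpairs_dep big_allpairs_dep /ideal_count.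
apply: eq_big_nat => c /andP[c0 _]; rewrite [RHS]big_mkcond /=.
apply: eq_big_nat => a /andP[a0]; rewrite ltnS => aX.
case: ifP => cX; last by rewrite big1 // => b _ /=; rewrite andbF.
rewrite /rho -sum1_card big_mkcond /= [RHS]big_mkcond /=.
rewrite -(big_mkord xpredT (fun b => if (b : nat) \in [pred b : nat | (a %| Fm p b)%Z] then 1%N else 0%N)) /=.
rewrite [RHS](big_nat_widen 0%N a X.+1 xpredT _ (leqW aX)) [RHS]big_mkcond /=.
apply: eq_bigr => b _; rewrite /valid3 /valid /= c0 a0 /= andbT.
by rewrite inE; case: (b < a)%N.
Qed.

Definition triple_of (I : set R) : nat * nat * nat := xget (0, 0, 0)%N [set t | valid3 t /\ I = jset t].

Lemma triple_ofP (I : set R) : nonzero_ideal p I -> valid3 (triple_of I) /\ I = jset (triple_of I).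
Proof.
move=> /(ideal_normal_form p_pr p_odd p14)[t tv tI].
by rewrite /triple_of; case: xgetP => [t' -> [] //|/(_ t)]; case; split.
Qed.

Lemma triple_of_jset t : valid3 t -> triple_of (jset t) = t.
Proof.
move=> tv; have [v e] := triple_ofP (jset_ideal R p_pr p_odd p14 tv).
by symmetry; apply: (jset_inj p_pr p_odd p14 tv v e).
Qed.

Definition point_ideal (a b : nat) (z : int * nat) : set R :=
  dilate (gval a b z.1 z.2%:Z / a%:R) (lat a b).

Definition in_sector (a b : nat) (E : R) (X : nat) (z : int * nat) : bool :=
  [&& 0 < gval a b z.1 z.2%:Z, gcnj a b z.1 z.2%:Z < E ^+ 2 * gval a b z.1 z.2%:Z &
      gval a b z.1 z.2%:Z * gcnj a b z.1 z.2%:Z <= (a * X)%:R].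

Lemma lattice_sector_count a b (E : R) : (0 < a)%N -> 1 < E ->
  exists C, forall X, (0 < X)%N -> exists s : seq (int * nat),
    [/\ uniq s, forall z, (z \in s) = in_sector a b E X z &
     `|(size s)%:R - ln E / w * X%:R| <= C * Num.sqrt X%:R].
Proof.
move=> a0 E1; have [C hC] := sector_count (fun y : nat => y%:Z%:~R * (b%:R + omega')) a0 (sqrtp_gt0 R p_pr) E1.
exists C => X X0; have [s [su sm ss]] := hC X X0; exists s; split=> // -[x y].
by rewrite sm /in_sector /= gcnjE.
Qed.


Lemma point_ideal_nonzero a b E X z : valid a b -> in_sector a b E X z ->
  nonzero_ideal p (point_ideal a b z).
Proof.
by move=> vab /and3P[v0 _ _]; apply: gval_ideal => //; rewrite gt_eqF.
Qed.

Lemma sector_le a b E X z : in_sector a b E X z -> gval a b z.1 z.2%:Z <= gcnj a b z.1 z.2%:Z.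
Proof. by move=> _; rewrite gcnjE lerDl mulr_ge0 ?ler0z // ltW // sqrtp_gt0. Qed.

(** By [gval_norm] the norm condition of the sector is the norm bound of the
    ideal. *)
Lemma point_triple_mem a b E X z : valid a b -> in_sector a b E X z ->
  triple_of (point_ideal a b z) \in triples X.
Proof.
move=> vab sz; have [v e] := triple_ofP (point_ideal_nonzero vab sz).
rewrite mem_triples v /=; have a0 : (0 < a)%N by case/and3P: vab.
have := gval_norm p_pr p_odd p14 vab v e; have cle := sector_le sz.
have /and3P[v0 _ ] := sz; have c0 := lt_le_trans v0 cle.
rewrite normrM !gtr0_norm // => + nE; rewrite nE (natrM _ a X) ler_pM2l ?ltr0n //.
by rewrite ler_nat.
Qed.

Lemma gval_inj a b x y x' y' : (0 < a)%N -> gval a b x y = gval a b x' y' -> x = x' /\ y = y'.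
Proof.
move=> a0; rewrite !gval_qint => /qI [h1 /oppr_inj h2]; rewrite -h2 in h1 *; split=> //.
by move/addIr: h1; apply: mulIf; rewrite eqz_nat -lt0n.
Qed.

Lemma dilate_eq_unit (g h : R) a b : valid a b -> g != 0 -> h != 0 ->
  dilate g (lat a b) = dilate h (lat a b) -> quad_unit (g / h).
Proof.
move=> vab g0 h0 e; apply: (stable_unit vab); first by rewrite mulf_neq0 // invr_eq0.
by rewrite mulrC -dilateM e dilateM mulVf // dilate1.
Qed.

Lemma point_ideal_inj a b E X z z' : valid a b -> 1 < E -> trivial_units_below p E ->
  in_sector a b E X z -> in_sector a b E X z' ->
  point_ideal a b z = point_ideal a b z' -> z = z'.
Proof.
move=> vab E1 tE sz sz' e; have a0 : (0 < a)%N by case/and3P: vab.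
have aR : a%:R != 0 :> R by rewrite pnatr_eq0 -lt0n.
have cle := sector_le sz; have cle' := sector_le sz'.
have /and3P[v0 vE _] := sz; have /and3P[v0' vE' _] := sz'.
have c0 := lt_le_trans v0 cle; have c0' := lt_le_trans v0' cle'.
have uu : quad_unit (gval a b z.1 z.2%:Z / gval a b z'.1 z'.2%:Z).
  have := dilate_eq_unit vab _ _ e; rewrite !mulf_eq0 invr_eq0 (negbTE aR) !orbF.
  by rewrite !gt_eqF // invf_div mulrA divfK //; apply.
have [ui _] := uu; have [t tE'] := (qP _).1 ui.
have h1 : qint t * (1%:R * gval a b z'.1 z'.2%:Z) = 1%:R * gval a b z.1 z.2%:Z.
  by rewrite -tE' !mul1r divfK // gt_eqF.
have h2 := gval_conj_rel h1; rewrite !mul1r in h1 h2.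
have q0 : 0 < qconj t by have := c0; rewrite -h2 pmulr_lgt0.
have u1 : qint t = 1.
  apply: (@unit_ratio E _ (qconj t) (gval a b z.1 z.2%:Z) (gcnj a b z.1 z.2%:Z)
     (gval a b z'.1 z'.2%:Z) (gcnj a b z'.1 z'.2%:Z)) => //.
  - by rewrite -tE'.
  - by rewrite -tE' divr_gt0.
  - by apply: quad_unit_norm => //; rewrite -tE'.
  - by rewrite gtr0_norm.
move: h1; rewrite u1 mul1r => /(gval_inj a0)[].
by case: z z' {sz sz' e cle cle' v0 vE v0' vE' c0 c0' uu ui tE' h2} => x y [x' y'] /= -> [->].
Qed.

(** The points of one sector give distinct principal ideals, so their density is
    at most that of all ideals. *)
Lemma sector_bound E : 1 < E -> trivial_units_below p E -> ln E / w <= Lvalue R p.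
Proof.
move=> E1 tE.
have v10 : valid 1 0 by rewrite /valid /= dvd1z.
have [C hC] := @lattice_sector_count 1 0 E isT E1.
pose P X (s : seq (int * nat)) := [/\ uniq s, forall z, (z \in s) = in_sector 1 0 E X z &
     `|(size s)%:R - ln E / w * X%:R| <= C * Num.sqrt X%:R].
pose s X : seq (int * nat) := xget [::] (P X).
have sP X : (0 < X)%N -> P X (s X).
  by move=> X0; rewrite /s; case: xgetP => [? -> //|h]; have [t /h] := hC X X0.
apply: (@sqrt_asymp_le R (fun X => (size (s X))%:R) (fun X => (ideal_count p X)%:R)).
- by exists C => X /sP[].
- exact: ideal_count_asymp.
move=> X /sP[su sm _]; rewrite ler_nat -size_triples.
rewrite -(size_map (fun z => triple_of (point_ideal 1 0 z))); apply: uniq_leq_size.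
  rewrite map_inj_in_uniq // => z z'; rewrite !sm => hz hz' e.
  apply: (point_ideal_inj v10 E1 tE hz hz').
  have [_ ->] := triple_ofP (point_ideal_nonzero v10 hz).
  by have [_ ->] := triple_ofP (point_ideal_nonzero v10 hz'); rewrite e.
by move=> _ /mapP[z + ->]; rewrite sm; exact: point_triple_mem.
Qed.

(** For large [E] the conclusion of [sector_bound] fails, so there are units
    besides 1 and -1. *)
Lemma fundamental_unitP : is_fundamental_unit p (fundamental_unit R p).
Proof.
have [e he] : exists e : R, is_fundamental_unit p e.
  (* chosen so that [ln E / w] exceeds the bound of [sector_bound] *)
  pose E := expR (`|Lvalue R p| * w + 1).
  have E1 : 1 < E by rewrite /E expR_gt1 ltr_wpDl // mulr_ge0 // ltW // sqrtp_gt0.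
  apply: (@fundamental_unit_exists R p p_pr p_odd p14 E) => tE.
  have := sector_bound E1 tE; rewrite expRK ler_pdivrMr ?sqrtp_gt0 //.
  have := ler_wpM2r (ltW (sqrtp_gt0 R p_pr)) (ler_norm (Lvalue R p)).
  by move=> h1 h2; have := le_trans h2 h1; rewrite gerDl ler10.
by apply: xgetPex; exists e.
Qed.

Local Notation e := (fundamental_unit R p).

Lemma fundamental_unit_gt1 : 1 < e. Proof. by case: fundamental_unitP. Qed.

Lemma fundamental_unit_trivial_below : trivial_units_below p e.
Proof.
move=> u uu u0 u1 u2; have [eu e1 /(_ u uu)[n]] := fundamental_unitP.
have e0 : 0 < e by apply: lt_trans e1.
have en : 0 < e ^ n by rewrite exprz_gt0.
case=> uE; last by move: u0; rewrite uE oppr_gt0 ltNge (ltW en).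
have n1 : (n < 1)%R by rewrite -(ltr_eXz2l e1) -uE expr1z.
have n2 : (-1 < n)%R by rewrite -(ltr_eXz2l e1) -uE exprN1.
have n0 : n = 0 by move: n1 n2; lia.
by rewrite uE n0 expr0z.
Qed.

(** Multiplying [g] by a power of the fundamental unit shifts the logarithm of
    [|gcnj| / |gval|] by multiples of [2 ln e]. *)
Lemma reduced_multiplier a b (g : R) : valid a b -> g != 0 -> dilate g (lat a b) `<=` quad_int ->
  exists g' x y, [/\ dilate g' (lat a b) = dilate g (lat a b), g' * a%:R = gval a b x y,
    0 < gval a b x y & gval a b x y <= `|gcnj a b x y| < e ^+ 2 * gval a b x y].
Proof.
move=> vab g0 gO; have a0 : (0 < a)%N by case/and3P: vab.
have aR : a%:R != 0 :> R by rewrite pnatr_eq0 -lt0n.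
have [x [y gE]] := ideal_scalar p_pr p_odd p14 vab gO.
have v0 : gval a b x y != 0 by rewrite -gE mulf_neq0.
have c0 : gcnj a b x y != 0 by move: v0; rewrite gval_qint gcnj_qconj qint_eq0 // qconj_eq0.
have [eu e1 _] := fundamental_unitP.
have e0 : 0 < e by apply: lt_trans e1.
have le0 : 0 < 2 * ln e by rewrite mulr_gt0 // ln_gt0.
pose r := `|gcnj a b x y| / `|gval a b x y|.
have r0 : 0 < r by rewrite divr_gt0 ?normr_gt0.
(* multiplication by [e ^ n] lowers [ln r] by [2 n ln e], into [[0, 2 ln e[] *)
pose n := Num.floor (ln r / (2 * ln e)).
have en0 : 0 < e ^ n by rewrite exprz_gt0.
have lnen : ln (e ^ n) = n%:~R * ln e.
  clear -e0; case: n => k; first by rewrite -exprnP lnXn // mulr_natl.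
  by rewrite NegzE -exprnN lnV ?posrE ?exprn_gt0 // lnXn // rmorphN /= mulNr mulr_natl.
pose u := (if 0 < gval a b x y then 1 else -1) * e ^ n.
have uu : quad_unit u.
  apply: quad_unitM => //; last exact: quad_unit_exp.
  by case: ifP => _; [exact: quad_unit1 | apply: quad_unitN => //; exact: quad_unit1].
have un : `|u| = e ^ n by rewrite normrM (gtr0_norm en0); case: ifP => _; rewrite ?normrN normr1 mul1r.
have dE : dilate (g * u) (lat a b) = dilate g (lat a b) by rewrite -dilateM unit_stable.
have [x' [y' gE']] : exists x' y', g * u * a%:R = gval a b x' y'.
  by apply: ideal_scalar => //; rewrite dE.
have vE : gval a b x' y' = u * gval a b x y by rewrite -gE' -gE; ring.
have [ui _] := uu; have [t tE] := (qP _).1 ui.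
have h1 : qint t * (1%:R * gval a b x y) = 1%:R * gval a b x' y' by rewrite -tE !mul1r.
have h2 := gval_conj_rel h1; rewrite !mul1r in h1 h2.
have vE' : gval a b x' y' = e ^ n * `|gval a b x y|.
  rewrite vE /u; case: ifP => v1; first by rewrite mul1r gtr0_norm.
  by rewrite ltr0_norm ?mulN1r ?mulNr ?mulrN // lt_neqAle v0 leNgt v1.
have cE' : `|gcnj a b x' y'| = `|gcnj a b x y| / e ^ n.
  rewrite -h2 normrM mulrC; congr (_ * _).
  have := @quad_unit_norm R p p_pr p_odd p14 t; rewrite -tE => /(_ uu).
  rewrite normrM un => h; apply: (mulfI (lt0r_neq0 en0)).
  by rewrite h divff // lt0r_neq0.
exists (g * u), x', y'; split=> //; first by rewrite vE' mulr_gt0 // normr_gt0.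
rewrite vE' cE' ler_pdivlMr // ltr_pdivrMr //.
have -> : `|gcnj a b x y| = r * `|gval a b x y| by rewrite divfK // normr_eq0.
have r1 (A B : R) : A * B * A = A ^+ 2 * B by ring.
have r2 (A B D : R) : D ^+ 2 * (A * B) * A = (D * A) ^+ 2 * B by ring.
rewrite r1 r2.
rewrite ler_pM2r ?normr_gt0 // ltr_pM2r ?normr_gt0 //.
apply/andP; split.
  rewrite -ler_ln ?posrE ?exprn_gt0 // lnXn // lnen -mulr_natl mulrCA.
  by rewrite -ler_pdivlMr // -floor_geP.
have een : 0 < e * e ^ n by rewrite mulr_gt0.
rewrite -ltr_ln ?posrE ?exprn_gt0 // lnXn // lnM ?posrE // lnen.
have : ln r / (2 * ln e) < (n + 1)%:~R by rewrite -floor_ltP ltzD1.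
rewrite ltr_pdivrMr // intrD => h; apply: (lt_le_trans h).
have r3 (N L : R) : (N + 1%:~R) * (2 * L) = (L + N * L) *+ 2 by ring.
by rewrite r3.
Qed.


Lemma equiv_lat a b (J : set R) : valid a b -> nonzero_ideal p J ->
  (ideal_equiv p (lat a b) J <-> exists2 g : R, g != 0 & J = dilate g (lat a b)).
Proof.
move=> vab [[JO _ _ JM] [j0 Jj0 j00]]; have a0 : (0 < a)%N by case/and3P: vab.
have aR : a%:R != 0 :> R by rewrite pnatr_eq0 -lt0n.
split=> [[al [be [alO al0 beO be0 e2]]]|[g g0 JE]].
  exists (be^-1 * al); first by rewrite mulf_neq0 // invr_eq0.
  by rewrite -dilateM; apply: dilateK.
exists (g * a%:R), a%:R; split=> //.
- by apply: JO; rewrite JE; exists a%:R => //; exact: lat_a.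
- by rewrite mulf_neq0.
- by rewrite [a%:R]pmulrn; exact: quad_int_intr.
- by rewrite JE -!/(dilate _ _) dilateM mulrC.
Qed.

Definition class_triples (C : set (set R)) (X : nat) : seq (nat * nat * nat) :=
  [seq t <- triples X | `[< C (jset t) >]].

(** Multiplication by [sqrt p], of negative norm, keeps the ideal class and
    exchanges points of positive and negative norm. The second lattice [lat a1 b1]
    lets [sector_count], which knows only points of positive norm, count the
    others. *)
Lemma sqrtp_lat a b : valid a b -> exists c1 a1 b1 : nat,
  [/\ (0 < c1)%N, valid a1 b1 & lat a1 b1 = dilate (w / c1%:R) (lat a b)].
Proof.
move=> vab; have w0 : w != 0 by rewrite gt_eqF // sqrtp_gt0.
have wE : w = qint (-1, 2) by rewrite /qint /= /omega; field.
have wO : quad_int w by apply/qP; exists (-1, 2).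
have h : nonzero_ideal p (dilate w (lat a b)).
  apply: dilate_lat_ideal => //.
    by apply: quad_intM => //; rewrite [a%:R]pmulrn; exact: quad_int_intr.
  by apply: quad_intM => //; apply/qP; exists (b%:Z, 1); rewrite /qint /= mul1r -pmulrn.
have [[[c1 a1] b1] /andP[/= c0 v1] e1] := ideal_normal_form p_pr p_odd p14 h.
exists c1, a1, b1; split=> //.
have c1R : c1%:R != 0 :> R by rewrite pnatr_eq0 -lt0n.
by rewrite mulrC -dilateM; apply: dilateK.
Qed.

Lemma sqrtp_conj (c1 a1 b1 a b : nat) (x1 y1 x y : int) z :
  qint z * ((a * 1)%:R * (w * gval a1 b1 x1 y1)) = (a1 * c1)%:R * gval a b x y ->
  qconj z * (a%:R * (- w * gcnj a1 b1 x1 y1)) = (a1 * c1)%:R * gcnj a b x y.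
Proof.
have wE : w = qint (-1, 2) by rewrite /qint /= /omega; field.
have wE' : - w = qconj (-1, 2) by rewrite /qconj /= /omega'; field.
rewrite muln1 => h.
have h' : qint (qmul p z (-1, 2)) * (a%:R * gval a1 b1 x1 y1) = (a1 * c1)%:R * gval a b x y.
  by rewrite -h qintM // -wE; ring.
by rewrite -(gval_conj_rel h') qconjM // -wE'; ring.
Qed.

Section OneClass.
Variables (a b c1 a1 b1 : nat).
Hypotheses (vab : valid a b) (c1_gt0 : (0 < c1)%N) (vab1 : valid a1 b1).
Hypothesis lat1E : lat a1 b1 = dilate (w / c1%:R) (lat a b).
Variables (X : nat) (s s1 : seq (int * nat)).
Hypotheses (su : uniq s) (su1 : uniq s1).
Hypothesis sE : forall z, (z \in s) = in_sector a b e X z.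
Hypothesis s1E : forall z, (z \in s1) = in_sector a1 b1 e X z.

Let C := ideal_class p (lat a b).

Let a_gt0 : (0 < a)%N. Proof. by case/and3P: vab. Qed.
Let a1_gt0 : (0 < a1)%N. Proof. by case/and3P: vab1. Qed.
Let aR : a%:R != 0 :> R. Proof. by rewrite pnatr_eq0 -lt0n. Qed.
Let a1R : a1%:R != 0 :> R. Proof. by rewrite pnatr_eq0 -lt0n. Qed.
Let c1R : c1%:R != 0 :> R. Proof. by rewrite pnatr_eq0 -lt0n. Qed.
Let w_neq0 : w != 0. Proof. by rewrite gt_eqF // sqrtp_gt0. Qed.

Lemma lat_in_class z : in_sector a b e X z -> C (point_ideal a b z).
Proof.
move=> sz; have nz := point_ideal_nonzero vab sz; split=> //.
apply/(equiv_lat vab nz); exists (gval a b z.1 z.2%:Z / a%:R) => //.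
by case/and3P: sz => v0 _ _; rewrite mulf_neq0 ?invr_eq0 // gt_eqF.
Qed.

Lemma lat1_in_class z : in_sector a1 b1 e X z -> C (point_ideal a1 b1 z).
Proof.
move=> sz; have nz := point_ideal_nonzero vab1 sz; split=> //.
apply/(equiv_lat vab nz); exists (gval a1 b1 z.1 z.2%:Z / a1%:R * (w / c1%:R)).
  by case/and3P: sz => v0 _ _; rewrite !mulf_neq0 ?invr_eq0 // gt_eqF.
by rewrite /point_ideal lat1E dilateM.
Qed.

(** Otherwise the two points differ by a unit of norm -1 that maps the sector to
    itself; by [unit_ratio] it is 1, whose norm is 1. *)
Lemma sector_disjoint z z1 : in_sector a b e X z -> in_sector a1 b1 e X z1 ->
  point_ideal a b z <> point_ideal a1 b1 z1.
Proof.
move=> sz sz1 eq12.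
have cle := sector_le sz; have cle1 := sector_le sz1.
have /and3P[v0 vE _] := sz; have /and3P[v01 vE1 _] := sz1.
have c0 := lt_le_trans v0 cle; have c01 := lt_le_trans v01 cle1.
have w0 : 0 < w by exact: sqrtp_gt0.
pose h := gval a1 b1 z1.1 z1.2%:Z; pose h' := gcnj a1 b1 z1.1 z1.2%:Z.
pose g := gval a b z.1 z.2%:Z; pose g' := gcnj a b z.1 z.2%:Z.
have uu : quad_unit ((g / a%:R) / (h / a1%:R * (w / c1%:R))).
  apply: (dilate_eq_unit vab).
  - by rewrite mulf_neq0 ?invr_eq0 // gt_eqF.
  - by rewrite !mulf_neq0 ?invr_eq0 // gt_eqF.
  - by rewrite -[LHS]/(point_ideal a b z) eq12 /point_ideal lat1E dilateM.
have [ui _] := uu; have [t tE] := (qP _).1 ui.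
have h0 : h != 0 by rewrite gt_eqF.
have e1 : qint t * ((a * 1)%:R * (w * h)) = (a1 * c1)%:R * g.
  by rewrite -tE muln1 natrM; field; rewrite c1R aR a1R h0 w_neq0.
have e2 := sqrtp_conj e1; rewrite -/h' -/g' in e2; rewrite muln1 in e1.
have aR0 : 0 < a%:R :> R by rewrite ltr0n.
have k0 : 0 < (a1 * c1)%:R :> R by rewrite ltr0n muln_gt0 a1_gt0.
have q0 : qconj t < 0.
  have : 0 < (a1 * c1)%:R * g' by rewrite mulr_gt0.
  rewrite -e2 mulNr mulrN mulrN oppr_gt0 pmulr_llt0 //.
  by rewrite !mulr_gt0.
have u1 : qint t = 1.
  apply: (@unit_ratio e _ (qconj t) ((a1 * c1)%:R * g) ((a1 * c1)%:R * g')
     (a%:R * (w * h)) (a%:R * (w * h'))) => //.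
  - exact: fundamental_unit_gt1.
  - exact: fundamental_unit_trivial_below.
  - by rewrite -tE.
  - by rewrite -tE !(divr_gt0, mulr_gt0) // ?invr_gt0 ?ltr0n.
  - by apply: quad_unit_norm => //; rewrite -tE.
  - by rewrite ltr0_norm // -e2; ring.
  - by rewrite !mulr_gt0.
  - by rewrite ler_pM2l.
  - by rewrite mulrCA ltr_pM2l.
  - by rewrite ler_pM2l // ler_pM2l.
  - by rewrite !(mulrCA (e ^+ 2)) ltr_pM2l // ltr_pM2l.
have : t = (1, 0) by apply: (@qint_inj R p p_pr p_odd p14); rewrite u1 qint1.
by move=> tE1; move: q0; rewrite tE1 qconj1 ltr10.
Qed.

(** The reduced multiplier is a point of the first sector or, after division by
    [sqrt p], of the second, according to the sign of its norm. *)
Lemma class_cover t : t \in class_triples C X ->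
  (exists2 z, z \in s & t = triple_of (point_ideal a b z)) \/
  (exists2 z, z \in s1 & t = triple_of (point_ideal a1 b1 z)).
Proof.
rewrite mem_filter mem_triples => /andP[/asboolP [nz /(equiv_lat vab nz)[g g0 JE]] /andP[vt tX]].
have JO : jset t `<=` quad_int by case: nz => -[].
have [g' [x [y [dE gE v0 /andP[c1' c2']]]]] := reduced_multiplier vab g0 (eq_ind _ (fun A => A `<=` quad_int) JO _ JE).
have JE' : jset t = dilate g' (lat a b) by rewrite dE.
have w0 : 0 < w by exact: sqrtp_gt0.
have g'E : g' = gval a b x y / a%:R by rewrite -gE mulfK.
have key (a2 b2 : nat) (x2 y2 : int) (s2 : seq (int * nat)) : valid a2 b2 ->
    (forall z, (z \in s2) = in_sector a2 b2 e X z) ->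
    0 < gval a2 b2 x2 y2 -> gval a2 b2 x2 y2 <= gcnj a2 b2 x2 y2 ->
    gcnj a2 b2 x2 y2 < e ^+ 2 * gval a2 b2 x2 y2 ->
    jset t = dilate (gval a2 b2 x2 y2 / a2%:R) (lat a2 b2) ->
    exists2 z, z \in s2 & t = triple_of (point_ideal a2 b2 z).
  move=> v2 s2E k1 k2 k3 JE2.
  have y0 : (0 <= y2)%R.
    by move: k2; rewrite gcnjE lerDl pmulr_lge0 // ler0z.
  have yE : y2 = `|y2|%N%:Z by rewrite abszE ger0_norm.
  exists (x2, `|y2|%N); last first.
    by rewrite /point_ideal /= -yE -JE2 triple_of_jset.
  rewrite s2E /in_sector /= -yE k1 k3 /=.
  have := gval_norm p_pr p_odd p14 v2 vt (esym JE2).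
  have k4 := lt_le_trans k1 k2.
  by rewrite normrM !gtr0_norm // => ->; rewrite (natrM _ a2 X) ler_wpM2l // ler_nat.
have [c0|c0] := ltrP 0 (gcnj a b x y).
  left; apply: (key a b x y s vab sE) => //.
  - by rewrite -(gtr0_norm c0).
  - by rewrite -(gtr0_norm c0).
  - by rewrite -g'E.
right.
have cE : `|gcnj a b x y| = - gcnj a b x y by rewrite ler0_norm.
have JE1 : jset t = dilate (g' * (c1%:R / w)) (lat a1 b1).
  rewrite lat1E dilateM JE' -mulrA; congr (dilate _ _).
  by rewrite -[LHS]mulr1; congr (_ * _); field; rewrite c1R w_neq0.
have [x1 [y1 g1E]] : exists x1 y1, g' * (c1%:R / w) * a1%:R = gval a1 b1 x1 y1.
  by apply: ideal_scalar => //; rewrite -JE1.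
have e1 : qint (1, 0) * ((a * 1)%:R * (w * gval a1 b1 x1 y1)) = (a1 * c1)%:R * gval a b x y.
  by rewrite -g1E g'E qint1 muln1 natrM; field; rewrite aR w_neq0.
have e2 := sqrtp_conj e1; rewrite qint1 muln1 mul1r in e1; rewrite qconj1 mul1r in e2.
have aR0 : 0 < a%:R :> R by rewrite ltr0n.
have k0 : 0 < (a1 * c1)%:R :> R by rewrite ltr0n muln_gt0 a1_gt0.
have aw : 0 < a%:R * w by rewrite mulr_gt0.
have e1' : (a%:R * w) * gval a1 b1 x1 y1 = (a1 * c1)%:R * gval a b x y by rewrite -e1 mulrA.
have e2' : (a%:R * w) * gcnj a1 b1 x1 y1 = (a1 * c1)%:R * `|gcnj a b x y|.
  by rewrite cE mulrN -e2; ring.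
apply: (key a1 b1 x1 y1 s1 vab1 s1E).
- by rewrite -(pmulr_rgt0 _ aw) e1' mulr_gt0.
- by rewrite -(ler_pM2l aw) e1' e2' ler_pM2l.
- by rewrite -(ltr_pM2l aw) mulrCA e1' e2' mulrCA ltr_pM2l.
- by rewrite -g1E mulfK.
Qed.

Lemma size_class_triples : size (class_triples C X) = (size s + size s1)%N.
Proof.
pose f z := triple_of (point_ideal a b z); pose f1 z := triple_of (point_ideal a1 b1 z).
have fP z : z \in s -> valid3 (f z) /\ point_ideal a b z = jset (f z).
  by rewrite sE => h; apply: triple_ofP; exact: point_ideal_nonzero h.
have f1P z : z \in s1 -> valid3 (f1 z) /\ point_ideal a1 b1 z = jset (f1 z).
  by rewrite s1E => h; apply: triple_ofP; exact: point_ideal_nonzero h.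
rewrite -(size_map f s) -(size_map f1 s1) -size_cat; apply/perm_size/uniq_perm.
- by apply: filter_uniq; exact: triples_uniq.
- rewrite cat_uniq; apply/and3P; split.
  + rewrite map_inj_in_uniq // => z z' hz hz' eq12; move: (hz) (hz'); rewrite !sE => h h'.
    apply: (point_ideal_inj vab fundamental_unit_gt1 fundamental_unit_trivial_below h h').
    by rewrite (fP _ hz).2 (fP _ hz').2 eq12.
  + apply/hasPn => _ /mapP[z1 hz1 ->]; apply/negP => /mapP[z hz eq12].
    move: (hz) (hz1); rewrite sE s1E => h h1.
    by apply: (sector_disjoint h h1); rewrite (fP _ hz).2 (f1P _ hz1).2 eq12.
  + rewrite map_inj_in_uniq // => z z' hz hz' eq12; move: (hz) (hz'); rewrite !s1E => h h'.
    apply: (point_ideal_inj vab1 fundamental_unit_gt1 fundamental_unit_trivial_below h h').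
    by rewrite (f1P _ hz).2 (f1P _ hz').2 eq12.
- move=> t; rewrite mem_cat; apply/idP/idP.
    by case/class_cover=> -[z hz ->]; apply/orP; [left|right]; exact: map_f.
  case/orP=> /mapP[z hz ->]; rewrite mem_filter; apply/andP; split.
  + by apply/asboolP; rewrite -(fP _ hz).2; apply: lat_in_class; rewrite -sE.
  + by move: hz; rewrite sE; exact: point_triple_mem.
  + by apply/asboolP; rewrite -(f1P _ hz).2; apply: lat1_in_class; rewrite -s1E.
  + by move: hz; rewrite s1E; exact: point_triple_mem.
Qed.

End OneClass.

(** All classes have the same density of ideals, which is what makes their number
    computable. *)
Lemma class_triples_asymp a b : valid a b ->
  sqrt_asymp (fun X => (size (class_triples (ideal_class p (lat a b)) X))%:R : R) (2 * ln e / w).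
Proof.
move=> vab; have [c1 [a1 [b1 [c1_gt0 vab1 lat1E]]]] := sqrtp_lat vab.
have a0 : (0 < a)%N by case/and3P: vab.
have a10 : (0 < a1)%N by case/and3P: vab1.
have [K hK] := lattice_sector_count b a0 fundamental_unit_gt1.
have [K1 hK1] := lattice_sector_count b1 a10 fundamental_unit_gt1.
exists (K + K1) => X X0; have [s [su sE sS]] := hK X X0; have [s1 [su1 s1E s1S]] := hK1 X X0.
rewrite (size_class_triples vab c1_gt0 vab1 lat1E su su1 sE s1E) natrD [(K + K1) * _]mulrDl.
apply: le_trans (lerD sS s1S); apply: le_trans (ler_normD _ _).
by rewrite le_eqVlt; apply/orP; left; apply/eqP; congr `|_|; rewrite -mulrA; ring.
Qed.

End ClassCount.

(** * The class number formula *)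

Section ClassNumber.
Local Open Scope classical_set_scope.

Variables (R : realType) (p : nat) (p_pr : prime p) (p_odd : odd p).
Hypothesis p14 : (p %% 4 = 1)%N.

Local Notation w := (sqrtp R p).
Local Notation lat := (@lat R p).
Local Notation e := (fundamental_unit R p).

Lemma ideal_equiv_refl (I : set R) : ideal_equiv p I I.
Proof.
have h1 : quad_int p (1 : R) by exact: quad_int1.
by exists 1, 1; split=> //; rewrite oner_neq0.
Qed.

Lemma ideal_equiv_sym (I J : set R) : ideal_equiv p I J -> ideal_equiv p J I.
Proof. by move=> [al [be [h1 h2 h3 h4 h5]]]; exists be, al; split. Qed.

Lemma ideal_equiv_trans (I J K : set R) :
  ideal_equiv p I J -> ideal_equiv p J K -> ideal_equiv p I K.
Proof.
move=> [al [be [h1 h2 h3 h4 h5]]] [ga [de [k1 k2 k3 k4 k5]]].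
exists (ga * al), (be * de); split; rewrite ?mulf_neq0 //; try exact: quad_intM.
rewrite -!/(dilate _ _) in h5 k5 *.
by rewrite -dilateM h5 dilateM [ga * be]mulrC -(dilateM be ga) k5 dilateM.
Qed.

Lemma ideal_class_eq (I J : set R) : ideal_equiv p I J -> ideal_class p I = ideal_class p J.
Proof.
move=> h; apply/seteqP; split=> K [nK hK]; split=> //; apply: ideal_equiv_trans hK => //.
exact: ideal_equiv_sym.
Qed.

Lemma ideal_classesP (C : set (set R)) : ideal_classes p C ->
  exists a b, valid p a b /\ C = ideal_class p (lat a b).
Proof.
case=> I nI <-; have [[[c a] b] /andP[/= c0 vab] IE] := ideal_normal_form p_pr p_odd p14 nI.
exists a, b; split=> //; apply: ideal_class_eq; apply: ideal_equiv_sym.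
apply/(equiv_lat p_pr p_odd p14 vab nI); exists c%:R => //.
by rewrite pnatr_eq0 -lt0n.
Qed.

Lemma mem_class_unique (C D : set (set R)) (I : set R) : ideal_classes p C -> ideal_classes p D ->
  C I -> D I -> C = D.
Proof.
move=> [J nJ <-] [K nK <-] [_ h] [_ k]; apply: ideal_class_eq.
by apply: ideal_equiv_trans h _; exact: ideal_equiv_sym.
Qed.

Lemma sum_class_triples (s : seq (set (set R))) X : uniq s ->
  (forall C, C \in s -> ideal_classes p C) ->
  (\sum_(C <- s) size (class_triples p C X))%N =
    count (fun t => has (fun C : set (set R) => `[< C (@jset R p t) >]) s) (triples p X).
Proof.
elim: s => [|C s IH] /=; first by rewrite big_nil (@eq_count _ _ pred0) ?count_pred0.
move=> /andP[Cs us] hs; rewrite big_cons IH //; last first.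
  by move=> D Ds; apply: hs; rewrite inE Ds orbT.
rewrite /class_triples size_filter -count_predUI.
rewrite [X in (_ + X)%N](@eq_count _ _ pred0) ?count_pred0 ?addn0 // => t /=.
apply/negP => /andP[/asboolP Ct /hasP[D Ds /asboolP Dt]].
have hC : ideal_classes p C by apply: hs; rewrite mem_head.
have hD : ideal_classes p D by apply: hs; rewrite inE Ds orbT.
by move: Cs; rewrite (mem_class_unique hC hD Ct Dt) Ds.
Qed.

Let kappa : R := 2 * ln e / w.

Let kappa_gt0 : 0 < kappa.
Proof.
by rewrite divr_gt0 ?sqrtp_gt0 // mulr_gt0 // ln_gt0 // fundamental_unit_gt1.
Qed.

Lemma sum_class_asymp (s : seq (set (set R))) :
  (forall C, C \in s -> ideal_classes p C) ->
  sqrt_asymp (fun X => (\sum_(C <- s) size (class_triples p C X))%N%:R : R) ((size s)%:R * kappa).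
Proof.
move=> hs.
have h := @sqrt_asymp_sum R _ s (fun C X => (size (class_triples p C X))%:R) kappa.
have {h} : sqrt_asymp (fun X => \sum_(C <- s) (size (class_triples p C X))%:R : R) ((size s)%:R * kappa).
  apply: h => C Cs; have [a [b [vab ->]]] := ideal_classesP (hs _ Cs).
  exact: class_triples_asymp.
by apply: sqrt_asymp_ext => X _; rewrite natr_sum.
Qed.

(** Finiteness of the class group comes out of the count: distinct classes contain
    distinct ideals, and each class has the density [kappa]. *)
Lemma size_classes_le (s : seq (set (set R))) : uniq s ->
  (forall C, C \in s -> ideal_classes p C) -> (size s)%:R * kappa <= Lvalue R p.
Proof.
move=> us hs; apply: (sqrt_asymp_le (sum_class_asymp hs) (ideal_count_asymp R p_pr p_odd p14)).
by move=> X X0; rewrite ler_nat sum_class_triples // -size_triples count_size.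
Qed.

Lemma finite_ideal_classes : finite_set (@ideal_classes R p).
Proof.
apply: contrapT => inf.
have [B BA Bn] := infinite_set_fset (Num.bound (`|Lvalue R p| / kappa)) inf.
have h : (#|` B|)%:R * kappa <= Lvalue R p.
  by apply: size_classes_le; [exact: fset_uniq | move=> C CB; exact: BA].
have := archi_boundP (divr_ge0 (normr_ge0 (Lvalue R p)) (ltW kappa_gt0)).
rewrite ltr_pdivrMr // => h1; have := le_lt_trans (ler_norm _) h1.
apply/negP; rewrite -leNgt; apply: le_trans h.
by rewrite ler_pM2r // ler_nat.
Qed.

(** Equality, because each ideal lies in one of the classes. *)
Lemma class_number_formula : (class_number R p)%:R * kappa = Lvalue R p.
Proof.
pose F := fset_set (@ideal_classes R p).
have FE C : (C \in F) <-> ideal_classes p C.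
  by rewrite in_fset_set ?inE //; exact: finite_ideal_classes.
have hs : forall C, C \in (F : seq _) -> ideal_classes p C by move=> C /FE.
have h1 := sum_class_asymp hs.
apply: (sqrt_asymp_unique h1); apply: sqrt_asymp_ext (ideal_count_asymp R p_pr p_odd p14) => X X0.
rewrite (sum_class_triples _ (fset_uniq F) hs) -size_triples; congr (_%:R); apply/esym.
rewrite -[RHS](count_predT); apply: eq_in_count => t; rewrite mem_triples => /andP[vt _] /=.
have nt := jset_ideal R p_pr p_odd p14 vt.
apply/hasP; exists (ideal_class p (@jset R p t)); first by apply/FE; exists (@jset R p t).
by apply/asboolP; split=> //; exact: ideal_equiv_refl.
Qed.

Lemma chord_char_class_number :
  chord_char R p = e ^- (4 * class_number R p).
Proof.
have w0 := sqrtp_gt0 R p_pr; have e1 := fundamental_unit_gt1 R p_pr p_odd p14.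
have e0 : 0 < e by apply: lt_trans e1.
have c0 := chord_char_gt0 R p_pr.
have h := class_number_formula; rewrite /Lvalue -/(sqrtp R p) /kappa in h.
have hl : ln (chord_char R p) = - ((4 * class_number R p)%:R * ln e).
  apply: oppr_inj; rewrite opprK.
  have w20 : 2 * w != 0 by rewrite mulf_neq0 // gt_eqF.
  rewrite -[LHS](divfK w20) -h natrM; field.
  by rewrite gt_eqF.
apply: ln_inj; rewrite ?posrE ?invr_gt0 ?exprn_gt0 //.
by rewrite hl lnV ?posrE ?exprn_gt0 // lnXn // mulr_natl.
Qed.

End ClassNumber.

(** * Evaluation of the product *)

Theorem theorem1p5 (R : realType) (p : nat) (a : int) :
  prime p -> odd p -> ~~ (p %| a)%Z ->
  let n := ((p - 1) %/ 2)%N in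
  let P : R[i] :=
    \prod_(1 <= j < n.+1) \prod_(j.+1 <= k < n.+1)
      (zeta R p ^ (a * j%:Z ^+ 2) + zeta R p ^ (a * k%:Z ^+ 2)) in
  let C : R :=
    \prod_(1 <= j < n.+1) \prod_(j.+1 <= k < n.+1)
      cos (pi * (a * (k%:Z ^+ 2 - j%:Z ^+ 2))%:~R / p%:R) in
  let eps : R :=
    fundamental_unit R p
      ^ ((legendre a p * (class_number R p)%:Z * (legendre 2 p - 1)) %/ 2)%Z in
  [/\ ((-1) ^ (a * ((p + 1) %/ 2)%N%:Z * ((p - 1) %/ 4)%N%:Z)
        * 2 ^+ ((p - 1) * (p - 3) %/ 8)%N * C)%:C = P,
      (p %% 4 = 3)%N -> P = 1 &
      (p %% 4 = 1)%N -> P = eps%:C \/ P = - eps%:C].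
Proof.
move=> p_pr p_odd pa n P C eps.
have PE : P = (real_product R p a)%:C by exact: zeta_product_real.
split; first by rewrite PE.
  by move=> p34; rewrite PE real_product3.
move=> p14.
have e1 := fundamental_unit_gt1 R p_pr p_odd p14.
have e0 : 0 < fundamental_unit R p by apply: lt_trans e1.
pose k : int := ((legendre a p * (class_number R p)%:Z * (legendre 2 p - 1)) %/ 2)%Z.
(* [legendre 2 p - 1] is 0 or -2, so the division by 2 is exact *)
have kE : legendre a p * (class_number R p)%:Z * (legendre 2 p - 1) = k * 2.
  rewrite /k divzK //; apply: dvdz_mull.
  have p2 : (p %| 2)%Z = false.
    apply/negbTE; rewrite dvdzE /=; apply/negP => /dvdn_leq -/(_ isT).
    by have := odd_prime_gt2 p_odd p_pr; lia.
  by rewrite /legendre p2; case: ifP.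
have P16 : real_product R p a ^+ 16 = (eps ^+ 2) ^+ 8.
  have := real_product_chord_char R p_pr p_odd pa.
  rewrite (chord_char_class_number R p_pr p_odd p14) exprnN exprz_exp; set d := (X in _ ^ X) => hP.
  have q0 (i : int) : fundamental_unit R p ^ i != 0 by rewrite gt_eqF // exprz_gt0.
  apply: (mulIf (q0 d)); rewrite hP -exprM exprnP /eps -/k exprz_exp -expfzDr ?gt_eqF //.
  have -> : k * (2 * 8)%N%:Z + d = 0.
    have -> : k * (2 * 8)%N%:Z = (k * 2) * 8 by ring.
    by rewrite -kE /d PoszM; ring.
  by rewrite expr0z.
have P2 : real_product R p a ^+ 2 = eps ^+ 2.
  have ep : 0 <= eps ^+ 2 by rewrite sqr_ge0.
  by apply/eqP; rewrite -(eqrXn2 (n := 8)) ?sqr_ge0 // -P16 -exprM.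
rewrite PE -rmorphN /=; move/eqP: P2; rewrite eqf_sqr => /orP[/eqP ->|/eqP ->].
  by left.
by right.
Qed.
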